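(* Let $\mathbb L\in\{\mathbb R,\mathbb C\}$, $\mathbb K\in\{\mathbb R,\mathbb L\}$, $s\in\{\infty,\omega\}$, $r\in\mathbb N_0\cup\{\infty,\omega\}$ with $r\le s$, and let $G$ be a $C^s_{\mathbb K}$-Lie group. If $n\in\mathbb N$ and $E_1,\ldots,E_n$ are equivariant $\mathbb L$-vector bundles of class $C^r_{\mathbb K}$ over a $G$-manifold $M$ of class $C^r_{\mathbb K}$, then also the Whitney sum $E_1\oplus\cdots\oplus E_n$ is an equivariant $\mathbb L$-vector bundle of class $C^r_{\mathbb K}$ over $M$.
   Context: All locally convex spaces are Hausdorff; manifolds and Lie groups are modeled on (possibly infinite-dimensional) locally convex $\mathbb K$-spaces. $n<\infty<\omega$ for $n\in\mathbb N_0$. Complex spaces are regarded as real ones when $\mathbb K=\mathbb R$. $C^r_{\mathbb K}$-maps (Keller's $C^r_c$-theory): for $r\in\mathbb N_0\cup\{\infty\}$, a map $f\colon U\to H$ from an open subset $U$ of a locally convex $\mathbb K$-space $X$ to a locally convex $\mathbb K$-space $H$ is $C^r_{\mathbb K}$ if it is continuous and for all $j\in\mathbb N$ with $j\le r$ the iterated directional derivatives $d^jf(x,y_1,\ldots,y_j)=(D_{y_j}\cdots D_{y_1}f)(x)$ (over $\mathbb K$) exist and define a continuous map $U\times X^j\to H$. $C^\omega_{\mathbb C}$ means complex analytic (continuous and locally a pointwise convergent series of continuous homogeneous complex polynomials; equivalent to $C^\infty_{\mathbb C}$); $C^\omega_{\mathbb R}$ means: extends to a complex analytic map to $H_{\mathbb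 C}$ on an open neighbourhood of $U$ in $X_{\mathbb C}$. Manifolds and Lie groups are defined as usual. An $\mathbb L$-vector bundle of class $C^r_{\mathbb K}$ over $M$ with typical fibre a locally convex $\mathbb L$-vector space $F$ is a $C^r_{\mathbb K}$-manifold $E$ with a surjective $C^r_{\mathbb K}$-map $\pi\colon E\to M$ and an $\mathbb L$-vector space structure on each fibre $E_x=\pi^{-1}(\{x\})$ such that each $x\in M$ has an open neighbourhood $U\subseteq M$ with a $C^r_{\mathbb K}$-diffeomorphism $\psi\colon\pi^{-1}(U)\to U\times F$ (a local trivialization) satisfying $\psi(E_y)=\{y\}\times F$ and $\mathrm{pr}_F\circ\psi|_{E_y}\colon E_y\to F$ $\mathbb L$-linear for all $y\in U$ ($\mathrm{pr}_F$ is the projection to $F$). A $G$-manifold of class $C^r_{\mathbb K}$ is a $C^r_{\mathbb K}$-manifold $M$ with a $C^r_{\mathbb K}$-action $\alpha\colon G\times M\to M$. An equivariant $\mathbb L$-vector bundle of class $C^r_{\mathbb K}$ over $(M,\alpha)$ is an $\mathbb L$-vector bundle $\pi\colon E\to M$ of class $C^r_{\mathbb K}$ with a $C^r_{\mathbb K}$-action $\beta\colon G\times E\to E$ such that $\beta(g,E_x)\subseteq E_{\alpha(g,x)}$ and $\beta(g,\cdot)|_{E_x}\colon E_x\to E_{\alpha(g,x)}$ is $\mathbb L$-linear for all $(g,x)\in G\times M$. Whitney sum: if $\pi_k\colon E_k\to M$ has typical fibre $F_k$ and action $\beta_k$, then $E_1\oplus\cdots\oplus E_n:=\bigcup_{x\in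 M}(E_1)_x\times\cdots\times(E_n)_x$ with the apparent projection $\pi$ to $M$, with the unique $\mathbb L$-vector bundle structure of class $C^r_{\mathbb K}$ such that $\pi^{-1}(U)\to U\times F_1\times\cdots\times F_n$, $v=(v_1,\ldots,v_n)\mapsto(\pi(v),\mathrm{pr}_{F_1}(\psi_1(v_1)),\ldots,\mathrm{pr}_{F_n}(\psi_n(v_n)))$ is a local trivialization for all families of local trivializations $\psi_k\colon\pi_k^{-1}(U)\to U\times F_k$ over a joint open subset $U\subseteq M$, and with the $G$-action $\beta(g,v):=(\beta_1(g,v_1),\ldots,\beta_n(g,v_n))$. *)

(* Defs.v *)
From HB Require Import structures.
From mathcomp Require Import all_boot all_order all_algebra.
From mathcomp Require Import all_classical all_reals all_analysis.
From mathcomp Require Import complex.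

Set Implicit Arguments.
Unset Strict Implicit.
Unset Printing Implicit Defensive.

Import Order.TTheory GRing.Theory Num.Theory.
Import numFieldNormedType.Exports.

Local Open Scope classical_set_scope.
Local Open Scope ring_scope.

Variant base_field := RealNumbers | ComplexNumbers.

Definition base_scalars (R : realType) (K : base_field) : numFieldType :=
  match K with RealNumbers => R | ComplexNumbers => R[i] end.

(* For L in {R, C}, this says K in {R, L}. *)
Definition base_subfield (K L : base_field) : bool :=
  match K, L with ComplexNumbers, RealNumbers => false | _, _ => true end.

Record field_inclusion (K L : numFieldType) := FieldInclusion {
  field_incl :> {rmorphism K -> L};
  field_incl_continuous : continuous (field_incl : K^o -> L^o);
  field_incl_mono : {mono field_incl : x y / x <= y} }.

Program Definition id_inclusion (K : numFieldType) : field_inclusion K K :=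
  @FieldInclusion K K idfun _ _.
Next Obligation. by move=> K x; exact: cvg_id. Qed.
Next Obligation. by []. Qed.

Program Definition real_complex_inclusion (R : realType) :
    field_inclusion R R[i] :=
  @FieldInclusion R R[i] (real_complex R) _ _.
Next Obligation.
move=> R x; apply/(@cvgrPdist_lt _ R[i]^o) => e e0.
have [eE e0'] : e = (complex.Re e)%:C%C /\ 0 < complex.Re e.
  by case: e e0 => a b /=; rewrite ltcE /= => /andP[/eqP -> ->].
near=> y.
rewrite -rmorphB normc_def /= expr0n addr0 sqrtr_sqr eE ltcR.
near: y; exact: (@cvgr_dist_lt _ R^o).
Unshelve. all: by end_near. Qed.
Next Obligation. by move=> R x y /=; rewrite lecR. Qed.

Definition base_inclusion (R : realType) (K L : base_field) :
    base_subfield K L ->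
    field_inclusion (base_scalars R K) (base_scalars R L) :=
  match K, L
    return base_subfield K L ->
      field_inclusion (base_scalars R K) (base_scalars R L)
  with
  | RealNumbers, RealNumbers => fun=> id_inclusion R
  | RealNumbers, ComplexNumbers => fun=> real_complex_inclusion R
  | ComplexNumbers, ComplexNumbers => fun=> id_inclusion R[i]
  | ComplexNumbers, RealNumbers => fun h => False_rect _ (notF h)
  end.

Lemma convex_setE (K : numDomainType) (V : lmodType K) (A : set V) :
  convex_set A <->
  (forall (t : K) x y, 0 <= t -> t <= 1 -> A x -> A y ->
     A (t *: x + (1 - t) *: y)).
Proof.
split=> [cA t x y t0 t1 Ax Ay|cA x y l].
  by have /set_mem := cA x y (Itv01 t0 t1) (mem_set Ax) (mem_set Ay).
rewrite !inE => Ax Ay; apply: cA => //.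
Qed.

Lemma pair_continuous (S T U : topologicalType) (f : S -> T) (g : S -> U) :
  continuous f -> continuous g -> continuous (fun x => (f x, g x)).
Proof.
move=> cf cg x; apply: (@cvg_pair _ _ _ (nbhs x) (nbhs (f x)) (nbhs (g x))).
  exact: cf.
exact: cg.
Qed.

(* Restriction of scalars: an L-space regarded as a K-space. *)
Definition restrict_scalars (K L : numFieldType) (i : field_inclusion K L)
  (V : Type) : Type := V.

Section restrict_scalars.
Variables (K L : numFieldType) (i : field_inclusion K L) (V : tvsType L).
Local Notation W := (restrict_scalars i V).

HB.instance Definition _ := Uniform.copy W V.
HB.instance Definition _ := GRing.Zmodule.copy W V.

Definition restrict_scale (a : K) (v : W) : W := i a *: (v : V).

Fact restrict_scaleA a b v :
  restrict_scale a (restrict_scale b v) = restrict_scale (a * b) v.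
Proof. by rewrite /restrict_scale scalerA rmorphM. Qed.
Fact restrict_scale1 : left_id 1 restrict_scale.
Proof. by move=> v; rewrite /restrict_scale rmorph1 scale1r. Qed.
Fact restrict_scaleDr : right_distributive restrict_scale +%R.
Proof. by move=> a u v; rewrite /restrict_scale scalerDr. Qed.
Fact restrict_scaleDl v : {morph restrict_scale^~ v : a b / a + b}.
Proof. by move=> a b; rewrite /restrict_scale rmorphD scalerDl. Qed.

HB.instance Definition _ := GRing.Zmodule_isLmodule.Build K W
  restrict_scaleA restrict_scale1 restrict_scaleDr restrict_scaleDl.

Fact restrict_add_continuous : continuous (fun x : W * W => x.1 + x.2).
Proof. exact: (@add_continuous V). Qed.

HB.instance Definition _ :=
  PreTopologicalNmodule_isTopologicalNmodule.Build W restrict_add_continuous.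

Fact restrict_scale_continuous :
  continuous (fun z : K^o * W => z.1 *: z.2).
Proof.
move=> z; apply: (@continuous_comp (K^o * W)%type (L^o * V)%type V
  (fun z => (i z.1, z.2)) (fun z => z.1 *: z.2)).
  apply: pair_continuous => {}z; last exact: cvg_snd.
  apply: (@continuous_comp (K^o * W)%type K^o L^o fst (fun a => i a)).
    exact: cvg_fst.
  exact: field_incl_continuous.
exact: scale_continuous.
Qed.

HB.instance Definition _ := TopologicalNmodule_isTopologicalLmodule.Build
  K W restrict_scale_continuous.

Fact restrict_locally_convex : exists2 B : set_system W,
  (forall b, b \in B -> convex_set b) & basis B.
Proof.
have [B Bc Bb] := @locally_convex L V.
exists B => // b /Bc /convex_setE bc; apply/convex_setE => t x y t0 t1 bx bY.
have := bc (i t) x y; rewrite -(rmorph0 i) -(rmorph1 i) !field_incl_mono.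
by rewrite -rmorphB; exact.
Qed.

HB.instance Definition _ := Uniform_isTvs.Build K W restrict_locally_convex.

End restrict_scalars.

(* The complexification of a real space: (x, y) stands for x + i y. *)
Definition complexify (V : Type) : Type := (V * V)%type.

Section complexify.
Variables (R : realType) (V : tvsType R).
Local Notation W := (complexify V).

HB.instance Definition _ := Uniform.copy W (V * V)%type.
HB.instance Definition _ := GRing.Zmodule.copy W (V * V)%type.

Definition complexify_scale (c : R[i]) (w : W) : W :=
  (complex.Re c *: w.1 - complex.Im c *: w.2,
   complex.Re c *: w.2 + complex.Im c *: w.1).

Fact complexify_scaleA a b w :
  complexify_scale a (complexify_scale b w) = complexify_scale (a * b) w.
Proof.
case: a b w => [a a'] [b b'] [x y]; rewrite /complexify_scale /=.
rewrite !scalerBr !scalerDr !scalerA !scalerBl !scalerDl.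
congr (_, _).
- by rewrite !opprD -!addrA; congr +%R; rewrite addrA addrC.
- by rewrite -!addrA; congr +%R; rewrite addrA addrC.
Qed.
Fact complexify_scale1 : left_id 1 complexify_scale.
Proof.
by case=> x y; rewrite /complexify_scale /= !scale1r !scale0r subr0 addr0.
Qed.
Fact complexify_scaleDr : right_distributive complexify_scale +%R.
Proof.
case=> a b [x y] [x' y']; rewrite /complexify_scale /=.
by congr (_, _); rewrite /= !scalerDr ?opprD addrACA.
Qed.
Fact complexify_scaleDl w : {morph complexify_scale^~ w : a b / a + b}.
Proof.
case: w => x y [a a'] [b b']; rewrite /complexify_scale /=.
by congr (_, _); rewrite /= !scalerDl ?opprD addrACA.
Qed.

HB.instance Definition _ := GRing.Zmodule_isLmodule.Build R[i] W
  complexify_scaleA complexify_scale1 complexify_scaleDr complexify_scaleDl.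

Fact complexify_add_continuous : continuous (fun x : W * W => x.1 + x.2).
Proof. exact: (@add_continuous (V * V)%type). Qed.

HB.instance Definition _ :=
  PreTopologicalNmodule_isTopologicalNmodule.Build W complexify_add_continuous.

Fact Re_continuous : continuous (@complex.Re R : R[i]^o -> R^o).
Proof.
move=> c; apply/(@cvgrPdist_lt _ R^o _ _ (nbhs_filter (c : R[i]^o))) => e e0.
have e0' : 0 < e%:C%C by rewrite ltcR.
have : \forall d \near (c : R[i]^o), `|c - d| < e%:C%C.
  apply: (@cvgr_dist_lt _ R[i]^o _ _ (nbhs_filter (c : R[i]^o)) id) => // A.
apply: (@filterS _ _ (nbhs_filter (c : R[i]^o))) => d; rewrite normc_def ltcR; apply: le_lt_trans.
rewrite raddfB /= -sqrtr_sqr ler_sqrt ?addr_ge0 ?sqr_ge0//.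
by rewrite lerDl sqr_ge0.
Qed.

Fact Im_continuous : continuous (@complex.Im R : R[i]^o -> R^o).
Proof.
move=> c; apply/(@cvgrPdist_lt _ R^o _ _ (nbhs_filter (c : R[i]^o))) => e e0.
have e0' : 0 < e%:C%C by rewrite ltcR.
have : \forall d \near (c : R[i]^o), `|c - d| < e%:C%C.
  apply: (@cvgr_dist_lt _ R[i]^o _ _ (nbhs_filter (c : R[i]^o)) id) => // A.
apply: (@filterS _ _ (nbhs_filter (c : R[i]^o))) => d; rewrite normc_def ltcR; apply: le_lt_trans.
rewrite raddfB /= -sqrtr_sqr ler_sqrt ?addr_ge0 ?sqr_ge0//.
by rewrite [complex.Im (c - d)]raddfB lerDr sqr_ge0.
Qed.

Fact complexify_scale_continuous :
  continuous (fun z : R[i]^o * W => z.1 *: z.2).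
Proof.
have cs (f : R[i]^o -> R^o) (g : W -> V) :
    continuous f -> continuous g ->
    continuous (fun z : R[i]^o * W => f z.1 *: g z.2).
  move=> cf cg z; apply: (@continuous_comp (R[i]^o * W)%type (R^o * V)%type V
    (fun z => (f z.1, g z.2)) (fun z => z.1 *: z.2)); last first.
    exact: scale_continuous.
  apply: pair_continuous => {}z.
    by apply: (@continuous_comp _ _ _ fst f); [exact: cvg_fst|exact: cf].
  by apply: (@continuous_comp _ _ _ snd g); [exact: cvg_snd|exact: cg].
have c1 : continuous (fst : W -> V) by move=> w; exact: cvg_fst.
have c2 : continuous (snd : W -> V) by move=> w; exact: cvg_snd.
apply: pair_continuous => z.
  apply: (@continuous_comp _ (V * V)%type V
    (fun z : R[i]^o * W =>
       (complex.Re z.1 *: z.2.1, complex.Im z.1 *: z.2.2))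
    (fun p => p.1 - p.2)); last exact: sub_continuous.
  by apply: pair_continuous; apply: cs => //; [exact: Re_continuous|
    exact: Im_continuous].
apply: (@continuous_comp _ (V * V)%type V
  (fun z : R[i]^o * W => (complex.Re z.1 *: z.2.2, complex.Im z.1 *: z.2.1))
  (fun p => p.1 + p.2)); last exact: add_continuous.
by apply: pair_continuous; apply: cs => //; [exact: Re_continuous|
  exact: Im_continuous].
Qed.

HB.instance Definition _ := TopologicalNmodule_isTopologicalLmodule.Build
  R[i] W complexify_scale_continuous.

Fact complexify_locally_convex : exists2 B : set_system W,
  (forall b, b \in B -> convex_set b) & basis B.
Proof.
have [B Bc Bb] := @locally_convex R (V * V)%type.
exists B => // b /Bc /convex_setE bc; apply/convex_setE.
move=> [t s] [x y] [x' y']; rewrite !lecE /= => /andP[/eqP -> t0].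
move=> /andP[_ t1] bx bx'.
have := bc t _ _ t0 t1 bx bx'; congr b.
rewrite /GRing.scale /= /complexify_scale /= /scale_pair /=.
by congr (_, _); rewrite /= !subr0 ?oppr0 !scale0r ?subr0 ?addr0.
Qed.

HB.instance Definition _ :=
  Uniform_isTvs.Build R[i] W complexify_locally_convex.

End complexify.

Definition dprod (I : Type) (V : I -> Type) : Type := forall i, V i.

Section dprod_lmodule.
Variables (I : Type) (K : pzRingType) (V : I -> lmodType K).
Local Notation W := (dprod V).

HB.instance Definition _ := Choice.copy W (prod_topology V).

Definition dprod_zero : W := fun i => 0.
Definition dprod_opp (f : W) : W := fun i => - f i.
Definition dprod_add (f g : W) : W := fun i => f i + g i.
Definition dprod_scale (a : K) (f : W) : W := fun i => a *: f i.

Fact dprod_addA : associative dprod_add.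
Proof.
by move=> f g h; apply: functional_extensionality_dep => i; exact: addrA.
Qed.
Fact dprod_addC : commutative dprod_add.
Proof.
by move=> f g; apply: functional_extensionality_dep => i; exact: addrC.
Qed.
Fact dprod_add0 : left_id dprod_zero dprod_add.
Proof. by move=> f; apply: functional_extensionality_dep => i; exact: add0r. Qed.
Fact dprod_addN : left_inverse dprod_zero dprod_opp dprod_add.
Proof. by move=> f; apply: functional_extensionality_dep => i; exact: addNr. Qed.

HB.instance Definition _ :=
  GRing.isZmodule.Build W dprod_addA dprod_addC dprod_add0 dprod_addN.

Fact dprod_scaleA a b f :
  dprod_scale a (dprod_scale b f) = dprod_scale (a * b) f.
Proof. by apply: functional_extensionality_dep => i; exact: scalerA. Qed.
Fact dprod_scale1 : left_id 1 dprod_scale.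
Proof. by move=> f; apply: functional_extensionality_dep => i; exact: scale1r. Qed.
Fact dprod_scaleDr : right_distributive dprod_scale +%R.
Proof.
by move=> a f g; apply: functional_extensionality_dep => i; exact: scalerDr.
Qed.
Fact dprod_scaleDl f : {morph dprod_scale^~ f : a b / a + b}.
Proof.
by move=> a b; apply: functional_extensionality_dep => i; exact: scalerDl.
Qed.

HB.instance Definition _ := GRing.Zmodule_isLmodule.Build K W
  dprod_scaleA dprod_scale1 dprod_scaleDr dprod_scaleDl.

End dprod_lmodule.

Section dprod_topology.
Variables (I : finType) (F : I -> topologicalType).

Lemma prod_topology_cvg (T : topologicalType) (f : T -> prod_topology F) :
  (forall i, continuous (fun x => f x i)) -> continuous f.
Proof.
move=> cf x; apply/cvg_sup => i.
apply/cvg_image; first by rewrite eqEsubset; split => // y _;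
  exists (dfwith (f x) i y) => //; rewrite dfwithin.
move=> A /(cf i x) fA; exists [set g | A (g i)] => //.
by rewrite eqEsubset; split => [y [g Ag <-]//|y Ay];
  exists (dfwith (f x) i y); rewrite /= dfwithin.
Qed.

Lemma prod_topology_nbhs (f : prod_topology F) (A : set (prod_topology F)) :
  nbhs f A -> exists P : forall i, set (F i),
    (forall i, nbhs (f i) (P i)) /\ [set g | forall i, P i (g i)] `<=` A.
Proof.
pose box (P : forall i, set (F i)) := [set g : forall i, F i | forall i, P i (g i)].
pose D := [set P : forall i, set (F i) | forall i, nbhs (f i) (P i)].
pose G : set_system (prod_topology F) := filter_from D box.
have GF : Filter G.
  apply: filter_from_filter; first by exists (fun=> setT) => i; exact: filterT.
  move=> P Q DP DQ; exists (fun i => P i `&` Q i).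
    by move=> i; exact: filterI.
  by move=> g PQg; split => i; have [] := PQg i.
suff Gf : G --> f by move=> /Gf[P DP PA]; exists P; split.
apply/cvg_sup => i; apply/cvg_image.
  by rewrite eqEsubset; split => // y _; exists (dfwith f i y) => //;
    rewrite dfwithin.
move=> B fB; exists [set g | B (g i)].
  exists (dfwith (fun=> setT) i B).
    by move=> j; case: dfwithP => // k _; exact: filterT.
  by move=> g /(_ i); rewrite dfwithin.
by rewrite eqEsubset; split => [y [g Bg <-]//|y By];
  exists (dfwith f i y); rewrite /= dfwithin.
Qed.

End dprod_topology.

Section dprod_tvs.
Variables (I : finType) (K : numFieldType) (F : I -> tvsType K).
Local Notation W := (dprod F).

HB.instance Definition _ := Uniform.copy W (prod_topology F).

Fact dprod_eval_continuous i : continuous (fun f : W => f i).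
Proof. exact: (@proj_continuous I F i). Qed.

Fact dprod_add_continuous : continuous (fun x : W * W => x.1 + x.2).
Proof.
apply: (@prod_topology_cvg I F (W * W)%type) => i.
have h : continuous (fun x : W * W => (x.1 i, x.2 i)).
  apply: pair_continuous => x.
    apply: (@continuous_comp (W * W)%type W (F i) fst (fun f => f i)).
      exact: cvg_fst.
    exact: dprod_eval_continuous.
  apply: (@continuous_comp (W * W)%type W (F i) snd (fun f => f i)).
    exact: cvg_snd.
  exact: dprod_eval_continuous.
move=> x; apply: (@continuous_comp (W * W)%type (F i * F i)%type (F i)
  (fun x => (x.1 i, x.2 i)) (fun p => p.1 + p.2)); first exact: h.
exact: add_continuous.
Qed.

HB.instance Definition _ :=
  PreTopologicalNmodule_isTopologicalNmodule.Build W dprod_add_continuous.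

Fact dprod_scale_continuous : continuous (fun z : K^o * W => z.1 *: z.2).
Proof.
apply: (@prod_topology_cvg I F (K^o * W)%type) => i.
have h : continuous (fun x : K^o * W => (x.1, x.2 i)).
  apply: pair_continuous => x; first exact: cvg_fst.
  apply: (@continuous_comp (K^o * W)%type W (F i) snd (fun f => f i)).
    exact: cvg_snd.
  exact: dprod_eval_continuous.
move=> x; apply: (@continuous_comp (K^o * W)%type (K^o * F i)%type (F i)
  (fun x => (x.1, x.2 i)) (fun p => p.1 *: p.2)); first exact: h.
exact: scale_continuous.
Qed.

HB.instance Definition _ := TopologicalNmodule_isTopologicalLmodule.Build
  K W dprod_scale_continuous.

Fact dprod_locally_convex : exists2 B : set_system W,
  (forall b, b \in B -> convex_set b) & basis B.
Proof.
exists [set b | open b /\ convex_set b]; first by move=> b /set_mem[].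
split=> [b []//|f A /(@prod_topology_nbhs I F)[P [fP PA]]].
have bE i : exists b : set (F i),
    [/\ open b, convex_set b, b (f i) & b `<=` P i].
  have [B Bc [Bo Bb]] := @locally_convex K (F i).
  have [b [Bb' bf] bP] := Bb _ _ (fP i).
  by exists b; split => //; [exact: Bo|exact/Bc/mem_set].
pose b i := sval (cid (bE i)).
have bP i : [/\ open (b i), convex_set (b i), b i (f i) & b i `<=` P i].
  exact: svalP (cid (bE i)).
exists [set g | forall i, b i (g i)]; last first.
  by move=> g bg; apply: PA => i; have [_ _ _] := bP i; apply.
split; last by move=> i; have [] := bP i.
split.
  rewrite openE => g bg.
  apply: (@filter_forall _ I _ _ (nbhs_filter (g : W))) => i.
  apply: (@dprod_eval_continuous i g); apply: open_nbhs_nbhs; split.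
    by have [] := bP i.
  exact: bg.
apply/convex_setE => t g h t0 t1 bg bh i.
have [_ /convex_setE bc _ _] := bP i.
exact: bc.
Qed.

HB.instance Definition _ := Uniform_isTvs.Build K W dprod_locally_convex.

End dprod_tvs.

(* The differentiability orders r in {0, 1, 2, ...; oo; omega}. *)
Variant diff_order := Cfinite of nat | Cinfty | Comega.

Definition diff_order_le (r s : diff_order) : bool :=
  match r, s with
  | Cfinite m, Cfinite n => (m <= n)%N
  | Cfinite _, _ | Cinfty, Cinfty | _, Comega => true
  | _, _ => false
  end.

Section keller.
Variables (K : numFieldType) (X H : tvsType K).

Definition diff_quotient (f : X -> H) (x y : X) (t : K^o) : H :=
  t^-1 *: (f (x + t *: y) - f x).

Definition dir_derivable (f : X -> H) (x y : X) : Prop :=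
  exists l : H, diff_quotient f x y @ (0 : K^o)^' --> l.

Definition dir_derive (f : X -> H) (y x : X) : H :=
  xget 0 [set l : H | diff_quotient f x y @ (0 : K^o)^' --> l].

(* [:: y_1; ...; y_j] is mapped to D_{y_j} ... D_{y_1} f. *)
Definition iter_derive (f : X -> H) (ys : seq X) : X -> H :=
  foldl dir_derive f ys.

(* C^r-maps on an open set U in the sense of Keller's C^r_c-theory, for finite
   or infinite r; only the values of f on U matter. *)
Definition keller (r : diff_order) (U : set X) (f : X -> H) : Prop :=
  {within U, continuous f} /\
  forall j : nat, diff_order_le (Cfinite j.+1) r ->
    (forall x (ys : j.-tuple X) y, U x ->
       dir_derivable (iter_derive f ys) x y) /\
    {within U `*` setT, continuous
       (fun p : X * {ptws 'I_j.+1 -> X} =>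
          iter_derive f [seq p.2 i | i <- enum 'I_j.+1] p.1)}.

Definition multilinear (k : nat) (m : ('I_k -> X) -> H) : Prop :=
  forall (v : 'I_k -> X) (i : 'I_k) (a : K) (x y : X),
    m (dfwith v i (a *: x + y)) = a *: m (dfwith v i x) + m (dfwith v i y).

Definition homogeneous_polynomial (k : nat) (p : X -> H) : Prop :=
  exists2 m : ('I_k -> X) -> H, multilinear m & forall x, p x = m (fun=> x).

(* Complex analyticity when K is the field of complex numbers. *)
Definition power_series_analytic (U : set X) (f : X -> H) : Prop :=
  {within U, continuous f} /\
  forall x, U x -> exists W : set X, exists p : nat -> X -> H,
    [/\ nbhs 0 W,
        forall k, homogeneous_polynomial k (p k) /\ continuous (p k) &
        forall w, W w ->
          U (x + w) /\ [series p k w]_k @ \oo --> f (x + w)].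

End keller.

Section analytic.
Variable R : realType.

Definition complex_analytic (X H : tvsType R[i]) (U : set X) (f : X -> H) :=
  power_series_analytic U f.

Definition real_analytic (X H : tvsType R) (U : set X) (f : X -> H) : Prop :=
  exists V : set (complexify X), exists g : complexify X -> complexify H,
    [/\ open V, forall x, U x -> V (x, 0), complex_analytic V g &
        forall x, U x -> g (x, 0) = (f x, 0)].

Definition analytic (K : base_field) :
    forall X H : tvsType (base_scalars R K), set X -> (X -> H) -> Prop :=
  match K
    return forall X H : tvsType (base_scalars R K), set X -> (X -> H) -> Prop
  with
  | RealNumbers => real_analytic
  | ComplexNumbers => complex_analytic
  end.

Definition of_class (K : base_field) (r : diff_order)
    (X H : tvsType (base_scalars R K)) (U : set X) (f : X -> H) : Prop :=
  match r with
  | Comega => analytic U f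
  | _ => keller r U f
  end.

End analytic.

(* A chart is given by its domain, and by total functions of which only the
   restrictions to the domain and to its image matter. *)
Record chart (T X : Type) := Chart {
  chart_dom : set T;
  chart_map : T -> X;
  chart_inv : X -> T }.

Definition chart_im (T X : Type) (c : chart T X) (A : set T) : set X :=
  chart_map c @` (chart_dom c `&` A).

Definition is_chart (T X : topologicalType) (c : chart T X) : Prop :=
  [/\ open (chart_dom c), open (chart_im c setT),
      {within chart_dom c, continuous (chart_map c)},
      {within chart_im c setT, continuous (chart_inv c)} &
      {in chart_dom c, cancel (chart_map c) (chart_inv c)}].

(* A topology, a modelling space and an atlas on the set T; the
   differentiability class is imposed separately, so that a C^s-manifold is
   also a C^r-manifold for r <= s, with the same data. *)
Record manifold_data (R : realType) (K : base_field) (T : Type) :=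
  ManifoldData {
    manifold_topology : Topological T;
    manifold_model : tvsType (base_scalars R K);
    manifold_atlas : set (chart T manifold_model) }.
Arguments manifold_topology {R K T}.
Arguments manifold_model {R K T}.
Arguments manifold_atlas {R K T}.

Section manifold.
Variables (R : realType) (K : base_field).
Local Notation data := (manifold_data R K).

Definition manifold_space (T : Type) (M : data T) : topologicalType :=
  Topological.Pack (manifold_topology M).

Definition is_manifold (r : diff_order) (T : Type) (M : data T) : Prop :=
  [/\ hausdorff_space (manifold_model M),
      hausdorff_space (manifold_space M),
      forall c, manifold_atlas M c ->
        @is_chart (manifold_space M) (manifold_model M) c,
      forall x : T, exists2 c, manifold_atlas M c & chart_dom c x &
      forall c d, manifold_atlas M c -> manifold_atlas M d ->
        of_class r (chart_im c (chart_dom d)) (chart_map d \o chart_inv c)].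

(* f is of class C^r on the open set A. *)
Definition class_on (r : diff_order) (T S : Type) (M : data T) (N : data S)
    (A : set T) (f : T -> S) : Prop :=
  {within (A : set (manifold_space M)),
    continuous (f : manifold_space M -> manifold_space N)} /\
  forall c d, manifold_atlas M c -> manifold_atlas N d ->
    of_class r (chart_im c (A `&` f @^-1` chart_dom d))
      (chart_map d \o f \o chart_inv c).

Definition class_map (r : diff_order) (T S : Type) (M : data T) (N : data S)
    (f : T -> S) : Prop := class_on r M N setT f.

Definition diffeo_on (r : diff_order) (T S : Type) (M : data T) (N : data S)
    (A : set T) (B : set S) (f : T -> S) : Prop :=
  class_on r M N A f /\ f @` A = B /\
  exists g : S -> T, class_on r N M B g /\ {in A, cancel f g}.

Definition vector_data (V : tvsType (base_scalars R K)) : data V :=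
  @ManifoldData R K V (Topological.class V) V [set Chart setT id id].

Definition prod_chart (T S X Y : Type) (c : chart T X) (d : chart S Y) :
    chart (T * S) (X * Y) :=
  Chart (chart_dom c `*` chart_dom d)
    (fun p => (chart_map c p.1, chart_map d p.2))
    (fun p => (chart_inv c p.1, chart_inv d p.2)).

Definition prod_data (T S : Type) (M : data T) (N : data S) : data (T * S) :=
  @ManifoldData R K (T * S)%type
    (Topological.class (manifold_space M * manifold_space N)%type)
    (manifold_model M * manifold_model N)%type
    [set prod_chart c d | c in manifold_atlas M & d in manifold_atlas N].

Definition is_lie_group (s : diff_order) (G : groupType) (MG : data G) : Prop :=
  [/\ is_manifold s MG,
      class_map s (prod_data MG MG) MG (fun p => (p.1 * p.2)%g) &
      class_map s MG MG (fun g => g^-1%g)].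

Definition is_action (G : groupType) (T : Type) (a : G -> T -> T) : Prop :=
  (forall x, a 1%g x = x) /\ (forall g h x, a (g * h)%g x = a g (a h x)).

Definition is_class_action (r : diff_order) (G : groupType) (MG : data G)
    (T : Type) (M : data T) (a : G -> T -> T) : Prop :=
  is_action a /\
  class_map r (prod_data MG M) M (fun p => a p.1 p.2).

Definition is_G_manifold (r : diff_order) (G : groupType) (MG : data G)
    (T : Type) (M : data T) (a : G -> T -> T) : Prop :=
  is_manifold r M /\ is_class_action r MG M a.

End manifold.

(* The data of an L-vector bundle over M: the vector space structure on the
   fibre of the projection over x is given by a bijection bundle_in x from a
   vector space bundle_fibre x onto this fibre. *)
Record bundle (R : realType) (K L : base_field) (M : Type) := Bundle {
  bundle_total : Type;
  bundle_data : manifold_data R K bundle_total;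
  bundle_proj : bundle_total -> M;
  bundle_fibre : M -> lmodType (base_scalars R L);
  bundle_in : forall x, bundle_fibre x -> bundle_total;
  bundle_in_inj : forall x, injective (@bundle_in x);
  bundle_inE : forall x, range (@bundle_in x) = bundle_proj @^-1` [set x];
  bundle_typical : tvsType (base_scalars R L) }.
Arguments bundle_total {R K L M}.
Arguments bundle_data {R K L M}.
Arguments bundle_proj {R K L M}.
Arguments bundle_fibre {R K L M}.
Arguments bundle_in {R K L M} b {x} v.
Arguments bundle_typical {R K L M}.

Section bundle.
Variables (R : realType) (K L : base_field) (KL : base_subfield K L).
Variables (r : diff_order) (M : Type) (MM : manifold_data R K M).

(* The manifold underlying the product U x F, with F regarded as a K-space. *)
Definition trivial_data (F : tvsType (base_scalars R L)) :
    manifold_data R K (M * F) :=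
  prod_data MM (vector_data (restrict_scalars (base_inclusion R KL) F)).

Definition local_trivialization (E : bundle R K L M) (U : set M)
    (psi : bundle_total E -> M * bundle_typical E) : Prop :=
  [/\ open (U : set (manifold_space MM)),
      diffeo_on r (bundle_data E) (trivial_data (bundle_typical E))
        (bundle_proj E @^-1` U) (U `*` setT) psi,
      forall y, U y ->
        psi @` (bundle_proj E @^-1` [set y]) = [set y] `*` setT &
      forall y, U y -> linear (fun v : bundle_fibre E y =>
        (psi (bundle_in E v)).2)].

Definition is_vector_bundle (E : bundle R K L M) : Prop :=
  [/\ is_manifold r (bundle_data E),
      hausdorff_space (bundle_typical E),
      range (bundle_proj E) = setT,
      class_map r (bundle_data E) MM (bundle_proj E) &
      forall x, exists U, exists psi : bundle_total E -> M * bundle_typical E,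
        U x /\ local_trivialization U psi].

Record is_equivariant_bundle (G : groupType) (MG : manifold_data R K G)
    (a : G -> M -> M) (E : bundle R K L M)
    (b : G -> bundle_total E -> bundle_total E) : Prop :=
  IsEquivariantBundle {
    equivariant_bundle : is_vector_bundle E;
    equivariant_action : is_class_action r MG (bundle_data E) b;
    equivariant_proj : forall g e,
      bundle_proj E (b g e) = a g (bundle_proj E e);
    equivariant_linear : forall g x,
      exists h : {linear bundle_fibre E x -> bundle_fibre E (a g x)},
        forall v, b g (bundle_in E v) = bundle_in E (h v) }.

End bundle.

(* The set underlying the Whitney sum. *)
Record whitney_total (R : realType) (K L : base_field) (M : Type) (n : nat)
    (E : 'I_n -> bundle R K L M) := WhitneyTotal {
  whitney_proj : M;
  whitney_vec : forall k, bundle_total (E k);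
  whitney_vecP : forall k, bundle_proj (E k) (whitney_vec k) = whitney_proj }.

Section whitney_sum.
Variables (R : realType) (K L : base_field) (M : Type) (n : nat).
Variable E : 'I_n -> bundle R K L M.
Local Notation W := (whitney_total E).

Lemma whitney_eq (v w : W) : whitney_proj v = whitney_proj w ->
  (forall k, whitney_vec v k = whitney_vec w k) -> v = w.
Proof.
case: v w => [x v vP] [y w wP] /= xy vw.
have vwE : v = w by exact: functional_extensionality_dep.
by rewrite -xy -vwE in wP *; congr WhitneyTotal; exact: Prop_irrelevance.
Qed.

Definition whitney_fibre (x : M) : lmodType (base_scalars R L) :=
  dprod (fun k => bundle_fibre (E k) x).

Fact whitney_in_subproof (x : M) (v : whitney_fibre x) k :
  bundle_proj (E k) (bundle_in (E k) (v k)) = x.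
Proof. by have := bundle_inE (E k) x; move/seteqP => [+ _]; apply; exists (v k). Qed.

Definition whitney_in (x : M) (v : whitney_fibre x) : W :=
  WhitneyTotal (whitney_in_subproof v).

Fact whitney_in_inj (x : M) : injective (@whitney_in x).
Proof.
move=> v w vw; apply: functional_extensionality_dep => k.
apply: (@bundle_in_inj _ _ _ _ (E k) x).
exact: (congr1 (fun u : W => whitney_vec u k) vw).
Qed.

Fact whitney_inE (x : M) :
  range (@whitney_in x) = @whitney_proj _ _ _ _ _ E @^-1` [set x].
Proof.
apply/seteqP; split => [_ [v _ <-]//|w /= wx].
have vE k : exists v : bundle_fibre (E k) x, bundle_in (E k) v = whitney_vec w k.
  have /seteqP[_ /(_ (whitney_vec w k))[|v _ vw]] := bundle_inE (E k) x.
    by rewrite /= whitney_vecP.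
  by exists v.
exists (fun k => sval (cid (vE k))) => //.
by apply: whitney_eq => //= k; exact: svalP (cid (vE k)).
Qed.

Definition whitney_bundle (D : manifold_data R K W) : bundle R K L M :=
  Bundle D whitney_in_inj whitney_inE (dprod (fun k => bundle_typical (E k))).

Definition is_whitney_structure (KL : base_subfield K L) (r : diff_order)
    (MM : manifold_data R K M) (D : manifold_data R K W) : Prop :=
  is_vector_bundle KL r MM (whitney_bundle D) /\
  forall (U : set M)
      (psi : forall k, bundle_total (E k) -> M * bundle_typical (E k)),
    (forall k, local_trivialization KL r MM U (psi k)) ->
    @local_trivialization _ _ _ KL r _ MM (whitney_bundle D) U
      (fun v => (whitney_proj v, fun k => (psi k (whitney_vec v k)).2)).

Fact whitney_action_subproof (G : Type) (a : G -> M -> M)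
  (b : forall k, G -> bundle_total (E k) -> bundle_total (E k))
  (ab : forall k g e, bundle_proj (E k) (b k g e) = a g (bundle_proj (E k) e))
  (g : G) (v : W) (k : 'I_n) :
  bundle_proj (E k) (b k g (whitney_vec v k)) = a g (whitney_proj v).
Proof. by rewrite ab whitney_vecP. Qed.

Definition whitney_action (G : Type) (a : G -> M -> M)
    (b : forall k, G -> bundle_total (E k) -> bundle_total (E k))
    (ab : forall k g e,
       bundle_proj (E k) (b k g e) = a g (bundle_proj (E k) e))
    (g : G) (v : W) : W :=
  WhitneyTotal (whitney_action_subproof ab g v).

End whitney_sum.

(* Main.v *)
From HB Require Import structures.
Require Import Defs.
From mathcomp Require Import all_boot all_order all_algebra.
From mathcomp Require Import cyclic separable cyclotomic.
From mathcomp Require Import all_classical all_reals all_analysis.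
From mathcomp Require Import complex lra.

(**
Give [E_1 + ... + E_n] the initial topology for the maps [v |-> pi v] and
[v |-> v_k], and the charts [v |-> (c (pi v), (pr (psi_k v_k))_k)], where [c] is
a chart of [M] and the [psi_k] are trivializations over a common open set, with
the additional requirement that each [v_k] stays in the domain of a prescribed
chart [e_k] of [E_k]. In coordinates, the change of charts, the Whitney sum of
trivializations and its inverse, and the action are then, globally on their
domains, built from maps which are [C^r] by assumption, such as
[psi_k o e_k^-1] and [e_k o psi_k^-1]; no gluing is needed, only stability of
the class [C^r] under composition, finite products and restriction. Two Whitney
structures agree because the same trivializations serve both.

For finite or infinite [r], the chain rule follows from the mean value theorem
for convex sets, once a [C^(r+1)]-map is recognized as a [C^1]-map whose
derivative is [C^r] on [U x X]. For analytic maps, the target space need not be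
complete, and the power series are composed directly: the term of degree [N] of
[g o f] is a finite sum of coefficients of the polynomials [q_l (f_n (z w))] in
[z], with [q_l] the terms of [g] and [f_n] the partial sums of [f]; averaging
over roots of unity gives Cauchy estimates for these coefficients, uniform in
[l] and [n] because [g (y + l f_n (z w))] is bounded for [l] and [z] in a
compact disc.
*)

Set Implicit Arguments.
Unset Strict Implicit.
Unset Printing Implicit Defensive.

Import Order.TTheory GRing.Theory Num.Theory.
Import numFieldNormedType.Exports.

Local Open Scope classical_set_scope.
Local Open Scope ring_scope.

(** * Limits, mean values and difference quotients *)

(** Gluing is a real obstacle, not just a nuisance: [real_analytic] asks for one complex analytic
    extension on a single open set, so patching local extensions would call for an identity theorem
    on well-chosen neighbourhoods. As [class_on] speaks of one pair of charts at a time, confining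
    each vector to one chart turns every map in question into a composite of coordinate expressions
    on a single set. The mean value theorem is run along the real segment from 0 to 1 also for
    complex scalars; hence the inclusion of the reals that is carried through the differential
    calculus. A directional derivative is a chosen limit, so Hausdorff targets enter as soon as a
    derivative has to be identified. In the analytic case there is neither a norm nor a Baire
    argument: everything is measured by one absolutely convex neighbourhood at a time, and
    convergence is tested against a limit known in advance, so that no Cauchy sequence ever has to
    converge. *)

Lemma within_openP (T S : topologicalType) (A : set T) (f : T -> S) :
  open A -> {within A, continuous f} <-> forall x, A x -> {for x, continuous f}.
Proof.
move=> oA; rewrite continuous_open_subspace//.
by split => h x; [move=> Ax; exact/h/mem_set|move=> /set_mem; exact: h].
Qed.

Lemma cvg_dnbhs_at (T S : topologicalType) (f : T -> S) (x : T) (l : S) :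
  f @ x --> l -> f @ x^' --> l.
Proof. by move=> fl A /fl; exact: nbhs_dnbhs. Qed.

Section tvs_limits.
Variables (K : numFieldType) (H : tvsType K).

Lemma tvs_cvgD (T : Type) (F : set_system T) {FF : Filter F} (f g : T -> H) a b :
  f @ F --> a -> g @ F --> b -> (fun x => f x + g x) @ F --> a + b.
Proof. by apply: continuous2_cvg; exact: (@add_continuous H (a, b)). Qed.

Lemma tvs_cvgZ (T : Type) (F : set_system T) {FF : Filter F} (k : T -> K^o)
    (g : T -> H) (a : K^o) b :
  k @ F --> a -> g @ F --> b -> (fun x => k x *: g x) @ F --> a *: b.
Proof. by apply: continuous2_cvg; exact: (@scale_continuous K H (a, b)). Qed.

Lemma tvs_cvgZr (T : Type) (F : set_system T) {FF : Filter F} (c : K)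
    (g : T -> H) b : g @ F --> b -> (fun x => c *: g x) @ F --> c *: b.
Proof. by apply: tvs_cvgZ; exact: (@cvg_cst K^o). Qed.

Lemma tvs_cvgN (T : Type) (F : set_system T) {FF : Filter F} (g : T -> H) b :
  g @ F --> b -> (fun x => - g x) @ F --> - b.
Proof.
move=> /(@tvs_cvgZr T F FF (-1)); rewrite scaleN1r.
by under eq_fun do rewrite scaleN1r.
Qed.

Lemma tvs_cvgB (T : Type) (F : set_system T) {FF : Filter F} (f g : T -> H) a b :
  f @ F --> a -> g @ F --> b -> (fun x => f x - g x) @ F --> a - b.
Proof. by move=> fa gb; apply: tvs_cvgD => //; exact: tvs_cvgN. Qed.

Lemma tvs_cvg_sum (T : Type) (F : set_system T) {FF : Filter F} (I : Type)
    (r : seq I) (f : I -> T -> H) (a : I -> H) :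
  (forall i, f i @ F --> a i) ->
  (fun x => \sum_(i <- r) f i x) @ F --> \sum_(i <- r) a i.
Proof.
move=> fa; elim: r => [|i r IH].
  by under eq_fun do rewrite big_nil; rewrite big_nil; exact: cvg_cst.
under eq_fun do rewrite big_cons.
by rewrite big_cons; exact: tvs_cvgD.
Qed.

Lemma tvs_open_convex (x : H) (N : set H) : nbhs x N ->
  exists C, [/\ open C, C x, C `<=` N &
    forall (t : K) y z, 0 <= t -> t <= 1 -> C y -> C z ->
     C (t *: y + (1 - t) *: z)].
Proof.
move=> xN; have [B Bc [Bo Bb]] := @locally_convex K H.
have [C [BC Cx] CN] := Bb x N xN.
by exists C; split => //; [exact: Bo|exact/convex_setE/Bc/mem_set].
Qed.

End tvs_limits.

Section mean_value.
Variables (R : realType) (K : numFieldType) (i : field_inclusion R K).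
Variable H : tvsType K.
Implicit Types (phi d : R -> H) (C : set H).

(** Slopes of chords, written as a product so that [a = b] is allowed, in which case any point of
    [C] serves as slope. *)
Let good C phi (a b : R) := exists2 z, C z & phi b - phi a = i (b - a) *: z.

Let convexK C := forall (t : K) y z, 0 <= t -> t <= 1 -> C y -> C z ->
  C (t *: y + (1 - t) *: z).

(** The slope of a chord is the average of the slopes of its two parts, weighted by their
    lengths. *)
Let good_trans C phi a b c : convexK C -> a <= b -> b <= c ->
  good C phi a b -> good C phi b c -> good C phi a c.
Proof.
move=> cC ab bc [y Cy yE] [z Cz zE]; rewrite /good.
have -> : phi c - phi a = i (b - a) *: y + i (c - b) *: z.
  by rewrite -yE -zE [RHS]addrC addrA subrK.
have [ac|ac] := eqVneq a c.
  have ab' : a = b by apply/le_anti; rewrite ab -ac in bc *.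
  by exists y => //; rewrite -ac -ab' subrr rmorph0 !scale0r addr0.
have ca : 0 < c - a by rewrite subr_gt0 lt_neqAle ac (le_trans ab bc).
exists (i ((b - a) / (c - a)) *: y + (1 - i ((b - a) / (c - a))) *: z).
  apply: cC => //.
    by rewrite -(rmorph0 i) field_incl_mono divr_ge0 ?(ltW ca)// subr_ge0.
  by rewrite -(rmorph1 i) field_incl_mono ler_pdivrMr// mul1r lerD2r.
rewrite scalerDr !scalerA -(rmorph1 i) -rmorphB -!rmorphM.
congr (i _ *: _ + i _ *: _); rewrite ?mulrBr ?mulr1; rewrite mulrCA divff ?gt_eqF//.
  by rewrite mulr1.
by rewrite mulr1 opprB addrA subrK.
Qed.

(** Close to [t] every chord ending at [t] has its slope in the open set [C], and chords are
    concatenated by convexity. A supremum argument then reaches 1, without continuous functionals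
    and without passing to the closure of [C]. *)
Lemma mean_value_convex phi d C : open C -> convexK C ->
  (forall t, 0 <= t -> t <= 1 -> C (d t) /\
    (fun h : R^o => i h^-1 *: (phi (t + h) - phi t)) @ (0 : R^o)^' --> d t) ->
  C (phi 1 - phi 0).
Proof.
move=> oC cC dphi.
have loc t : 0 <= t -> t <= 1 -> exists2 e, 0 < e & forall b, `|b - t| < e ->
    (t <= b -> good C phi t b) /\ (b <= t -> good C phi b t).
  move=> t0 t1; have [Cd /(_ C)] := dphi t t0 t1.
  move=> /(_ (open_nbhs_nbhs (conj oC Cd))) /nbhs_ballP[e /= e0 eC].
  exists e => // b bt; have [->|bt0] := eqVneq b t.
    by split => _; exists (d t) => //; rewrite !subrr rmorph0 scale0r.
  have bt1 : b - t != 0 by rewrite subr_eq0.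
  have := eC (b - t); rewrite /ball/= sub0r normrN => /(_ bt bt1).
  rewrite subrKC => Cz; split => _; [exists (i (b - t)^-1 *: (phi b - phi t)) => //|
    exists (i (b - t)^-1 *: (phi b - phi t)) => //].
    by rewrite scalerA -rmorphM divff// rmorph1 scale1r.
  rewrite scalerA -rmorphM -(opprB b t) mulNr divff// rmorphN rmorph1 scaleN1r.
  by rewrite opprB.
pose A := [set t : R | [/\ 0 <= t, t <= 1 & good C phi 0 t]].
have A0 : A 0.
  split => //; exists (d 0); first by have [] := dphi 0 (lexx 0) ler01.
  by rewrite !subrr rmorph0 scale0r.
have supA : has_sup A by split; [exists 0|exists 1 => t []].
pose s := sup A.
have s0 : 0 <= s by exact: (ub_le_sup supA.2).
have s1 : s <= 1 by apply: ge_sup; [exists 0|move=> t []].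
have [e e0 eP] := loc s s0 s1.
have [t [t0 t1 gt] st] := sup_adherent e0 supA.
have ts : t <= s by exact: (ub_le_sup supA.2).
have gs : good C phi 0 s.
  apply: (good_trans cC t0 ts gt); apply: (eP t _).2 => //.
  by rewrite ler0_norm ?subr_le0// opprB ltrBlDr addrC -ltrBlDr.
suff s1' : s = 1 by move: gs; rewrite s1' => -[z Cz ->]; rewrite subr0 rmorph1 scale1r.
apply/eqP; rewrite eq_le s1 leNgt; apply/negP => s1'.
(* If [s < 1], half the radius at [s] leads beyond the supremum while staying at most 1. *)
pose b := Num.min 1 (s + e / 2).
have sb : s < b by rewrite lt_min s1'/= ltrDl divr_gt0.
suff Ab : A b by have := ub_le_sup supA.2 Ab; rewrite leNgt sb.
split; [exact: le_trans (ltW sb)|by rewrite ge_min lexx|].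
apply: (good_trans cC s0 (ltW sb) gs); apply: (eP b _).1; last exact: ltW.
rewrite ger0_norm ?subr_ge0 ?(ltW sb)// ltrBlDr gt_min addrC ltrD2l.
by rewrite [X in _ || X]ltr_pdivrMr// mulr_natr mulr2n ltrDl e0 orbT.
Qed.

Section difference_quotient.
Variable X : tvsType K.

(** Base point, direction and step may all vary along the filter: the chain rule has a varying
    direction, and additivity of the derivative in its direction has a varying base point. The mean
    value theorem on the segment from [y s] to [y s + t s *: v s] reduces this to the continuity of
    [dg] at one point. *)
Lemma strict_diff_quotient (U : set X) (g : X -> H) (dg : X * X -> H) y0 v0
    (T : Type) (F : set_system T) {FF : Filter F} (y v : T -> X) (t : T -> K^o) :
  open U -> U y0 ->
  (forall y v, U y -> diff_quotient g y v @ (0 : K^o)^' --> dg (y, v)) ->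
  {for (y0, v0), continuous dg} ->
  y @ F --> y0 -> v @ F --> v0 -> t @ F --> (0 : K^o) -> (\forall s \near F, t s != 0) ->
  (fun s => (t s)^-1 *: (g (y s + t s *: v s) - g (y s))) @ F --> dg (y0, v0).
Proof.
move=> oU Uy0 gd cdg yF vF tF t0 N /tvs_open_convex[C [oC Cd CN cC]].
apply: (@filterS _ F _ (fun s => C ((t s)^-1 *: (g (y s + t s *: v s) - g (y s))))).
  by move=> s; exact: CN.
have : nbhs (y0, v0) (fun p => U p.1 /\ C (dg p)).
  apply: filterI; last by apply: cdg; exact: open_nbhs_nbhs.
  by apply: (@cvg_fst _ _ (nbhs y0) (nbhs v0)); exact: open_nbhs_nbhs.
move=> [[B1 B2] /= [B1y B2v] B12].
have : nbhs (y0, ((0 : K^o), v0)) (fun q : X * (K^o * X) => B1 (q.1 + q.2.1 *: q.2.2)).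
  have hc : (fun q : X * (K^o * X) => q.1 + q.2.1 *: q.2.2) @ (y0, ((0 : K^o), v0))
      --> y0 + (0 : K) *: v0.
    apply: tvs_cvgD; first exact: (@cvg_fst _ _ (nbhs y0)).
    apply: (@tvs_cvgZ _ _ _ _ _ (fun q : X * (K^o * X) => q.2.1) (fun q => q.2.2)).
      apply: (@continuous_comp _ _ _ (@snd X (K^o * X)) fst (y0, (0 : K^o, v0))).
        exact: cvg_snd.
      exact: cvg_fst.
    apply: (@continuous_comp _ _ _ (@snd X (K^o * X)) snd (y0, (0 : K^o, v0))); exact: cvg_snd.
  by apply: hc; rewrite scale0r addr0.
move=> [[D1 D2] /= [D1y [[E1 E2] /= [/nbhs_ballP[e /= e0 eE] E2v] E12]] D12].
have tb : \forall s \near F, `|t s| < e.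
  have := tF _ (nbhsx_ballx (0 : K^o) e e0).
  rewrite nbhs_simpl; apply: (@filterS _ F _) => s.
  by rewrite /= /ball/= sub0r normrN.
near=> s.
have ts0 : t s != 0 by near: s.
have tse : `|t s| < e.
  near: s; exact: tb.
have ysD : D1 (y s) by near: s; exact: yF.
have vsE : E2 (v s) by near: s; exact: vF.
have vsB : B2 (v s) by near: s; exact: vF.
(* Dividing by [t s] beforehand makes [phi 1 - phi 0] the difference quotient itself; the derivative
   of [phi] is then a value of [dg] on the segment, in direction [v s]. *)
pose phi (h : R) := (t s)^-1 *: g (y s + (i h * t s) *: v s).
have := @mean_value_convex phi (fun h => dg (y s + (i h * t s) *: v s, v s)) C oC cC.
rewrite /phi rmorph1 rmorph0 mul1r mul0r scale0r addr0 -scalerBr; apply => h h0 h1.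
have [Uh Ch] : U (y s + (i h * t s) *: v s) /\ C (dg (y s + (i h * t s) *: v s, v s)).
  apply: (B12 (_, _)); split => //=; apply: (D12 (_, (_, _))); split => //=.
  apply: (E12 (_, _)); split => //=; apply: eE; rewrite /ball/= sub0r normrN.
  apply: le_lt_trans tse; rewrite normrM ler_piMl ?normr_ge0//.
  by rewrite ger0_norm -?(rmorph0 i) -?(rmorph1 i) field_incl_mono.
split => //.
have -> : (fun h' : R^o => i h'^-1 *: ((t s)^-1 *: g (y s + (i (h + h') * t s) *: v s) -
        (t s)^-1 *: g (y s + (i h * t s) *: v s))) =
    diff_quotient g (y s + (i h * t s) *: v s) (v s) \o (fun h' : R^o => i h' * t s : K^o).
  apply/funext => h'; rewrite /diff_quotient/= -scalerBr scalerA fmorphV -invfM mulrC.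
  by rewrite rmorphD mulrDl scalerDl addrA [t s * _]mulrC.
apply: cvg_comp; last exact: gd.
have i0 : (fun h' : R^o => i h' * t s : K^o) @ (0 : R^o)^' --> (0 : K^o).
  rewrite -[X in _ --> X](mul0r (t s)) -(rmorph0 i).
  apply: (@tvs_cvgZ K K^o) => //; last exact: cvg_cst.
  by apply: cvg_dnbhs_at; exact: field_incl_continuous.
move=> A A0; have {}i0 := i0 _ A0; rewrite nbhs_simpl /= in i0 *.
have h0' : \forall h' \near (0 : R^o)^', h' != 0 by exact: nbhs_dnbhs_neq.
apply: (@filterS2 _ _ _ _ _ _ _ i0 h0') => h' /= Ah h'0; apply: Ah.
by rewrite mulf_neq0// fmorph_eq0.
Unshelve. all: by end_near. Qed.

End difference_quotient.
End mean_value.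

(** * Finite order differentiability *)

Lemma linear_exE (K : pzRingType) (X H : lmodType K) (f : X -> H) :
  linear f -> exists g : {linear X -> H}, f = g.
Proof.
move=> lf; pose m := GRing.isLinear.Build K X H _ f lf.
pose g : {linear X -> H} := HB.pack f m; by exists g.
Qed.

(** Products up to isomorphism, described by their projections: one set of lemmas then covers pairs,
    [dprod] with restricted scalars, and complexified products. *)
Record tvs_product (K : numFieldType) (I : finType) (H : tvsType K)
    (Hk : I -> tvsType K) (p : forall k, H -> Hk k) : Prop := TvsProduct {
  tvs_product_linear : forall k, linear (p k);
  tvs_product_continuous : forall k, continuous (p k);
  tvs_product_cvg : forall (T : Type) (F : set_system T) (f : T -> H) l,
    Filter F -> (forall k, (fun x => p k (f x)) @ F --> p k l) -> f @ F --> l;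
  tvs_product_inj : forall h h', (forall k, p k h = p k h') -> h = h';
  tvs_product_lift : forall y, exists h, forall k, p k h = y k }.

Section product_maps.
Variables (K : numFieldType).

Lemma tvs_product_maps (I : finType) (H : tvsType K) (Hk : I -> tvsType K)
    (p : forall k, H -> Hk k) (X : Type) (f : forall k, X -> Hk k) :
  tvs_product p -> exists g : X -> H, forall k x, p k (g x) = f k x.
Proof.
move=> pp; have h x := tvs_product_lift pp (fun k => f k x).
by exists (fun x => sval (cid (h x))) => k x; exact: (svalP (cid (h x))).
Qed.

Definition pair_space (X Y : tvsType K) (b : bool) : tvsType K :=
  if b then Y else X.
Definition pair_proj (X Y : tvsType K) (b : bool) : X * Y -> pair_space X Y b :=
  match b with true => snd | false => fst end.

Lemma pair_tvs_product (X Y : tvsType K) :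
  @tvs_product K bool (X * Y)%type (pair_space X Y) (@pair_proj X Y).
Proof.
split.
- by case=> a [x y] [x' y'].
- by case=> z; [exact: cvg_snd|exact: cvg_fst].
- move=> T F f [l1 l2] FF fl; have f1 := fl false; have f2 := fl true.
  have -> : f = (fun x => ((f x).1, (f x).2)).
    by apply/funext => x; rewrite -surjective_pairing.
  exact: cvg_pair f1 f2.
- by move=> [x y] [x' y'] h; have /= -> := h false; have /= -> := h true.
- by move=> y; exists (y false, y true); case.
Qed.

End product_maps.

Section recursive_derivatives.
Variables (K : numFieldType).

Definition cont_on (X H : topologicalType) (U : set X) (f : X -> H) :=
  forall x, U x -> {for x, continuous f}.

(* The recursion on the derivative as a map on [U * X] is the form in which the
   chain rule can be proved by induction. *)
Fixpoint cont_diff (n : nat) (H X : tvsType K) (U : set X) (f : X -> H) : Prop :=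
  cont_on U f /\
  if n is n'.+1 then exists2 df : (X * X)%type -> H,
     (forall x y, U x -> diff_quotient f x y @ (0 : K^o)^' --> df (x, y)) &
     @cont_diff n' H (X * X)%type (U `*` setT) df
  else True.

Lemma cont_diff_cont n (X H : tvsType K) (U : set X) (f : X -> H) :
  cont_diff n U f -> cont_on U f.
Proof. by case: n => [|n] []. Qed.

Lemma cont_diff_sub n (X H : tvsType K) (U V : set X) (f : X -> H) :
  V `<=` U -> cont_diff n U f -> cont_diff n V f.
Proof.
elim: n X U V f => [|n IH] X U V f VU /= [cf h]; split => //.
- by move=> x /VU; exact: cf.
- by move=> x /VU; exact: cf.
case: h => df fd dfC; exists df; first by move=> x y /VU; exact: fd.
by apply: IH dfC => -[x y] /= [/VU].
Qed.

Lemma cont_diff_pred n (X H : tvsType K) (U : set X) (f : X -> H) :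
  cont_diff n.+1 U f -> cont_diff n U f.
Proof.
elim: n X U f => [|n IH] X U f /= [cf [df fd dfC]]; split => //.
by exists df => //; exact: IH.
Qed.

Lemma cont_diff_le m n (X H : tvsType K) (U : set X) (f : X -> H) :
  (m <= n)%N -> cont_diff n U f -> cont_diff m U f.
Proof.
move=> /subnK <-; elim: (n - m)%N => //= k IH /cont_diff_pred; exact: IH.
Qed.

Lemma line_cont (X : tvsType K) (x y : X) :
  {for (0 : K^o), continuous (fun t : K^o => x + t *: y)}.
Proof.
apply: (@tvs_cvgD _ _ _ (nbhs (0 : K^o))); first exact: cvg_cst.
by apply: (@tvs_cvgZ _ _ _ (nbhs (0 : K^o)) _ (fun t : K^o => t));
  [exact: cvg_id|exact: cvg_cst].
Qed.

Lemma near_line (X : tvsType K) (U : set X) (x y : X) : open U -> U x ->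
  \forall t \near (0 : K^o), U (x + t *: y).
Proof.
move=> oU Ux.
have h : (fun t : K^o => x + t *: y) @ (0 : K^o) --> x + (0 : K) *: y by exact: line_cont.
by apply: h; apply: open_nbhs_nbhs; split => //; rewrite scale0r addr0.
Qed.

Lemma diff_quotient_eq (X H : tvsType K) (U : set X) (f g : X -> H) x y :
  open U -> U x -> (forall z, U z -> f z = g z) ->
  \forall t \near (0 : K^o)^', diff_quotient f x y t = diff_quotient g x y t.
Proof.
move=> oU Ux fg; apply: nbhs_dnbhs; have := near_line y oU Ux.
by apply: filterS => t Ut; rewrite /diff_quotient !fg.
Qed.

Lemma diff_quotient_cvg_eq (X H : tvsType K) (U : set X) (f g : X -> H) x y (l : H) :
  open U -> U x -> (forall z, U z -> f z = g z) ->
  diff_quotient f x y @ (0 : K^o)^' --> l ->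
  diff_quotient g x y @ (0 : K^o)^' --> l.
Proof.
move=> oU Ux fg; apply: cvg_trans; apply: near_eq_cvg.
exact: (diff_quotient_eq y oU Ux fg).
Qed.

Lemma open_setXT (X Y : topologicalType) (U : set X) : open U ->
  open (U `*` setT : set (X * Y)).
Proof.
move=> oU; have -> : U `*` setT = (@fst X Y) @^-1` U.
  by apply/seteqP; split => -[x y] //= [].
by apply: open_comp => // x _; exact: cvg_fst.
Qed.

Lemma cont_on_eq (X H : topologicalType) (U : set X) (f g : X -> H) : open U ->
  (forall x, U x -> f x = g x) -> cont_on U f -> cont_on U g.
Proof.
move=> oU fg cf x Ux; rewrite /prop_for /continuous_at -(fg x Ux).
have := cf x Ux; apply: cvg_trans; apply: near_eq_cvg.
by have := open_nbhs_nbhs (conj oU Ux); apply: filterS => z Uz; rewrite fg.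
Qed.

Lemma cont_diff_eq n (X H : tvsType K) (U : set X) (f g : X -> H) : open U ->
  (forall x, U x -> f x = g x) -> cont_diff n U f -> cont_diff n U g.
Proof.
case: n => [|n] oU fg /= [cf h]; split => //; try exact: cont_on_eq cf.
case: h => df fd dfC; exists df => // x y Ux.
exact: (diff_quotient_cvg_eq oU Ux fg (fd x y Ux)).
Qed.

Lemma diff_quotient_linear_post (X H Z : tvsType K) (f : X -> H) (l : H -> Z) x y :
  linear l ->
  diff_quotient (fun x => l (f x)) x y = (fun t => l (diff_quotient f x y t)).
Proof.
move=> ll; apply/funext => t; have [g ->] := linear_exE ll.
by rewrite /diff_quotient (linearZ_LR g) (linearB g).
Qed.

Lemma diff_quotient_linear_pre (X H Z : tvsType K) (f : H -> Z) (l : X -> H) x y :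
  linear l -> diff_quotient (fun x => f (l x)) x y = diff_quotient f (l x) (l y).
Proof.
move=> ll; apply/funext => t; have [g ->] := linear_exE ll.
by rewrite /diff_quotient (linearD g) (linearZ_LR g).
Qed.

Lemma cont_diff_linear n (X H : tvsType K) (U : set X) (f : X -> H) :
  linear f -> continuous f -> cont_diff n U f.
Proof.
elim: n X U f => [|n IH] X U f lf cf /=; split => //; try by move=> x _; exact: cf.
exists (fun p => f p.2) => [x y Ux|]; last first.
  apply: IH => [a [? ?] [? ?] /=|p]; first exact: lf.
  by apply: (@continuous_comp _ _ _ snd f); [exact: cvg_snd|exact: cf].
have [g ->] := linear_exE lf.
apply: (cvg_trans _ (@cvg_cst _ (g y) _ ((0 : K^o)^') _)).
apply: near_eq_cvg; have : \forall t \near (0 : K^o)^', t != 0 by exact: nbhs_dnbhs_neq.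
apply: filterS => t t0; rewrite /diff_quotient/= (linearD g) [g x + _]addrC addrK (linearZ_LR g).
by rewrite scalerA mulVf// scale1r.
Qed.

Lemma cont_diff_product n (I : finType) (H : tvsType K) (Hk : I -> tvsType K)
    (p : forall k, H -> Hk k) (X : tvsType K) (U : set X) (f : X -> H) :
  tvs_product p -> (forall k, cont_diff n U (fun x => p k (f x))) -> cont_diff n U f.
Proof.
move=> pp; elim: n X U f => [|n IH] X U f fC; (split;
  first by move=> x Ux; apply: (tvs_product_cvg pp) => k; exact: (cont_diff_cont (fC k) Ux)).
  by [].
have dfk k : exists df : X * X -> Hk k,
    (forall x y, U x ->
       diff_quotient (fun x => p k (f x)) x y @ (0 : K^o)^' --> df (x, y)) /\
    cont_diff n (U `*` setT) df.
  by have [_ [df ? ?]] := fC k; exists df.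
pose dk k := sval (cid (dfk k)).
have dkP k : (forall x y, U x ->
    diff_quotient (fun x => p k (f x)) x y @ (0 : K^o)^' --> dk k (x, y)) /\
    cont_diff n (U `*` setT) (dk k) by exact: svalP (cid (dfk k)).
have [df dfE] := tvs_product_maps dk pp.
exists df.
  move=> x y Ux; apply: (tvs_product_cvg pp) => k; rewrite dfE.
  have [h _] := dkP k; have := h x y Ux.
  by rewrite (diff_quotient_linear_post _ _ _ (tvs_product_linear pp k)).
apply: IH => k; have [_] := dkP k.
by congr cont_diff; apply/funext => z; rewrite dfE.
Qed.

Lemma cont_diff_pair n (H1 H2 X : tvsType K) (U : set X) (f : X -> H1) (g : X -> H2) :
  cont_diff n U f -> cont_diff n U g -> cont_diff n U (fun x => (f x, g x) : (H1 * H2)%type).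
Proof. by move=> fC gC; apply: (cont_diff_product (pair_tvs_product H1 H2)); case. Qed.

(** Precedes the chain rule, whose induction uses it for [f] composed with [fst]; linearity of [l]
    gives the derivative [df (l x, l y)] without a mean value argument. *)
Lemma cont_diff_linear_precomp n (Y X H : tvsType K) (U : set X) (l : Y -> X) (f : X -> H) :
  linear l -> continuous l -> cont_diff n U f -> cont_diff n (l @^-1` U) (fun y => f (l y)).
Proof.
elim: n Y X U l f => [|n IH] Y X U l f ll cl [cf fC];
  (split; first by move=> y Uy; apply: continuous_comp; [exact: cl|exact: cf]).
  by [].
have [df fd dfC] := fC; exists (fun p => df (l p.1, l p.2)).
  move=> x y Ux; have := fd _ (l y) Ux.
  by rewrite (diff_quotient_linear_pre _ _ _ ll).
have := IH (Y * Y)%type (X * X)%type (U `*` setT) (fun p => (l p.1, l p.2)) df.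
have -> : (fun p : Y * Y => (l p.1, l p.2)) @^-1` (U `*` setT) =
    (l @^-1` U) `*` setT by [].
apply => //.
  by move=> a [x y] [x' y']; congr (_, _); rewrite /= ll.
by apply: pair_continuous => p; apply: continuous_comp;
  do ?[exact: cl|exact: cvg_fst|exact: cvg_snd].
Qed.

Variables (R : realType) (i : field_inclusion R K).

(** The derivative [dg (f x, df (x, y))] is again a composite, of [dg] with a pair of maps of one
    order less, so the induction hypothesis applies to it. *)
Lemma cont_diff_comp n (Z H X : tvsType K) (U : set X) (V : set H) (f : X -> H) (g : H -> Z) :
  open V -> (forall x, U x -> V (f x)) ->
  cont_diff n U f -> cont_diff n V g -> cont_diff n U (fun x => g (f x)).
Proof.
elim: n X H U V f g => [|n IH] X H U V f g oV UV fC gC; (split;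
  first by move=> x Ux; apply: continuous_comp;
    [exact: (cont_diff_cont fC)|apply: (cont_diff_cont gC); exact: UV]) => //.
have [cf [df fd dfC]] := fC; have [cg [dg gd dgC]] := gC.
exists (fun p => dg (f p.1, df p)).
  move=> x y Ux; rewrite /diff_quotient.
  (* The increment of [f] is written as step times difference quotient, which becomes the varying
     direction for [g]. At [t = 0] both sides vanish because the inverse of 0 is 0. *)
  have -> : (fun t : K^o => t^-1 *: (g (f (x + t *: y)) - g (f x))) =
     (fun t : K^o => t^-1 *: (g (f x + t *: diff_quotient f x y t) - g (f x))).
    apply/funext => t; have [->|t0] := eqVneq t 0.
      by rewrite invr0 !scale0r.
    by rewrite /diff_quotient scalerA divff// scale1r subrKC.
  apply: (@strict_diff_quotient _ _ i _ _ V g dg (f x) (df (x, y)) _ _ _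
    (fun=> f x) (diff_quotient f x y) (fun t => t)) => //.
  - exact: UV.
  - by apply: (cont_diff_cont dgC); split => //; exact: UV.
  - exact: cvg_cst.
  - exact: fd.
  - by apply: cvg_dnbhs_at; exact: cvg_id.
  - exact: nbhs_dnbhs_neq.
apply: (IH _ _ _ (V `*` setT) (fun p => (f p.1, df p)) dg) => //.
- exact: open_setXT.
- by move=> [x y] /= [Ux _]; split => //; exact: UV.
apply: cont_diff_pair => //.
have -> : U `*` setT = (@fst X X) @^-1` U.
  by apply/seteqP; split => -[x y] //= [].
by apply: cont_diff_linear_precomp => [//|p|]; [exact: cvg_fst|exact: cont_diff_pred].
Qed.

End recursive_derivatives.

(** * Equivalence of iterated and recursive derivatives *)

Section keller_iterated_derivatives.
Variables (K : numFieldType).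

(* The continuity of [d^j f] is tested along arbitrary continuous families of
   points and directions, instead of on a product of copies of [X]. *)
Definition iter_diff n (X H : tvsType K) (U : set X) (f : X -> H) : Prop :=
  (forall (T : topologicalType) (t0 : T) (h0 : T -> X) (hs : seq (T -> X)),
     U (h0 t0) -> {for t0, continuous h0} ->
     all (fun h => `[< {for t0, continuous h} >]) hs -> (size hs <= n)%N ->
     {for t0, continuous (fun t => iter_derive f [seq h t | h <- hs] (h0 t))}) /\
  (forall x (ys : seq X) y, U x -> (size ys < n)%N ->
     dir_derivable (iter_derive f ys) x y).

(** From left to right, the families are packed into one map to the product on which [d^j f] is
    continuous; conversely, the coordinate projections of that product are themselves admissible
    families. *)
Lemma keller_iter_diff n (X H : tvsType K) (U : set X) (f : X -> H) : open U ->
  keller (Cfinite n) U f <-> iter_diff n U f.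
Proof.
move=> oU; split=> [[cf fn]|[c d]]; split.
- move=> T t0 h0 [|h hs] Ut ch0 chs hn /=.
    apply: (@continuous_comp _ _ _ h0 f) => //.
    by move/(within_openP _ oU): cf; apply.
  have [_] := fn (size hs) hn.
  move/(within_openP _ (open_setXT oU)).
  set p : T -> X * {ptws 'I_(size hs).+1 -> X} :=
    fun t => (h0 t, fun i : 'I_(size hs).+1 => nth h (h :: hs) i t).
  move=> /(_ (p t0) (conj Ut I)) cF.
  pose q t : {ptws 'I_(size hs).+1 -> X} := fun i => nth h (h :: hs) i t.
  have cq : {for t0, continuous q}.
    apply/cvg_sup => i; apply/cvg_image.
      by rewrite eqEsubset; split => // y _; exists (fun=> y).
    have ch : {for t0, continuous (nth h (h :: hs) i)}.
      exact/asboolP/(all_nthP h chs)/(ltn_ord i).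
    move=> A /ch hA; exists [set g | A (g i)] => //.
    by rewrite eqEsubset; split => [y [g Ag <-]//|y Ay]; exists (fun=> y).
  have cp : {for t0, continuous p}.
    by apply: (@cvg_pair _ _ _ (nbhs t0) (nbhs (h0 t0)) (nbhs (q t0))); [exact: ch0|exact: cq].
  have := continuous_comp cp cF; congr ({for t0, continuous _}).
  apply/funext => t'; apply/funext => t; clear t';
    rewrite /comp /p /= -[RHS]/(iter_derive f [seq h t | h <- h :: hs] (h0 t)).
  congr (iter_derive f _ _).
  apply: (@eq_from_nth _ (h t)); first by rewrite size_map size_enum_ord /= size_map.
  move=> k; rewrite size_map size_enum_ord => kn.
  rewrite (nth_map ord0) ?size_enum_ord// nth_enum_ord//.
  by rewrite (@nth_map _ h _ (h t) (fun h => h t) k (h :: hs)).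
- move=> x ys y Ux yn.
  by have [h _] := fn (size ys) yn; exact: (h x (in_tuple ys) y Ux).
- apply/within_openP => // x Ux.
  by apply: (c X x id [::]) => //; exact: cvg_id.
move=> j jn; split; first by move=> x ys y Ux; apply: d => //; rewrite size_tuple.
apply/within_openP; first exact: open_setXT.
move=> [x v] [/= Ux _].
have := c (X * {ptws 'I_j.+1 -> X})%type (x, v) fst
  [seq (fun p : X * {ptws 'I_j.+1 -> X} => p.2 i) | i <- enum 'I_j.+1] Ux.
have -> : (fun t : X * {ptws 'I_j.+1 -> X} => iter_derive f
      [seq h t | h <- [seq (fun p : X * {ptws 'I_j.+1 -> X} => p.2 i) | i <- enum 'I_j.+1]] t.1) =
    (fun t => iter_derive f [seq t.2 i | i <- enum 'I_j.+1] t.1).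
  by apply/funext => t; rewrite -map_comp.
rewrite size_map size_enum_ord; apply => //; first exact: cvg_fst.
rewrite all_map; apply/allP => i _; apply/asboolP.
apply: (@continuous_comp _ _ _ snd (fun g : {ptws 'I_j.+1 -> X} => g i)); first exact: cvg_snd.
exact: (@proj_continuous _ (fun=> X)).
Qed.

End keller_iterated_derivatives.

Lemma near_open (T X : topologicalType) (U : set X) (h : T -> X) (t0 : T) :
  open U -> U (h t0) -> {for t0, continuous h} -> \forall t \near t0, U (h t).
Proof. by move=> oU Ut ch; apply: ch; exact: open_nbhs_nbhs. Qed.

Section keller_recursive_derivatives.
Variables (K : numFieldType).

Lemma dir_deriveE (X H : tvsType K) (f : X -> H) x y (l : H) : hausdorff_space H ->
  diff_quotient f x y @ (0 : K^o)^' --> l -> dir_derive f y x = l.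
Proof.
move=> hH fl; have /(xgetPex 0) h : exists l : H, diff_quotient f x y @ (0 : K^o)^' --> l.
  by exists l.
exact: (cvg_unique hH h fl).
Qed.

Lemma iter_derive_eq (X H : tvsType K) (U : set X) (f g : X -> H) ys x :
  open U -> (forall z, U z -> f z = g z) -> U x ->
  iter_derive f ys x = iter_derive g ys x.
Proof.
move=> oU; elim: ys f g => [|y ys IH] f g fg Ux; first exact: fg.
apply: IH => // z Uz; rewrite /dir_derive; congr (xget 0 _).
by apply/seteqP; split => l; apply: (diff_quotient_cvg_eq oU Uz) => u Uu; rewrite fg.
Qed.

Lemma diff_quotient_slice (X H : tvsType K) (F : X * X -> H) x y u :
  diff_quotient (fun x => F (x, y)) x u = diff_quotient F (x, y) (u, 0).
Proof.
apply/funext => t; rewrite /diff_quotient; congr (_ *: (F _ - _)).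
by rewrite -[RHS]/(x + t *: u, y + t *: 0) scaler0 addr0.
Qed.

Lemma iter_derive_slice (X H : tvsType K) (F : X * X -> H) y us x :
  iter_derive (fun x => F (x, y)) us x = iter_derive F [seq (u, 0) | u <- us] (x, y).
Proof.
elim: us F => //= u us IH F; rewrite -IH; congr (iter_derive _ _ _).
by apply/funext => z; rewrite /dir_derive diff_quotient_slice.
Qed.

(** Differentiating [df (x, y)] in [x] alone means differentiating along [(u, 0)]. Thus a derivative
    of [f] along [y :: us] is one of [df] at [(x, y)] along the directions [(u, 0)], one order
    lower. *)
Lemma cont_diff_iter n (X H : tvsType K) (U : set X) (f : X -> H) : hausdorff_space H ->
  open U -> cont_diff n U f -> iter_diff n U f.
Proof.
move=> hH; elim: n X U f => [|n IH] X U f oU [cf fC].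
  split=> // T t0 h0 [|//] Ut ch0 _ _ /=.
  by apply: continuous_comp => //; exact: cf.
have [df fd /(IH _ _ _ (open_setXT oU))[c d]] := fC.
have E y us x : U x ->
    iter_derive f (y :: us) x = iter_derive df [seq (u, 0) | u <- us] (x, y).
  move=> Ux; rewrite -iter_derive_slice -[LHS]/(iter_derive (dir_derive f y) us x).
  apply: (iter_derive_eq _ oU _ Ux) => z Uz.
  by apply: dir_deriveE => //; exact: fd.
split.
  move=> T t0 h0 [|h hs] Ut ch0 chs hn.
    by apply: continuous_comp => //; exact: cf.
  have /andP[/asboolP ch chs'] := chs.
  have := c T t0 (fun t => (h0 t, h t)) [seq (fun t => (h' t, 0)) | h' <- hs] (conj Ut I).
  rewrite all_map size_map => cF.
  have cF' : {for t0, continuous (fun t : T => iter_derive df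
      [seq h1 t | h1 <- [seq (fun t => (h' t, 0 : X)) | h' <- hs]] (h0 t, h t))}.
    apply: cF => //.
      by apply: (@cvg_pair _ _ _ (nbhs t0) (nbhs (h0 t0)) (nbhs (h t0))).
    apply/(sub_all _ chs') => g /asboolP cg; apply/asboolP.
    by apply: (@cvg_pair _ _ _ (nbhs t0) (nbhs (g t0)) (nbhs (0 : X))) => //; exact: cvg_cst.
  have E' t : U (h0 t) -> iter_derive f [seq h1 t | h1 <- h :: hs] (h0 t) = iter_derive df
      [seq h1 t | h1 <- [seq (fun t => (h' t, 0 : X)) | h' <- hs]] (h0 t, h t).
    by move=> Ut'; rewrite -[LHS]/(iter_derive f (h t :: [seq h1 t | h1 <- hs]) _) E// -!map_comp.
  rewrite /prop_for /continuous_at E'//.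
  apply: cvg_trans cF'; apply: near_eq_cvg.
  by have := near_open oU Ut ch0; apply: filterS => t /E' ->.
move=> x [|y us] z Ux; first by move=> _; exists (df (x, z)); exact: fd.
rewrite /= ltnS => un.
have := d (x, y) [seq (u, 0) | u <- us] (z, 0) (conj Ux I); rewrite size_map => /(_ un)[l dl].
exists l; rewrite -/(iter_derive f (y :: us)).
apply: (diff_quotient_cvg_eq oU Ux (f := fun x => iter_derive df [seq (u, 0) | u <- us] (x, y))).
  by move=> u Uu; exact: (esym (E y us u Uu)).
by rewrite (diff_quotient_slice (iter_derive df [seq (u, 0) | u <- us])).
Qed.

(* The product rule: the derivative of [(x, y) |-> D_y f x] along
   [(v_1, w_1), ..., (v_j, w_j)] is the derivative of [f] along
   [y, v_1, ..., v_j] plus one term for each [i], in which the directions are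
   [w_i] and the [v_k] with [k <> i]. *)
Fixpoint extra_rev (A : Type) (r : seq (A * A)) : seq (seq A) :=
  if r is q :: r' then
    rcons [seq rcons e q.1 | e <- extra_rev r'] (q.2 :: map fst (rev r'))
  else [::].
Definition extra (A : Type) (r : seq (A * A)) := extra_rev (rev r).

Lemma extra_rcons (A : Type) (r : seq (A * A)) q : extra (rcons r q) =
  rcons [seq rcons e q.1 | e <- extra r] (q.2 :: map fst r).
Proof. by rewrite /extra rev_rcons /= revK. Qed.

Lemma map_extra (A B : Type) (g : A -> B) (r : seq (A * A)) :
  extra [seq (g q.1, g q.2) | q <- r] = [seq map g e | e <- extra r].
Proof.
elim/last_ind: r => // r q IH; rewrite map_rcons !extra_rcons map_rcons IH /=.
rewrite -!map_comp; congr (rcons _ (_ :: _)).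
by apply: eq_map => e /=; rewrite map_rcons.
Qed.

Lemma size_extra (A : Type) (r : seq (A * A)) :
  all (fun e => size e == size r) (extra r).
Proof.
elim/last_ind: r => // r q IH; rewrite extra_rcons all_rcons all_map /= size_map size_rcons eqxx/=.
by apply: sub_all IH => e /= /eqP <-; rewrite size_rcons.
Qed.

Lemma all_extra (A : Type) (P : pred A) (r : seq (A * A)) :
  all (fun q => P q.1 && P q.2) r -> all (all P) (extra r).
Proof.
elim/last_ind: r => // r q IH; rewrite all_rcons => /andP[/andP[q1 q2] Pr].
rewrite extra_rcons all_rcons /= q2 /= all_map all_map; apply/andP; split.
  by apply: sub_all Pr => ? /= /andP[].
by apply: sub_all (IH Pr) => e /=; rewrite all_rcons q1.
Qed.

Variables (R : realType) (i : field_inclusion R K).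

Section derivative.
Variables (n : nat) (X H : tvsType K) (U : set X) (f : X -> H).
Hypothesis (hH : hausdorff_space H) (oU : open U) (fK : iter_diff n.+1 U f).

Let iterP x ys y : U x -> (size ys <= n)%N ->
  diff_quotient (iter_derive f ys) x y @ (0 : K^o)^' --> iter_derive f (rcons ys y) x.
Proof.
move=> Ux yn; have [_ d] := fK; have := d x ys y Ux yn => /(xgetPex 0) /=.
by rewrite /iter_derive foldl_rcons.
Qed.

(** Linearity in the first direction. Without further directions, the increment is split at the
    intermediate point [x + s *: y], which moves with [s]; hence [strict_diff_quotient]. Further
    directions are added by differentiating the identity on [U]. *)
Let iter_linear us x y w t : U x -> (size us <= n)%N ->
  iter_derive f (t *: w + y :: us) x =
  t *: iter_derive f (w :: us) x + iter_derive f (y :: us) x.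
Proof.
elim/last_ind: us x => [|us v IH] x Ux.
  move=> _ /=; apply: dir_deriveE => //.
  have yd := @iterP x [::] y Ux isT.
  have [->|t0] := eqVneq t 0; first by rewrite !scale0r !add0r.
  have -> : diff_quotient f x (t *: w + y) = (fun s : K^o =>
     t *: ((s * t : K^o)^-1 *: (f ((x + s *: y) + (s * t) *: w) - f (x + s *: y))) +
     diff_quotient f x y s).
    apply/funext => s; rewrite /diff_quotient scalerA invfM [t * _]mulrC -mulrA mulVf// mulr1.
    rewrite -scalerDr addrA subrK; congr (_ *: (f _ - _)).
    by rewrite scalerDr scalerA -addrA; congr (_ + _); rewrite addrC.
  apply: tvs_cvgD yd; apply: tvs_cvgZr.
  apply: (@strict_diff_quotient _ _ i H X U f (fun p => dir_derive f p.2 p.1) x w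
     _ _ _ (fun s : K^o => x + s *: y) (fun=> w) (fun s => s * t)) => //.
  - by move=> {Ux}x z Ux; exact: (@iterP x [::] z Ux isT).
  - have [c _] := fK; have := c (X * X)%type (x, w) fst [:: snd] Ux.
    apply => //=; first exact: cvg_fst.
    by rewrite andbT; apply/asboolP; exact: cvg_snd.
  - apply: cvg_dnbhs_at; rewrite -[X in _ --> X]addr0 -(scale0r y).
    exact: line_cont.
  - exact: cvg_cst.
  - apply: cvg_dnbhs_at; rewrite -[X in _ --> X](mul0r t).
    by apply: (@tvs_cvgZ K K^o _ (nbhs (0 : K^o)) _ (fun s : K^o => s));
      [exact: cvg_id|exact: cvg_cst].
  have : \forall s \near (0 : K^o)^', s != 0 by exact: nbhs_dnbhs_neq.
  by apply: filterS => s s0; rewrite mulf_neq0.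
rewrite size_rcons => un; rewrite -!rcons_cons.
rewrite {1}/iter_derive foldl_rcons; apply: dir_deriveE => //.
apply: (diff_quotient_cvg_eq oU Ux (f := fun x =>
    t *: iter_derive f (w :: us) x + iter_derive f (y :: us) x)).
  by move=> z Uz; rewrite -IH// ltnW.
have -> : diff_quotient (fun x => t *: iter_derive f (w :: us) x + iter_derive f (y :: us) x) x v =
   (fun s => t *: diff_quotient (iter_derive f (w :: us)) x v s +
        diff_quotient (iter_derive f (y :: us)) x v s).
  apply/funext => s; rewrite /diff_quotient [t *: (_ *: _)]scalerA mulrC -scalerA -scalerDr.
  by congr (_ *: _); rewrite scalerBr [in LHS]opprD addrACA.
by apply: (@tvs_cvgD _ _ _ (0 : K^o)^');
  [apply: (@tvs_cvgZr _ _ _ (0 : K^o)^')|]; exact: iterP.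
Qed.

(** The closed form predicted by the product rule; for the empty list the sum is empty and [D_y f x]
    remains. *)
Let F (ys : seq (X * X)) (p : X * X) : H :=
  iter_derive f (p.2 :: map fst ys) p.1 + \sum_(e <- extra ys) iter_derive f e p.1.

(** When the moved direction [y + t *: w] is split by linearity, the part with [w] is a derivative
    of [f] at the moved point [x + t *: v]. It converges by continuity along this line, and its
    limit is the term newly added to [extra]. *)
Let F_derive ys p q : U p.1 -> (size ys < n)%N ->
  diff_quotient (F ys) p q @ (0 : K^o)^' --> F (rcons ys q) p.
Proof.
case: p q => x y [v w] /= Ux yn; pose us := map fst ys.
have un : (size us < n)%N by rewrite size_map.
have lim : (fun t : K^o => diff_quotient (iter_derive f (y :: us)) x v t +
     iter_derive f (w :: us) (x + t *: v) +
     \sum_(e <- extra ys) diff_quotient (iter_derive f e) x v t) @ (0 : K^o)^' -->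
   iter_derive f (rcons (y :: us) v) x + iter_derive f (w :: us) x +
   \sum_(e <- extra ys) iter_derive f (rcons e v) x.
  apply: tvs_cvgD; first apply: tvs_cvgD.
  - exact: iterP.
  - have [c _] := fK; have := c K^o 0 (fun t : K^o => x + t *: v) [seq (fun=> u) | u <- w :: us].
    rewrite size_map all_map scale0r addr0 => /(_ Ux).
    have ac : all (fun u : X => `[< {for (0 : K^o), continuous (fun=> u : X)} >]) (w :: us).
      by apply/allP => u _; apply/asboolP; exact: cst_continuous.
    move=> /(_ (@line_cont _ X x v) ac (ltnW un)).
    rewrite /prop_for /continuous_at scale0r addr0.
    have E t : [seq h t | h <- [seq (fun=> u) | u <- w :: us]] = w :: us.
      by rewrite -map_comp; exact: map_id.
    by rewrite E; under eq_fun do rewrite E; exact: cvg_dnbhs_at.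
  have := size_extra ys; elim: (extra ys) => [|e es IH] /=.
    by move=> _; under eq_fun do rewrite big_nil; rewrite big_nil; exact: cvg_cst.
  move=> /andP[/eqP se /IH h].
  under eq_fun do rewrite big_cons; rewrite big_cons.
  by apply: tvs_cvgD h; apply: iterP => //; rewrite se ltnW.
have -> : F (rcons ys (v, w)) (x, y) =
   iter_derive f (rcons (y :: us) v) x + iter_derive f (w :: us) x +
   \sum_(e <- extra ys) iter_derive f (rcons e v) x.
  rewrite /F /= extra_rcons big_rcons big_map map_rcons /=.
  by rewrite -addrA; congr (_ + _); rewrite addrC.
apply: cvg_trans lim; apply: near_eq_cvg.
have : \forall t \near (0 : K^o)^', t != 0 by exact: nbhs_dnbhs_neq.
have : \forall t \near (0 : K^o)^', U (x + t *: v) by apply: nbhs_dnbhs; exact: near_line.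
apply: filterS2 => t Ut t0; rewrite /diff_quotient /F /=.
apply/esym; rewrite -/us opprD addrACA scalerDr; congr (_ + _); last first.
  by rewrite -sumrB scaler_sumr.
have /= := iter_linear y w t Ut (ltnW un); rewrite [y + _]addrC => ->.
by rewrite -addrA scalerDr [t^-1 *: (t *: _)]scalerA mulVf// scale1r; exact: addrC.
Qed.

(** On [U] the iterated derivatives of [df] agree with [F], a sum of derivatives of [f] of order at
    most [n.+1]; existence and continuity are read off from these. *)
Lemma iter_diff_derive : iter_diff n (U `*` setT) (fun p => dir_derive f p.2 p.1).
Proof.
pose df (p : X * X) := dir_derive f p.2 p.1; rewrite -/df.
have E ys p : U p.1 -> (size ys <= n)%N -> iter_derive df ys p = F ys p.
  elim/last_ind: ys p => [|ys q IH] p Up; first by rewrite /F/= big_nil addr0.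
  rewrite size_rcons => yn; rewrite {1}/iter_derive foldl_rcons.
  apply: dir_deriveE => //.
  apply: (@diff_quotient_cvg_eq K _ _ (U `*` setT) (F ys)).
  - exact: open_setXT.
  - by split.
  - by move=> z [Uz _]; rewrite -IH// ltnW.
  - exact: F_derive.
split; last first.
  move=> p ys q [Up _] yn; exists (F (rcons ys q) p).
  apply: (@diff_quotient_cvg_eq K _ _ (U `*` setT) (F ys)).
  - exact: open_setXT.
  - by split.
  - by move=> z [Uz _]; rewrite E// ltnW.
  - exact: F_derive.
have [c _] := fK.
move=> T t0 h0 hs [Ut _] ch0 chs hn.
have cp (S1 S2 : topologicalType) (g : T -> S1 * S2) : {for t0, continuous g} ->
    {for t0, continuous (fun t => (g t).1)} /\ {for t0, continuous (fun t => (g t).2)}.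
  move=> cg; split; first by apply: (continuous_comp cg); exact: cvg_fst.
  by apply: (continuous_comp cg); exact: cvg_snd.
have [c1 c2] := cp _ _ h0 ch0.
(* A family of pairs becomes a pair of families, so that [extra] can be formed before evaluating at
   [t]. *)
pose hs2 := [seq ((fun t => (h t).1), (fun t => (h t).2)) | h <- hs].
have E' t : U (h0 t).1 -> iter_derive df [seq h t | h <- hs] (h0 t) =
  iter_derive f [seq h t | h <- (fun t => (h0 t).2) :: map fst hs2] (h0 t).1 +
  \sum_(e <- extra hs2) iter_derive f [seq h t | h <- e] (h0 t).1.
  move=> Ut'; rewrite E ?size_map//; rewrite /F /=; congr (iter_derive _ _ _ + _).
    by rewrite -!map_comp.
  rewrite -(big_map (fun e => [seq h t | h <- e]) xpredT (fun e => iter_derive f e (h0 t).1)).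
  rewrite -map_extra; congr (\sum_(e <- extra _) _); rewrite -map_comp.
  by apply: eq_map => h /=; rewrite -surjective_pairing.
have chs2 : all (fun q => `[< {for t0, continuous q.1} >] && `[< {for t0, continuous q.2} >]) hs2.
  rewrite all_map; apply: sub_all chs => h /asboolP /cp[h1 h2].
  by apply/andP; split; exact/asboolP.
rewrite /prop_for /continuous_at E'//.
apply: (@cvg_trans _ ((fun t => iter_derive f [seq h t | h <- (fun t => (h0 t).2) :: map fst
  hs2] (h0 t).1 +
  \sum_(e <- extra hs2) iter_derive f [seq h t | h <- e] (h0 t).1) @ t0)).
  apply: near_eq_cvg; have := @near_open _ _ U (fun t => (h0 t).1) t0 oU Ut c1.
  by apply: filterS => t /E' ->.
apply: tvs_cvgD.
  apply: (c T t0) => //=; last by rewrite ltnS !size_map.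
  apply/andP; split; first exact/asboolP.
  by rewrite all_map; apply: sub_all chs2 => ? /andP[].
have := @all_extra _ (fun g : T -> X => `[< {for t0, continuous g} >]) _ chs2;
  have := size_extra hs2.
elim: (extra hs2) => [|e es IH] /=.
  by under eq_fun do rewrite big_nil; rewrite big_nil => _ _; exact: cvg_cst.
move=> /andP[/eqP se /IH h] /andP[ce /h {}h].
under eq_fun do rewrite big_cons; rewrite big_cons.
apply: tvs_cvgD h; apply: (c T t0) => //.
by rewrite se size_map ltnW.
Qed.

End derivative.

Lemma iter_diff_cont n (X H : tvsType K) (U : set X) (f : X -> H) : hausdorff_space H ->
  open U -> iter_diff n U f -> cont_diff n U f.
Proof.
move=> hH; elim: n X U f => [|n IH] X U f oU fK; have [c d] := fK;
  (split; first by move=> x Ux; apply: (c X x id [::]) => //; exact: cvg_id) => //.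
exists (fun p => dir_derive f p.2 p.1).
  by move=> x y Ux; exact: xgetPex (d x [::] y Ux isT).
by apply: IH; [exact: open_setXT|exact: iter_diff_derive].
Qed.

Lemma keller_finP n (X H : tvsType K) (U : set X) (f : X -> H) : hausdorff_space H ->
  open U -> keller (Cfinite n) U f <-> cont_diff n U f.
Proof.
move=> hH oU; rewrite keller_iter_diff//; split; first exact: iter_diff_cont.
exact: cont_diff_iter.
Qed.

End keller_recursive_derivatives.

(** * Complex coefficient estimates *)

Section complex_norm.
Variable R : realType.
Implicit Types c d z : R[i].

(** The norm on [R[i]] takes its values in [R[i]]; the estimates want a real number. *)
Definition cnorm c : R := complex.Re `|c|.

Lemma cnormE c : `|c| = (cnorm c)%:C%C.
Proof. by rewrite /cnorm normc_def. Qed.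

Lemma cnorm_ge0 c : 0 <= cnorm c.
Proof. by rewrite /cnorm normc_def; exact: sqrtr_ge0. Qed.

Lemma cnormM c d : cnorm (c * d) = cnorm c * cnorm d.
Proof. by apply: (@complexI R); rewrite rmorphM/= -!cnormE normrM. Qed.

Lemma cnorm1 : cnorm 1 = 1.
Proof. by apply: (@complexI R); rewrite -cnormE normr1. Qed.

Lemma cnormN c : cnorm (- c) = cnorm c.
Proof. by rewrite /cnorm normrN. Qed.

Lemma cnorm0 : cnorm 0 = 0.
Proof. by apply: (@complexI R); rewrite -cnormE normr0. Qed.

Lemma cnormX c n : cnorm (c ^+ n) = cnorm c ^+ n.
Proof. by elim: n => [|n IH]; rewrite ?cnorm1// !exprS cnormM IH. Qed.

Lemma cnormV c : cnorm c^-1 = (cnorm c)^-1.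
Proof. by apply: (@complexI R); rewrite fmorphV/= -!cnormE normfV. Qed.

Lemma cnorm_real (t : R) : cnorm t%:C%C = `|t|.
Proof. by apply: (@complexI R); rewrite -cnormE normc_def /= expr0n addr0 sqrtr_sqr. Qed.

Lemma cnorm_nat n : cnorm n%:R = n%:R.
Proof. by apply: (@complexI R); rewrite -cnormE normr_nat rmorph_nat. Qed.

Lemma cnorm_eq0 c : (cnorm c == 0) = (c == 0).
Proof. by rewrite -[RHS]normr_eq0 cnormE -(inj_eq (@complexI R)). Qed.

(** The polynomial ['X^n - 1] splits and is separable in characteristic 0, and [n] distinct roots of
    unity include a primitive one. *)
Lemma primitive_root_ex n : (0 < n)%N -> exists z, n.-primitive_root z.
Proof.
move=> n0; have [r def_p] := closed_field_poly_normal ('X^n - 1 : {poly R[i]}).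
rewrite (monicP _) ?monicXnsubC // scale1r in def_p.
have rn : all n.-unity_root r by apply/allP => z; rewrite -root_prod_XsubC -def_p.
have ru : uniq r.
  rewrite -separable_prod_XsubC -def_p; apply: separable_Xn_sub_1.
  by rewrite pnatr_eq0 -lt0n.
have rs : (n < (size r).+1)%N.
  by rewrite -(size_prod_XsubC r id) -def_p size_XnsubC.
by have /hasP[z _ zP] := has_prim_root n0 rn ru rs; exists z.
Qed.

Lemma cnorm_prim n z : (0 < n)%N -> n.-primitive_root z -> cnorm z = 1.
Proof.
move=> n0 zn; apply/eqP; rewrite -(pexpr_eq1 n0) ?cnorm_ge0//.
by rewrite -cnormX (prim_expr_order zn) cnorm1.
Qed.

(** Orthogonality of the powers of [z]; the exponent [n - m] stands for [- m] modulo [n]. *)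
Lemma sum_prim_root n z k m : (0 < n)%N -> n.-primitive_root z ->
  (k < n)%N -> (m < n)%N ->
  \sum_(j < n) z ^+ (j * (n - m)) * z ^+ (j * k) = if k == m then n%:R else 0.
Proof.
move=> n0 zn kn mn.
have -> : \sum_(j < n) z ^+ (j * (n - m)) * z ^+ (j * k) =
    \sum_(j < n) (z ^+ (n - m + k)) ^+ j.
  by apply: eq_bigr => j _; rewrite -exprD -mulnDr mulnC exprM.
have [->|km] := eqVneq k m.
  under eq_bigr do rewrite (subnK (ltnW mn)) (prim_expr_order zn) expr1n.
  by rewrite sumr_const card_ord.
set w := z ^+ _; have w1 : w != 1.
  rewrite -(expr0 z) (eq_prim_root_expr zn) mod0n.
  apply/negP; rewrite -/(dvdn n _) => /dvdnP[q qE].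
  (* Since [n - m + k] lies strictly between 0 and [2 n], divisibility by [n] forces it to be [n],
     that is, [k = m]. *)
  have : (n - m + k < n * 2)%N.
    by rewrite muln2 -addnn -addnS leq_add// leq_subr.
  rewrite qE mulnC ltn_pmul2l//; case: q qE => [|[|//]].
    by move/eqP; rewrite addn_eq0 subn_eq0 leqNgt mn.
  rewrite mul1n => E _; move/eqP: km; apply.
  by apply/eqP; rewrite -(eqn_add2l (n - m)) E subnK// ltnW.
have : (w - 1) * (\sum_(j < n) w ^+ j) = 0.
  by rewrite -subrX1 -exprM mulnC exprM (prim_expr_order zn) expr1n subrr.
by move/eqP; rewrite mulf_eq0 subr_eq0 (negPf w1) => /eqP.
Qed.

Lemma near_scale (X : tvsType R[i]) (A : set X) (r : R) : nbhs (0 : X) A ->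
  nbhs (0 : X) [set x | forall c, cnorm c <= r -> A (c *: x)].
Proof.
move=> A0.
have : nbhs ((0 : R[i]^o), (0 : X)) (fun p : R[i]^o * X => A (p.1 *: p.2)).
  by apply: (@scale_continuous R[i] X ((0 : R[i]^o), (0 : X))); rewrite /= scale0r.
move=> [[B1 B2] /= [/nbhs_ballP[e /= e0 eB] B20] BA].
have [e1 e1E e10] : exists2 e1 : R, e = e1%:C%C & 0 < e1.
  exists (complex.Re e); last by move: e0; rewrite ltcE /= => /andP[].
  by move: e0; case: (e) => a b; rewrite ltcE /= => /andP[/eqP -> _].
(* Chosen so that [|r| * s < e1]; the added 1 keeps the divisor positive. *)
pose s : R := e1 / 2 / (`|r| + 1).
have s0 : 0 < s by rewrite !divr_gt0// ltr_wpDl.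
have : nbhs (0 : X) (fun x => B2 ((s%:C%C)^-1 *: x)).
  have h := @tvs_cvgZr _ X _ (nbhs (0 : X)) _ (s%:C%C)^-1 id 0 cvg_id.
  by apply: h; rewrite scaler0.
apply: filterS => x Bx c cr.
have sC0 : s%:C%C != 0 :> R[i] by rewrite -cnorm_eq0 cnorm_real normr_eq0 gt_eqF.
have -> : c *: x = (c * s%:C%C) *: ((s%:C%C)^-1 *: x).
  by rewrite scalerA -mulrA divff// mulr1.
apply: (BA (_, _)); split => //=; apply: eB; rewrite /ball/= sub0r normrN.
rewrite cnormE cnormM cnorm_real (ger0_norm (ltW s0)) e1E ltcR.
apply: (@le_lt_trans _ _ (`|r| * s)).
  by rewrite ler_wpM2r ?(ltW s0)// (le_trans cr)// ler_norm.
rewrite /s mulrCA mulrC mulrAC ltr_pdivrMr ?ltr_wpDl//.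
apply: (@lt_le_trans _ _ (`|r| * e1 + e1)); last by rewrite mulrDr mulr1 mulrC.
apply: (@le_lt_trans _ _ (`|r| * e1)); last by rewrite ltrDl.
by rewrite ler_wpM2l// ler_pdivrMr// ler_peMr ?(ltW e10)// ler1n.
Qed.

End complex_norm.

Section gauge.
Variables (R : realType) (X : tvsType R[i]).
Implicit Types (S : set X) (x y : X) (s t e : R).

(** The absolutely convex neighbourhoods of 0, whose gauges are the continuous seminorms. *)
Record disk S : Prop := Disk {
  disk_nbhs : nbhs (0 : X) S;
  disk_scale : forall c x, cnorm c <= 1 -> S x -> S (c *: x);
  disk_convex : forall t x y, 0 <= t -> t <= 1 -> S x -> S y ->
    S (t%:C%C *: x + (1 - t)%:C%C *: y) }.

(** The balanced core of a convex neighbourhood remains convex, and [near_scale] keeps it a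
    neighbourhood of 0. *)
Lemma disk_ex (N : set X) : nbhs (0 : X) N -> exists2 S, disk S & S `<=` N.
Proof.
move=> /tvs_open_convex[C [oC C0 CN cC]].
exists [set x | forall c, cnorm c <= 1 -> C (c *: x)]; last first.
  by move=> x /(_ 1); rewrite cnorm1 scale1r => /(_ (lexx _)) /CN.
split.
- by apply: near_scale; exact: open_nbhs_nbhs.
- move=> c x c1 Sx d d1; rewrite scalerA; apply: Sx; rewrite cnormM.
  by rewrite mulr_ile1 ?cnorm_ge0.
move=> t x y t0 t1 Sx Sy c c1; rewrite scalerDr !scalerA ![c * _]mulrC -!scalerA.
rewrite rmorphB rmorph1; apply: cC; rewrite ?lecR//; [exact: Sx|exact: Sy].
Qed.

(* The Minkowski gauge of [S] at [x] is at most [t]; only such upper bounds are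
   needed, so that the infimum is never formed. *)
Definition gauge_le S x t : Prop := 0 <= t /\ exists2 y, S y & x = t%:C%C *: y.

Section disk.
Variables (S : set X) (dS : disk S).

Lemma gauge_le0 t : 0 <= t -> gauge_le S 0 t.
Proof.
move=> t0; split => //; exists 0; last by rewrite scaler0.
exact: nbhs_singleton (disk_nbhs dS).
Qed.

Lemma gauge_le_le x s t : s <= t -> gauge_le S x s -> gauge_le S x t.
Proof.
move=> st [s0 [y Sy ->]]; split; first exact: le_trans st.
have [t0|t0] := eqVneq t 0.
  have -> : s = 0 by apply/eqP; rewrite eq_le s0 -t0 st.
  by exists y => //; rewrite t0.
exists ((s / t)%:C%C *: y).
  apply: disk_scale => //; rewrite cnorm_real ger0_norm ?divr_ge0// ?(le_trans s0)//.
  by rewrite ler_pdivrMr ?mul1r// lt_neqAle eq_sym t0 (le_trans s0).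
by rewrite scalerA -rmorphM mulrC divfK.
Qed.

Lemma gauge_leD x y s t : gauge_le S x s -> gauge_le S y t -> gauge_le S (x + y) (s + t).
Proof.
move=> [s0 [x' Sx ->]] [t0 [y' Sy ->]]; split; first exact: addr_ge0.
have [st|st] := eqVneq (s + t) 0.
  move/eqP: (st); rewrite paddr_eq0// => /andP[/eqP -> /eqP ->].
  by rewrite add0r rmorph0 !scale0r add0r; exists x' => //; rewrite scale0r.
exists ((s / (s + t))%:C%C *: x' + (1 - s / (s + t))%:C%C *: y').
  apply: disk_convex => //; first by rewrite divr_ge0// addr_ge0.
  by rewrite ler_pdivrMr ?mul1r ?lerDl// lt_neqAle eq_sym st addr_ge0.
rewrite scalerDr !scalerA -!rmorphM mulrBr mulr1 mulrC divfK//.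
by rewrite [s + t]addrC addrK.
Qed.

Lemma gauge_leZ c x t : gauge_le S x t -> gauge_le S (c *: x) (cnorm c * t).
Proof.
move=> [t0 [y Sy ->]]; split; first by rewrite mulr_ge0 ?cnorm_ge0.
have [->|c0] := eqVneq c 0.
  by exists y => //; rewrite cnorm0 mul0r !scale0r.
exists ((c / (cnorm c)%:C%C) *: y).
  apply: disk_scale => //; rewrite cnormM cnormV cnorm_real ger0_norm ?cnorm_ge0//.
  by rewrite divff ?cnorm_eq0.
rewrite !scalerA rmorphM/= [X in _ = X *: _]mulrC mulrA divfK//.
by rewrite (inj_eq (@complexI R) _ 0) cnorm_eq0.
Qed.

Lemma gauge_leN x t : gauge_le S x t -> gauge_le S (- x) t.
Proof. by move=> /(gauge_leZ (-1)); rewrite scaleN1r cnormN cnorm1 mul1r. Qed.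

Lemma gauge_leB x y s t : gauge_le S x s -> gauge_le S y t -> gauge_le S (x - y) (s + t).
Proof. by move=> xs yt; apply: gauge_leD => //; exact: gauge_leN. Qed.

Lemma gauge_le_sum (I : Type) (r : seq I) (P : pred I) (F : I -> X) (f : I -> R) :
  (forall k, P k -> gauge_le S (F k) (f k)) ->
  gauge_le S (\sum_(k <- r | P k) F k) (\sum_(k <- r | P k) f k).
Proof.
move=> Ff; elim/big_ind2: _ => [|x s y t xs yt|//]; first exact: gauge_le0.
exact: gauge_leD.
Qed.

Lemma gauge_le_mem x t : t <= 1 -> gauge_le S x t -> S x.
Proof.
move=> t1 [t0 [y Sy ->]]; apply: disk_scale => //.
by rewrite cnorm_real ger0_norm.
Qed.

Lemma near_bnd (T : Type) (F : set_system T) {FF : Filter F} (f : T -> X) (l : X) e :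
  0 < e -> f @ F --> l -> \forall u \near F, gauge_le S (f u - l) e.
Proof.
move=> e0 fl.
have : (fun u => (e%:C%C)^-1 *: (f u - l)) @ F --> (0 : X).
  rewrite -[X in _ --> X](scaler0 _ (e%:C%C)^-1) -(subrr l).
  by apply: tvs_cvgZr; apply: tvs_cvgB => //; exact: cvg_cst.
move=> /(_ S (disk_nbhs dS)); rewrite nbhs_simpl; apply: (@filterS _ F _) => u Su.
split; [exact: ltW|exists (e%:C%C^-1 *: (f u - l)) => //].
by rewrite scalerA divff ?scale1r// (inj_eq (@complexI R) _ 0) gt_eqF.
Qed.

Lemma gauge_le_ex x : exists t, gauge_le S x t.
Proof.
have : (fun t : R[i]^o => t *: x) @ (0 : R[i]^o) --> (0 : R[i]) *: x.
  by apply: (@tvs_cvgZ _ _ _ (nbhs (0 : R[i]^o)) _ (fun t : R[i]^o => t));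
    [exact: cvg_id|exact: cvg_cst].
rewrite scale0r => /(_ S (disk_nbhs dS))/nbhs_ballP[e /= e0 eS].
have [e1 e1E e10] : exists2 e1 : R, e = e1%:C%C & 0 < e1.
  exists (complex.Re e); last by move: e0; rewrite ltcE /= => /andP[].
  by move: e0; case: (e) => a b; rewrite ltcE /= => /andP[/eqP -> _].
exists (e1 / 2)^-1; split; first by rewrite invr_ge0 divr_ge0// ltW.
exists ((e1 / 2)%:C%C *: x).
  apply: eS; rewrite /ball/= sub0r normrN cnormE cnorm_real e1E ltcR.
  by rewrite ger0_norm ?divr_ge0// ?ltW// ltr_pdivrMr// ltr_pMr// ltr1n.
rewrite scalerA -rmorphM mulVf ?rmorph1 ?scale1r//.
by rewrite mulf_neq0// ?gt_eqF.
Qed.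

End disk.

(** All disks are tested, so the bound 1 is as good as any smaller one. *)
Lemma gauge_le_cvg (T : Type) (F : set_system T) {FF : Filter F} (f : T -> X) (l : X) :
  (forall S, disk S -> \forall u \near F, gauge_le S (f u - l) 1) -> f @ F --> l.
Proof.
move=> h A lA.
have : nbhs (0 : X) (fun x => A (x + l)).
  have h0 := @tvs_cvgD _ X _ (nbhs (0 : X)) _ id (fun=> l) 0 l cvg_id (@cvg_cst _ _ _ _ _).
  by apply: h0; rewrite add0r.
move=> /disk_ex[S dS SA]; rewrite nbhs_simpl; have := h S dS.
apply: (@filterS _ F _) => u /(gauge_le_mem dS (lexx _)) /SA.
by rewrite subrK.
Qed.

Lemma geometric_tail (a : R) m n : 0 <= a -> a < 1 ->
  \sum_(m <= k < n) a ^+ k <= a ^+ m / (1 - a).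
Proof.
move=> a0 a1; have a1' : 0 < 1 - a by rewrite subr_gt0.
have [mn|nm] := leqP m n; last first.
  by rewrite big_geq ?(ltnW nm)// divr_ge0 ?exprn_ge0// ltW.
rewrite ler_pdivlMr// -(subnKC mn); elim: (n - m)%N => [|k IH].
  by rewrite addn0 big_geq// mul0r exprn_ge0.
suff E j : (\sum_(m <= k < m + j) a ^+ k) * (1 - a) = a ^+ m - a ^+ (m + j).
  by rewrite E lerBlDr lerDl exprn_ge0.
elim: j => [|j IHj]; first by rewrite addn0 big_geq// mul0r subrr.
rewrite addnS big_nat_recr ?leq_addr//= mulrDl IHj mulrBr mulr1 -exprSr.
by rewrite addrA subrK.
Qed.

(** Only partial sums are compared: a distant one differs from [series u n] by part of a geometric
    tail, and the slack [e] pays for its distance to the given limit [l]. *)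
Lemma series_tail S (dS : disk S) (u : nat -> X) l (B a e : R) n :
  0 <= a -> a < 1 -> 0 <= B -> 0 < e ->
  (forall k, (n <= k)%N -> gauge_le S (u k) (B * a ^+ k)) ->
  series u @ \oo --> l -> gauge_le S (l - series u n) (B * (a ^+ n / (1 - a)) + e).
Proof.
move=> a0 a1 B0 e0 ub ul.
have [N _ NP] := near_bnd dS e0 ul.
pose m := maxn n N.
have mS : gauge_le S (series u m - l) e by apply: NP; rewrite /= leq_maxr.
have -> : l - series u n = (series u m - series u n) - (series u m - l).
  by rewrite opprB [RHS]addrC addrA subrK.
apply: gauge_leB => //; apply: (@gauge_le_le _ dS _ (\sum_(n <= k < m) (B * a ^+ k))).
  by rewrite -mulr_sumr ler_wpM2l// geometric_tail.
rewrite sub_series_geq ?leq_maxl// big_nat_cond [X in gauge_le _ _ X]big_nat_cond.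
by apply: gauge_le_sum => // k /andP[/andP[nk _] _]; exact: ub.
Qed.

(* Averaging over the [D]-th roots of unity isolates one coefficient. *)
Lemma coef_extract (u : nat -> X) D (r : R) m w : 0 < r -> (m < D)%N ->
  D.-primitive_root w ->
  u m = (D%:R * r%:C%C ^+ m)^-1 *:
    \sum_(j < D) w ^+ (j * (D - m)) *: (\sum_(k < D) (r%:C%C * w ^+ j) ^+ k *: u k).
Proof.
move=> r0 mD wP; have D0 : (0 < D)%N by apply: leq_ltn_trans mD.
have -> : \sum_(j < D) w ^+ (j * (D - m)) *: (\sum_(k < D) (r%:C%C * w ^+ j) ^+ k *: u k) =
  \sum_(k < D) (r%:C%C ^+ k * \sum_(j < D) w ^+ (j * (D - m)) * w ^+ (j * k)) *: u k.
  under eq_bigr do rewrite scaler_sumr.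
  rewrite exchange_big; apply: eq_bigr => k _ /=.
  rewrite mulr_sumr scaler_suml; apply: eq_bigr => j _.
  by rewrite scalerA exprMn -exprM mulrCA.
rewrite (bigD1 (Ordinal mD))//= [X in _ + X]big1 ?addr0 => [|k km].
  rewrite sum_prim_root// eqxx scalerA [r%:C%C ^+ m * _]mulrC mulVf ?scale1r//.
  by rewrite mulf_neq0 ?pnatr_eq0 -?lt0n// expf_neq0// (inj_eq (@complexI R) _ 0) gt_eqF.
have {}km : (k != m :> nat) by apply: contraNneq km => km; apply/eqP/val_inj.
by rewrite sum_prim_root// (negPf km) mulr0 scale0r.
Qed.

(** Cauchy's estimate for a polynomial: up to the factor [r ^ m], [u m] is an average of [D] rotated
    values. The bound is independent of the degree, which will grow. *)
Lemma coef_bnd S (dS : disk S) (u : nat -> X) D (r M : R) m : 0 < r -> (m < D)%N ->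
  (forall z, cnorm z = r -> gauge_le S (\sum_(k < D) z ^+ k *: u k) M) ->
  gauge_le S (u m) (M / r ^+ m).
Proof.
move=> r0 mD h; have D0 : (0 < D)%N by apply: leq_ltn_trans mD.
have [w wP] := primitive_root_ex R D0; have w1 := cnorm_prim D0 wP.
rewrite (coef_extract u r0 mD wP).
have -> : M / r ^+ m = cnorm (D%:R * r%:C%C ^+ m)^-1 * \sum_(j < D) (cnorm (w ^+ (j * (D - m)))
  * M).
  under eq_bigr do rewrite cnormX w1 expr1n mul1r.
  rewrite sumr_const card_ord cnormV cnormM cnorm_nat cnormX cnorm_real (ger0_norm (ltW r0)).
  by rewrite invfM -[M *+ D]mulr_natl mulrACA mulVf ?mul1r 1?mulrC// pnatr_eq0 -lt0n.
apply: gauge_leZ => //; apply: gauge_le_sum => // j _; apply: gauge_leZ => //; apply: h.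
by rewrite cnormM cnorm_real cnormX w1 expr1n mulr1 ger0_norm// ltW.
Qed.

Lemma small_geometric (B a e : R) : 0 <= a -> a < 1 -> 0 < e ->
  exists N, forall n, (N <= n)%N -> B * a ^+ n <= e.
Proof.
move=> a0 a1 e0; have := @cvg_geometric R B a.
rewrite ger0_norm// => /(_ a1) /cvgrPdist_le /(_ e e0)[N _ NP].
by exists N => n /NP /=; rewrite sub0r normrN => /(le_trans (ler_norm _)).
Qed.

(** Far out, a term is the difference of two partial sums within 1 of the limit, whence the 2; the
    finitely many other terms are absorbed one by one. *)
Lemma series_bnd S (dS : disk S) (v : nat -> X) (l : X) : series v @ \oo --> l ->
  exists2 B : R, 0 <= B & forall k, gauge_le S (v k) B.
Proof.
move=> vl; have [N _ NP] := near_bnd dS ltr01 vl.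
have [B B0 BP] : exists2 B : R, 0 <= B & forall k, (k < N)%N -> gauge_le S (v k) B.
  elim: (N) => [|n [B B0 BP]]; first by exists 0.
  have [t [t0 tP]] := gauge_le_ex dS (v n); exists (B + t) => [|k]; first exact: addr_ge0.
  rewrite ltnS leq_eqVlt => /orP[/eqP ->|/BP].
    by apply: (@gauge_le_le _ dS _ t); [rewrite lerDr|split].
  by apply: (gauge_le_le dS); rewrite lerDl.
exists (B + 2) => [|k]; first by rewrite addr_ge0.
have [kN|Nk] := ltnP k N; first by apply: (gauge_le_le dS) (BP k kN); rewrite lerDl.
apply: (@gauge_le_le _ dS _ 2); first by rewrite lerDr.
have -> : v k = (series v k.+1 - l) - (series v k - l).
  by rewrite opprB addrA subrK seriesSB.
rewrite -[2]/(1 + 1 : R); apply: gauge_leB => //; apply: NP => //=.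
exact: leq_trans (leqnSn k).
Qed.

(** Cauchy's estimate on the circle of radius 2. Convergence at radius 3 dominates the terms on this
    circle by a geometric sequence of ratio 2/3, so the sum may be replaced by a polynomial at the
    cost of the 1 in [M + 1]. *)
Lemma cauchy_bnd S (dS : disk S) (u : nat -> X) (h : R[i] -> X) (M : R) m : 0 <= M ->
  (forall z, cnorm z <= 3 -> series (fun k => z ^+ k *: u k) @ \oo --> h z) ->
  (forall z, cnorm z = 2 -> gauge_le S (h z) M) -> gauge_le S (u m) ((M + 1) / 2 ^+ m).
Proof.
move=> M0 uh hM.
have n3 : cnorm (3%:R : R[i]) = 3 by rewrite cnorm_nat.
have n3' : cnorm (3%:R : R[i]) <= 3 by rewrite n3.
have [B B0 BP] := series_bnd dS (uh 3%:R n3').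
pose a : R := 2 / 3.
have a0 : 0 <= a by rewrite divr_ge0.
have a1 : a < 1 by rewrite ltr_pdivrMr// mul1r ltr_nat.
have e2 : (0 : R) < 1 / 2 by rewrite divr_gt0.
have [N NP] := small_geometric (B / (1 - a)) a0 a1 e2.
(* Long enough to contain the index [m] and to leave a tail of at most 1/2; the other 1/2 is the
   slack of [series_tail]. *)
pose D := (maxn N m).+1.
apply: (@coef_bnd _ dS u D) => //; first by rewrite ltnS leq_maxr.
move=> z z2.
have ub k : gauge_le S (z ^+ k *: u k) (B * a ^+ k).
  have -> : z ^+ k *: u k = (z / 3) ^+ k *: (3%:R ^+ k *: u k).
    by rewrite scalerA -exprMn divfK// pnatr_eq0.
  have := gauge_leZ dS ((z / 3) ^+ k) (BP k).
  by rewrite cnormX cnormM cnormV n3 z2 [_ * B]mulrC.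
have z3 : cnorm z <= 3 by rewrite z2 ler_nat.
have tl := series_tail dS a0 a1 B0 e2 (fun k _ => ub k) (uh z z3) (n := D).
have le1 : B * (a ^+ D / (1 - a)) + 1 / 2 <= 1.
  rewrite [X in _ <= X](splitr 1) lerD2r mulrCA [_ * (B / _)]mulrC.
  by apply: NP; rewrite leqW// leq_maxl.
have := gauge_leB dS (hM z z2) (gauge_le_le dS le1 tl).
by rewrite opprB addrCA subrr addr0 seriesEord.
Qed.

End gauge.

(** * Homogeneous polynomials *)

Section multilinear_maps.
Variables (K : numFieldType) (X H : tvsType K).

(* Unlike [multilinear], with any finite set of argument places: those of a
   composite are pairs of places. *)
Definition multilinear_map (I : finType) (m : (I -> X) -> H) : Prop :=
  forall (v : I -> X) (i : I) (a : K) (x y : X),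
    m (dfwith v i (a *: x + y)) = a *: m (dfwith v i x) + m (dfwith v i y).

Section multilinear_map_theory.
Variables (I : finType) (m : (I -> X) -> H).
Hypothesis mm : multilinear_map m.

Lemma dfwith_id (v : I -> X) i : dfwith v i (v i) = v.
Proof. by apply/funext => j; case: dfwithP. Qed.

Lemma multilinear_map0 v i : m (dfwith v i 0) = 0.
Proof. by have := mm v i (-1) 0 0; rewrite scaler0 addr0 scaleN1r addNr. Qed.

Lemma multilinear_map_eq0 v i : v i = 0 -> m v = 0.
Proof. by move=> vi; rewrite -(dfwith_id v i) vi multilinear_map0. Qed.

Lemma multilinear_map_lin_sum (J : Type) (r : seq J) (c : J -> K) (x : J -> X) v i :
  m (dfwith v i (\sum_(j <- r) c j *: x j)) = \sum_(j <- r) c j *: m (dfwith v i (x j)).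
Proof.
elim: r => [|j r IH]; first by rewrite !big_nil multilinear_map0.
by rewrite !big_cons mm IH.
Qed.

(** The places are expanded one at a time along a list [r], as in the distributivity of products
    over sums. Index functions take the default value [j0] at places not yet expanded, so that each
    choice is counted once. *)
Lemma multilinear_map_sum (J : finType) (j0 : J) (c : I -> J -> K) (x : I -> J -> X) :
  m (fun i => \sum_j c i j *: x i j) =
  \sum_(k : {ffun I -> J}) (\prod_i c i (k i)) *: m (fun i => x i (k i)).
Proof.
pose V i := \sum_j c i j *: x i j; rewrite -/V.
pose Pf (r : seq I) := pfamily j0 (mem r) (fun=> predT : pred J).
have key (r : seq I) : uniq r -> \sum_(k in Pf r) (\prod_(i <- r) c i (k i)) *:
    m (fun i => if i \in r then x i (k i) else V i) = m V.
  elim: r => [_|i r IH /= /andP[/negbTE nri ur]].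
    rewrite (big_pred1 [ffun=> j0]) ?big_nil ?scale1r //= => f.
    apply/familyP/eqP=> /= [Df |->{f} i]; last by rewrite ffunE !inE.
    by apply/ffunP=> i; rewrite ffunE; apply/eqP/Df.
  rewrite -(IH ur) (partition_big (fun f : {ffun I -> J} => f i) predT)//=.
  pose seti j (f : {ffun I -> J}) := [ffun k => if k == i then j else f k].
  have E (k : {ffun I -> J}) : (\prod_(i <- r) c i (k i)) *: m (fun i => if i \in r then x i (k
    i) else V i) =
     \sum_j (\prod_(i' <- i :: r) c i' (seti j k i')) *:
         m (fun i' => if i' \in i :: r then x i' (seti j k i') else V i').
    set w := fun i => if i \in r then x i (k i) else V i.
    have wE : w i = V i by rewrite /w nri.
    rewrite -(dfwith_id w i) wE /V multilinear_map_lin_sum scaler_sumr; apply: eq_bigr => j _.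
    rewrite scalerA big_cons ffunE eqxx [c i j * _]mulrC; congr (_ * _ *: m _).
      rewrite [LHS]big_seq [RHS]big_seq; apply: eq_bigr => l lr; rewrite ffunE; case: eqP => // li.
      by rewrite li nri in lr.
    apply/funext => l; rewrite inE ffunE; have [->|li] := eqVneq l i; first by rewrite dfwithin.
    by rewrite dfwithout 1?eq_sym.
  under [RHS]eq_bigr => k _ do rewrite E.
  rewrite [RHS]exchange_big /=; apply: eq_bigr => j _.
  (* An index function for [i :: r] with value [j] at [i] is one for [r] whose value at [i] was
     changed from [j0] to [j]. *)
  rewrite (reindex_onto (seti j) (seti j0)) => [|f /andP[_ /eqP fi]]; last first.
    by apply/ffunP=> k; rewrite !ffunE; case: eqP => // ->.
  apply: eq_bigl => f.
  rewrite !ffunE !eqxx andbT; apply/andP/familyP=> /= [[Pjf fij0] k | Pff].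
    have /[!(ffunE, inE)] := familyP Pjf k; case: eqP => // -> _.
    by rewrite nri -(eqP fij0) !ffunE !inE !eqxx.
  (split; [apply/familyP | apply/eqP/ffunP]) => k; have /[!(ffunE, inE)]:= Pff k.
    by case: eqP => // ->.
  by case: eqP => // ->; rewrite nri /= => /eqP.
rewrite -(key (enum I) (enum_uniq _)).
apply: eq_big => [k|k _].
  by apply/familyP => i; rewrite /= mem_enum.
by rewrite big_enum; congr (_ *: m _); apply/funext => i; rewrite mem_enum.
Qed.

Lemma multilinear_map_scale (c : K) (v : X) : m (fun=> c *: v) = c ^+ #|I| *: m (fun=> v).
Proof.
have := @multilinear_map_sum unit tt (fun _ _ => c) (fun _ _ => v).
have -> : (fun _ : I => \sum_(j : unit) c *: v) = (fun=> c *: v).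
  by apply/funext => i; rewrite big_const card_unit /= addr0.
move=> ->; rewrite (big_pred1 [ffun=> tt]) ?prodr_const//.
by move=> k; apply/esym/eqP/ffunP => i; case: (k i); case: ([ffun=> tt] i).
Qed.

End multilinear_map_theory.

Lemma homogeneous_of_multi (I : finType) k (m : (I -> X) -> H) p : multilinear_map m ->
  #|I| = k -> (forall x, p x = m (fun=> x)) -> homogeneous_polynomial k p.
Proof.
move=> mm Ik pm; exists (fun v => m (fun i => v (cast_ord Ik (enum_rank i)))) => // v j a x y.
have E z : (fun i => dfwith v j z (cast_ord Ik (enum_rank i))) =
    dfwith (fun i => v (cast_ord Ik (enum_rank i))) (enum_val (cast_ord (esym Ik) j)) z.
  apply/funext => i; have [->|ij] := eqVneq i (enum_val (cast_ord (esym Ik) j)).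
    by rewrite enum_valK cast_ordKV !dfwithin.
  rewrite !dfwithout// 1?eq_sym//; apply: contraNneq ij => <-.
  by rewrite cast_ordK enum_rankK.
by rewrite !E mm.
Qed.

Lemma homogeneous_scale k (p : X -> H) (c : K) x : homogeneous_polynomial k p ->
  p (c *: x) = c ^+ k *: p x.
Proof. by move=> [m mm pm]; rewrite !pm (multilinear_map_scale mm) card_ord. Qed.

Lemma homogeneous0 k : homogeneous_polynomial k (fun _ : X => 0 : H).
Proof. by exists (fun=> 0) => // v i a x y; rewrite scaler0 addr0. Qed.

Lemma homogeneousD k (p q : X -> H) : homogeneous_polynomial k p ->
  homogeneous_polynomial k q -> homogeneous_polynomial k (fun x => p x + q x).
Proof.
move=> [m mm pm] [l ll ql]; exists (fun v => m v + l v) => [v i a x y|x].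
  by rewrite mm ll scalerDr addrACA.
by rewrite pm ql.
Qed.

Lemma homogeneous_sum k (J : Type) (r : seq J) (P : pred J) (p : J -> X -> H) :
  (forall j, P j -> homogeneous_polynomial k (p j)) ->
  homogeneous_polynomial k (fun x => \sum_(j <- r | P j) p j x).
Proof.
move=> hp; elim: r => [|j r IH].
  by under eq_fun do rewrite big_nil; exact: homogeneous0.
under eq_fun do rewrite big_cons; case: (boolP (P j)) => // Pj.
by apply: homogeneousD => //; exact: hp.
Qed.

End multilinear_maps.

Lemma homogeneous_comp (K : numFieldType) (X H Z : tvsType K) l
    (m : ('I_l -> H) -> Z) (k : 'I_l -> nat) (p : 'I_l -> X -> H) :
  multilinear m -> (forall i, homogeneous_polynomial (k i) (p i)) ->
  homogeneous_polynomial (\sum_i k i)%N (fun x => m (fun i => p i x)).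
Proof.
move=> mm hp.
have [n nP] : {n : forall i, ('I_(k i) -> X) -> H |
    forall i, multilinear (n i) /\ forall x, p i x = n i (fun=> x)}.
  have h i : {n : ('I_(k i) -> X) -> H | multilinear n /\ forall x, p i x = n (fun=> x)}.
    by apply: cid; have [n n1 n2] := hp i; exists n.
  by exists (fun i => sval (h i)) => i; exact: svalP (h i).
apply: (@homogeneous_of_multi _ _ _ {i : 'I_l & 'I_(k i)} _
   (fun v => m (fun i => n i (fun j => v (Tagged (fun i => 'I_(k i)) j))))) => //; last 2 first.
- rewrite card_tagged sumnE big_map big_enum.
  by apply: eq_bigr => i _; rewrite card_ord.
- by move=> x; congr m; apply/funext => i; have [_ ->] := nP i.
move=> v [i j] a x y.
(* Changing the argument at place [(i, j)] alters only the [i]-th inner value, and there only the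
   place [j]; linearity passes from the inner form to the outer one. *)
have E z : (fun i' => n i' (fun j' => dfwith v (existT _ i j) z (Tagged (fun i => 'I_(k i)) j'))) =
    dfwith (fun i' => n i' (fun j' => v (Tagged (fun i => 'I_(k i)) j'))) i
      (n i (dfwith (fun j' => v (Tagged (fun i => 'I_(k i)) j')) j z)).
  apply/funext => i'; have [<-|ii'] := eqVneq i i'.
    rewrite dfwithin; congr (n i _); apply/funext => j'.
    have [<-|jj'] := eqVneq j j'; first by rewrite !dfwithin.
    rewrite !dfwithout//; apply: contraNneq jj' => /eqP.
    by rewrite eq_Tagged.
  rewrite dfwithout//; congr (n i' _); apply/funext => j'.
  by rewrite dfwithout//; apply: contraNneq ii' => /(congr1 tag)/= ->.
by rewrite !E; have [-> _] := nP i; rewrite mm.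
Qed.

(** * Composition of power series *)

Section power_series.
Variable R : realType.

Lemma near_translate (X : tvsType R[i]) (x : X) (A : set X) : nbhs x A ->
  nbhs (0 : X) [set w | A (x + w)].
Proof.
move=> xA.
have h0 := @tvs_cvgD _ X _ (nbhs (0 : X)) _ (fun=> x) id x 0 (@cvg_cst _ _ _ _ _) cvg_id.
by apply: h0; rewrite addr0.
Qed.

Lemma near_untranslate (X : tvsType R[i]) (x : X) (A : set X) :
  nbhs (0 : X) [set w | A (x + w)] -> nbhs x A.
Proof.
move=> A0.
have h0 : (fun z => z - x) @ x --> x - x.
  by apply: (@tvs_cvgB _ X _ (nbhs x)); [exact: cvg_id|exact: cvg_cst].
move: h0; rewrite subrr => /(_ _ A0); rewrite nbhs_simpl.
by apply: (@filterS _ (nbhs x)) => z /=; rewrite subrKC.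
Qed.

Lemma power_series_open (X H : tvsType R[i]) (U : set X) (f : X -> H) :
  power_series_analytic U f -> open U.
Proof.
move=> [_ h]; rewrite openE => x /h[W [p [W0 _ Wp]]].
apply: near_untranslate; apply: (@filterS _ _ _ W) => // w Ww.
by have [] := Wp w Ww.
Qed.

Lemma power_series_cont (X H : tvsType R[i]) (U : set X) (f : X -> H) :
  power_series_analytic U f -> cont_on U f.
Proof. by move=> fU; apply/(within_openP _ (power_series_open fU)); have [] := fU. Qed.

(** The image of a square of half-side [r]; the triangle inequality puts it into the disc of radius
    [2 * r], which is why radius 3 is later accompanied by radius 6. *)
Lemma disc_compact (r : R) : 0 <= r -> exists Q : set R[i]^o,
  [/\ compact Q, forall c, cnorm c <= r -> Q c & forall c, Q c -> cnorm c <= 2 * r].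
Proof.
move=> r0.
pose F (p : R^o * R^o) : R[i]^o := p.1%:C%C + 'i%C *: (p.2%:C%C : R[i]^o).
have cF : continuous F.
  have cC : continuous (fun a : R^o => a%:C%C : R[i]^o).
    exact: (field_incl_continuous (f := real_complex_inclusion R)).
  move=> p; apply: (@tvs_cvgD R[i] R[i]^o _ (nbhs p)).
    by apply: (@continuous_comp _ _ _ (@fst R^o R^o) (fun a : R^o => a%:C%C : R[i]^o));
      [exact: cvg_fst|exact: cC].
  apply: (@tvs_cvgZr R[i] R[i]^o _ (nbhs p)).
  by apply: (@continuous_comp _ _ _ (@snd R^o R^o) (fun a : R^o => a%:C%C : R[i]^o));
      [exact: cvg_snd|exact: cC].
exists (F @` (`[- r, r] `*` `[- r, r])); split.
- apply: continuous_compact; first exact: continuous_subspaceT.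
  by apply: compact_setX; exact: segment_compact.
- move=> c cr; exists (complex.Re c, complex.Im c).
    have Er : `|complex.Re c| <= r.
      apply: le_trans cr; rewrite /cnorm normc_def /= -sqrtr_sqr ler_sqrt ?addr_ge0 ?sqr_ge0//.
      by rewrite lerDl sqr_ge0.
    have Ei : `|complex.Im c| <= r.
      apply: le_trans cr; rewrite /cnorm normc_def /= -sqrtr_sqr ler_sqrt ?addr_ge0 ?sqr_ge0//.
      by rewrite lerDr sqr_ge0.
    by split; rewrite /= in_itv /= -ler_norml.
  by rewrite [RHS]complexE.
move=> c [[a b] /= [+ +] <-]; rewrite /= !in_itv /= -!ler_norml => ar br.
rewrite -lecR -cnormE /F /=; apply: le_trans (ler_normD _ _) _.
rewrite -['i%C *: (b%:C%C : R[i]^o)]/('i%C * b%:C%C) normrM !cnormE !cnorm_real.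
have -> : cnorm ('i%C : R[i]) = 1.
  by rewrite /cnorm normc_def /= expr0n add0r expr1n sqrtr1.
rewrite rmorph1 mul1r -rmorphD lecR mulr2n mulrDl mul1r lerD//.
Qed.

Section uniform_bound.
Variables (H Z : tvsType R[i]) (Q1 Q2 : set R[i]^o) (phi : R[i] -> H) (phis : nat -> R[i] -> H).
Variables (O : set H) (G : H -> Z) (S : set Z).
Hypotheses (cQ1 : compact Q1) (cQ2 : compact Q2) (dS : disk S) (oO : open O).
Hypothesis phic : forall z, Q2 z -> {for z, continuous (phi : R[i]^o -> H)}.
Hypothesis phisu : forall T e, disk T -> 0 < e -> exists N, forall n z, (N <= n)%N -> Q2 z ->
  gauge_le T (phis n z - phi z) e.
Hypothesis Gc : forall l z, Q1 l -> Q2 z -> O (l *: phi z) /\ {for l *: phi z, continuous G}.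

(** For [(l, z)] near [(l0, z0)] and large [n], [l *: phis n z] stays where [G] is within 1 of
    [G (l0 *: phi z0)]; compactness makes this uniform. One number [N] is both the threshold for [n]
    and the bound, so that compactness can be used as a near covering along the filter [\oo]. *)
Lemma uniform_bound : exists N : nat, forall n l z, (N <= n)%N -> Q1 l -> Q2 z ->
  O (l *: phis n z) /\ gauge_le S (G (l *: phis n z)) N%:R.
Proof.
have /compact_near_coveringP/near_covering_withinP cov := compact_setX cQ1 cQ2.
pose P (N : nat) (x : R[i]^o * R[i]^o) := forall n, (N <= n)%N ->
  O (x.1 *: phis n x.2) /\ gauge_le S (G (x.1 *: phis n x.2)) N%:R.
have [|N _ NP] := cov _ \oo P _; last first.
  exists N => n l z Nn l1 z2; have := NP N (leqnn N) (l, z) (conj l1 z2) n Nn.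
  by [].
move=> [l0 z0] [/= Q1l Q2z].
have [Oh ch] := Gc Q1l Q2z; set h0 := l0 *: phi z0 in Oh ch.
have [M0 M0P] := gauge_le_ex dS (G h0).
have Ah : nbhs h0 (fun h => O h /\ gauge_le S (G h - G h0) 1).
  apply: filterI; first exact: open_nbhs_nbhs.
  exact: (near_bnd dS ltr01 ch).
have := @scale_continuous R[i] H ((l0 : R[i]^o), phi z0) _ Ah.
move=> [[B1 B2] /= [B1l B2z] B12].
have [T dT TB] := disk_ex (near_translate B2z).
have e2 : (0 : R) < 1 / 2 by rewrite divr_gt0.
have [N1 N1P] := phisu dT e2.
have near2 := near_bnd dT e2 (phic Q2z).
(* Large enough for [phis] to approximate [phi] and, as a bound, to exceed [M0 + 1]. *)
pose N2 := (maxn N1 (Num.Def.truncn (M0 + 1)).+1).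
exists ((B1 `*` [set z | gauge_le T (phi z - phi z0) (1 / 2)]), [set N | (N2 <= N)%N]).
  split; last by exists N2.
  by exists (B1, [set z : R[i]^o | gauge_le T (phi z - phi z0) (1 / 2)]) => //; split => //=;
    exact: near2.
move=> [[l z] N] /= [[B1l' zT] N2N] [Q1l' Q2z'] n Nn /=.
have N1n : (N1 <= n)%N.
  by apply: leq_trans Nn; apply: leq_trans N2N; exact: leq_maxl.
have hB2 : B2 (phis n z).
  have /(gauge_le_mem dT) : gauge_le T ((phis n z - phi z) + (phi z - phi z0)) (1 / 2 + 1 / 2).
    by apply: gauge_leD => //; exact: N1P.
  rewrite addrA subrK -splitr => /(_ (lexx _)) /TB /=.
  by rewrite subrKC.
have [Oh' b1] := B12 (l, phis n z) (conj B1l' hB2).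
split => //; apply: (@gauge_le_le _ _ _ dS _ (M0 + 1)); last first.
  rewrite (_ : G _ = G h0 + (G (l *: phis n z) - G h0)); last by rewrite subrKC.
  exact: (gauge_leD dS M0P b1).
have h1 : M0 + 1 < (Num.Def.truncn (M0 + 1)).+1%:R by exact: truncnS_gt.
apply: le_trans (ltW h1) _; rewrite ler_nat.
by apply: leq_trans N2N; exact: leq_maxr.
Qed.

End uniform_bound.
End power_series.

(** * The homogeneous terms of a composite and their convergence *)

Section composite_series.
Variables (R : realType) (X H Z : tvsType R[i]).
Variables (a : nat -> X -> H) (q : nat -> H -> Z).
Hypothesis aP : forall k, homogeneous_polynomial k (a k) /\ continuous (a k).
Hypothesis qP : forall l, homogeneous_polynomial l (q l) /\ continuous (q l).
Hypothesis a0 : forall w, a 0 w = 0.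

(** The partial sum of the inner series at [z *: w], with the powers of [z] pulled out to exhibit a
    polynomial in [z]. *)
Definition partial n (z : R[i]) w : H := \sum_(k < n.+1) z ^+ k *: a k w.

Let q_multi l : {m : ('I_l -> H) -> Z | multilinear m /\ forall x, q l x = m (fun=> x)}.
Proof. by apply: cid; have [[m mm qm] _] := qP l; exists m. Qed.

Let m (l : nat) : ('I_l -> H) -> Z := sval (q_multi l).
Arguments m : clear implicits.
Let mm (l : nat) : @multilinear_map R[i] H Z 'I_l (m l). Proof. exact: (svalP (q_multi l)).1. Qed.
Let qm l x : q l x = m l (fun=> x). Proof. exact: (svalP (q_multi l)).2. Qed.

(* [comp_coef n l N w] is the coefficient of [z ^+ N] in [q l (partial n z w)]. *)
Definition comp_coef n l N w : Z :=
  \sum_(k : {ffun 'I_l -> 'I_n.+1} | (\sum_i k i == N)%N) m l (fun i => a (k i) w).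

(** As [a 0] vanishes, degree [N] receives nothing from [l > N], and inner terms of degree above [N]
    cannot occur; hence this finite sum is already the untruncated coefficient. *)
Definition comp_term N w : Z := \sum_(l < N.+1) comp_coef N l N w.

(** Multilinear expansion sorted by total degree, which is at most [l * n]. *)
Lemma comp_coefE n l z w D : (l * n < D)%N ->
  q l (partial n z w) = \sum_(N < D) z ^+ N *: comp_coef n l N w.
Proof.
case: D => // D lD; rewrite qm /partial.
rewrite (@multilinear_map_sum _ _ _ _ _ (@mm l) _ ord0 (fun _ k => z ^+ k) (fun _ k => a k w)).
rewrite (partition_big (fun k : {ffun 'I_l -> 'I_n.+1} => inord (\sum_i k i) : 'I_D.+1) predT)//=.
apply: eq_bigr => N _; rewrite /comp_coef scaler_sumr.
have sk (k : {ffun 'I_l -> 'I_n.+1}) : (\sum_i k i < D.+1)%N.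
  apply: leq_ltn_trans lD; rewrite -[X in (_ <= X * _)%N]card_ord -sum_nat_const.
  by apply: leq_sum => i _; rewrite -ltnS.
have E (k : {ffun 'I_l -> 'I_n.+1}) : ((inord (\sum_i k i) : 'I_D.+1) == N) = ((\sum_i k i)%N == N).
  by rewrite -val_eqE /= inordK.
apply: eq_big => [k|k]; first by rewrite E.
by rewrite E => /eqP <-; rewrite expr_sum.
Qed.

Lemma comp_coef_eq0 n l N w : (N < l)%N -> comp_coef n l N w = 0.
Proof.
move=> Nl; rewrite /comp_coef big1// => k /eqP kN.
have [i ki] : exists i, k i = 0 :> nat.
  apply: contrapT => h; move: Nl; rewrite -kN ltnNge => /negP; apply.
  rewrite -[X in (X <= _)%N]card_ord -sum1_card; apply: leq_sum => i _.
  by rewrite lt0n; apply/eqP => ki; apply: h; exists i.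
by apply: (multilinear_map_eq0 (@mm l) (i := i)); rewrite ki a0.
Qed.

Lemma comp_coef_stable n l N w : (N <= n)%N -> comp_coef n l N w = comp_coef N l N w.
Proof.
move=> Nn; rewrite /comp_coef.
have bd (n' : nat) (k : {ffun 'I_l -> 'I_n'.+1}) i : (\sum_i k i)%N = N -> (k i <= N)%N.
  by move=> <-; rewrite (bigD1 i)//= leq_addr.
pose up (k : {ffun 'I_l -> 'I_N.+1}) : {ffun 'I_l -> 'I_n.+1} := [ffun i => inord (k i)].
pose dn (k : {ffun 'I_l -> 'I_n.+1}) : {ffun 'I_l -> 'I_N.+1} := [ffun i => inord (k i)].
have upE k i : up k i = k i :> nat.
  by rewrite ffunE inordK// ltnS (leq_trans _ Nn)// -ltnS.
rewrite (reindex_onto up dn) => [|k /eqP kN]; last first.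
  by apply/ffunP => i; apply: val_inj; rewrite [LHS]upE ffunE /= inordK// ltnS bd.
apply: eq_big => [k|k _].
  have -> : dn (up k) = k by apply/ffunP => i; apply: val_inj; rewrite ffunE /= upE inordK.
  by rewrite eqxx andbT; congr (_ == _); apply: eq_bigr => i _; rewrite upE.
by congr (m l _); apply/funext => i; rewrite upE.
Qed.

Lemma comp_coef_homogeneous n l N : homogeneous_polynomial N (comp_coef n l N).
Proof.
apply: homogeneous_sum => k /eqP <-.
by apply: homogeneous_comp; [exact: mm|move=> i; have [] := aP (k i)].
Qed.

Lemma partial_continuous n z : continuous (partial n z).
Proof.
move=> w; apply: (@tvs_cvg_sum _ _ _ (nbhs w)) => k.
by apply: (@tvs_cvgZr _ _ _ (nbhs w)); have [_] := aP k; apply.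
Qed.

(** The polynomials [q l] are continuous, but nothing is known about the chosen forms [m l]. So the
    coefficient is recovered from the values of [q l (partial n z x)] at finitely many roots of
    unity [z], each continuous in [x]. *)
Lemma comp_coef_continuous n l N : continuous (comp_coef n l N).
Proof.
pose D := (maxn (l * n) N).+1.
have ND : (N < D)%N by rewrite ltnS leq_maxr.
have D0 : (0 < D)%N by [].
have [w wP] := primitive_root_ex R D0.
have -> : comp_coef n l N = fun x => (D%:R * 1%:C%C ^+ N)^-1 *:
   \sum_(j < D) w ^+ (j * (D - N)) *: q l (partial n (1%:C%C * w ^+ j) x).
  apply/funext => x; rewrite (coef_extract (fun N => comp_coef n l N x) (@ltr01 R) ND wP).
  congr (_ *: _); apply: eq_bigr => j _; congr (_ *: _).
  by rewrite (@comp_coefE _ _ _ _ D)// ltnS leq_maxl.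
move=> x; apply: (@tvs_cvgZr _ _ _ (nbhs x)); apply: (@tvs_cvg_sum _ _ _ (nbhs x)) => j.
apply: (@tvs_cvgZr _ _ _ (nbhs x)).
apply: (@continuous_comp _ _ _ (partial n (1%:C%C * w ^+ j)) (q l)).
  exact: partial_continuous.
by have [_] := qP l; apply.
Qed.

Lemma comp_termP N : homogeneous_polynomial N (comp_term N) /\ continuous (comp_term N).
Proof.
split; first by apply: homogeneous_sum => l _; exact: comp_coef_homogeneous.
by move=> x; apply: (@tvs_cvg_sum _ _ _ (nbhs x)) => l; exact: comp_coef_continuous.
Qed.

(** Stability and vanishing allow all coefficients to be taken at the same [n], over a square of
    indices. *)
Lemma series_comp_term n w : series (comp_term ^~ w) n.+1 =
  \sum_(l < n.+1) \sum_(N < n.+1) comp_coef n l N w.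
Proof.
rewrite seriesEord exchange_big; apply: eq_bigr => N _ /=.
have Nn : (N <= n)%N by rewrite -ltnS.
rewrite /comp_term (big_ord_widen n.+1 (fun l => comp_coef N l N w))//.
rewrite [RHS](bigID (fun l : 'I_n.+1 => (l < N.+1)%N))/=.
rewrite [X in _ = _ + X]big1 ?addr0 => [|l]; last first.
  by rewrite -leqNgt => Nl; rewrite comp_coef_eq0.
by apply: eq_bigr => l _; rewrite [RHS]comp_coef_stable.
Qed.

(** The radii: both Cauchy estimates use circles of radius 2, the one in the scalar before [phi]
    needing convergence up to 3; the compact set around the disc of radius 3 reaches up to 6;
    uniform convergence of [partial] on radius 6 follows from convergence at 8. For large [n] this
    bounds [comp_coef n l N] by [(M + 1) / 2 ^ (l + N)], so that cutting off at [l, N <= n] costs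
    little. *)
Lemma comp_series_cvg (w : X) (phi : R[i] -> H) (G : H -> Z) (O : set H) :
  open O -> (forall h, O h -> {for h, continuous G}) ->
  (forall h, O h -> series (fun l => q l h) @ \oo --> G h) ->
  (forall z, cnorm z <= 8 -> series (fun k => z ^+ k *: a k w) @ \oo --> phi z) ->
  (forall z : R[i]^o, cnorm z <= 6 -> {for z, continuous (phi : R[i]^o -> H)}) ->
  (forall l z, cnorm l <= 6 -> cnorm z <= 6 -> O (l *: phi z)) ->
  series (comp_term ^~ w) @ \oo --> G (phi 1).
Proof.
move=> oO Gc qG aphi phic Ophi.
have r3 : (0 : R) <= 3 by [].
have [Q [cQ Q3 Q6']] := disc_compact r3.
have Q6 c : Q c -> cnorm c <= 6.
  by move/Q6' => h; apply: le_trans h _; rewrite -natrM ler_nat.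
apply: gauge_le_cvg => S dS.
have phisu T (e : R) : disk T -> 0 < e -> exists N, forall n z, (N <= n)%N -> cnorm z <= 6 ->
    gauge_le T (partial n z w - phi z) e.
  move=> dT e0.
  have n8 : cnorm (8%:R : R[i]) = 8 by rewrite cnorm_nat.
  have n8' : cnorm (8%:R : R[i]) <= 8 by rewrite n8.
  have [B B0 BP] := series_bnd dT (aphi 8%:R n8').
  pose b : R := 6 / 8.
  have b0 : 0 <= b by rewrite divr_ge0.
  have b1 : b < 1 by rewrite ltr_pdivrMr// mul1r ltr_nat.
  have e2 : 0 < e / 2 by rewrite divr_gt0.
  have [N NP] := small_geometric (B / (1 - b)) b0 b1 e2.
  exists N => n z Nn z6.
  have ub k : gauge_le T (z ^+ k *: a k w) (B * b ^+ k).
    have -> : z ^+ k *: a k w = (z / 8) ^+ k *: (8%:R ^+ k *: a k w).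
      by rewrite scalerA -exprMn divfK// pnatr_eq0.
    apply: (gauge_le_le dT) (gauge_leZ dT _ (BP k)).
    rewrite cnormX cnormM cnormV n8 [_ * B]mulrC ler_wpM2l// lerXn2r ?nnegrE ?mulr_ge0 ?cnorm_ge0//.
    by rewrite ler_wpM2r.
  have z8 : cnorm z <= 8 by apply: le_trans z6 _; rewrite ler_nat.
  have tl := series_tail dT b0 b1 B0 e2 (fun k _ => ub k) (aphi z z8) (n := n.+1).
  rewrite -opprB; apply: (gauge_leN dT); rewrite /partial.
  rewrite seriesEord in tl; apply: (gauge_le_le dT) tl.
  rewrite [X in _ <= X](splitr e) lerD2r mulrCA [_ * (B / _)]mulrC.
  by apply: NP; rewrite leqW.
have phic' z : Q z -> {for z, continuous (phi : R[i]^o -> H)} by move=> /Q6 /phic.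
have phisu' T (e : R) : disk T -> 0 < e -> exists N, forall n z, (N <= n)%N -> Q z ->
    gauge_le T (partial n z w - phi z) e.
  by move=> dT e0; have [N NP] := phisu T e dT e0; exists N => n z Nn /Q6; exact: NP.
have Gc' l z : Q l -> Q z -> O (l *: phi z) /\ {for l *: phi z, continuous G}.
  by move=> /Q6 l6 /Q6 z6; have Oh := Ophi l z l6 z6; split => //; exact: Gc.
have [N0 N0P] := uniform_bound (phi := phi) (phis := fun n z => partial n z w)
  cQ cQ dS oO phic' phisu' Gc'.
pose M : R := N0%:R; have M0 : 0 <= M by [].
(* By homogeneity, [c ^+ l *: q l h] is the [l]-th term of the series of [G] at [c *: h]; Cauchy's
   estimate is applied in [c]. *)
have qb n l z : (N0 <= n)%N -> cnorm z <= 3 -> gauge_le S (q l (partial n z w)) ((M + 1) / 2 ^+ l).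
  move=> Nn z3; apply: (@cauchy_bnd _ _ _ dS (fun l => q l (partial n z w))
    (fun c => G (c *: partial n z w)) M l M0) => c c3.
    have [Oc _] := N0P n c z Nn (Q3 c c3) (Q3 z z3).
    have -> : (fun k => c ^+ k *: q k (partial n z w)) = (q ^~ (c *: partial n z w)).
      by apply/funext => j; have [hj _] := qP j; rewrite (homogeneous_scale _ _ hj).
    exact: qG.
  have c3' : cnorm c <= 3 by rewrite c3 ler_nat.
  by have [_] := N0P n c z Nn (Q3 c c3') (Q3 z z3).
(* The second Cauchy estimate, for the polynomial in [z] whose coefficients these are. *)
have cb n l N : (N0 <= n)%N -> gauge_le S (comp_coef n l N w) ((M + 1) / 2 ^+ l / 2 ^+ N).
  move=> Nn; pose D := (maxn (l * n) N).+1.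
  apply: (@coef_bnd _ _ _ dS (fun N => comp_coef n l N w) D) => //.
    by rewrite ltnS leq_maxr.
  move=> z z2; rewrite -comp_coefE ?ltnS ?leq_maxl//; apply: qb => //.
  by rewrite z2 ler_nat.
have h0 : (0 : R) <= 1 / 2 by [].
have h1 : (1 / 2 : R) < 1 by rewrite ltr_pdivrMr// mul1r ltr1n.
have hs : 1 - 1 / 2 = 1 / 2 :> R by rewrite [X in X - _](splitr 1) addrK.
have hX k : (1 / 2 : R) ^+ k = 1 / 2 ^+ k by rewrite expr_div_n expr1n.
have e4 : (0 : R) < 1 / 4 by [].
have [N1 N1P] := small_geometric ((M + 1) * 4) h0 h1 e4.
have n11 : cnorm (1 : R[i]) <= 6 by rewrite cnorm1 ler1n.
have n13 : cnorm (1 : R[i]) <= 3 by rewrite cnorm1 ler1n.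
have [Ophi1 Gphi1] := Gc' 1 1 (Q3 1 n13) (Q3 1 n13); rewrite scale1r in Ophi1 Gphi1.
have pc : (fun n => partial n 1 w) @ \oo --> phi 1.
  apply: gauge_le_cvg => T dT; have [N NP] := phisu T 1 dT ltr01.
  by exists N => // n /= Nn; exact: NP.
have Gp : (fun n => G (partial n 1 w)) @ \oo --> G (phi 1).
  by apply: continuous_cvg => //.
have [N2 _ N2P] := near_bnd dS e4 Gp.
exists (maxn N0 (maxn N1 N2)).+1 => // -[//|n] /=; rewrite ltnS !geq_max => /and3P[N0n N1n N2n].
have small : (M + 1) * 4 * (1 / 2) ^+ n <= 1 / 4 by exact: N1P.
have hV k : (1 / 2 : R) ^+ k = (2 ^+ k)^-1 by rewrite expr_div_n expr1n mul1r.
have half_tail k k' : \sum_(k <= N < k') (1 / 2 : R) ^+ N <= (1 / 2) ^+ k * 2.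
  by have := geometric_tail k k' h0 h1; rewrite hs mul1r invrK.
have M1 : 0 <= M + 1 by rewrite addr_ge0.
have Mh k : 0 <= (M + 1) * (1 / 2) ^+ k by rewrite mulr_ge0 ?exprn_ge0.
(* The two sums differ by the coefficients of degree [N > n]. *)
have b1 : gauge_le S (series (comp_term ^~ w) n.+1 - \sum_(l < n.+1) q l (partial n 1 w)) (1 / 4).
  rewrite series_comp_term -opprB -sumrB; apply: (gauge_leN dS).
  apply: (gauge_le_le dS small).
  apply: (@gauge_le_le _ _ _ dS _ (\sum_(l < n.+1) ((M + 1) * (1 / 2) ^+ l * ((1 / 2) ^+ n.+1 *
    2)))).
    rewrite -mulr_suml -mulr_sumr -(big_mkord xpredT (fun l => (1 / 2) ^+ l)).
    have := half_tail 0 n.+1; rewrite expr0 exprSr; set s := \sum_(_ <= _ < _) _ => s2.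
    have := Mh n; have := ler_wpM2l (Mh n) s2; lra.
  apply: gauge_le_sum => // l _; pose D := (l * n + n).+1.
  rewrite (@comp_coefE _ _ _ _ D) ?ltnS ?leq_addr//.
  rewrite -!(big_mkord xpredT (fun N => 1 ^+ N *: comp_coef n l N w)).
  rewrite -(big_mkord xpredT (fun N => comp_coef n l N w)).
  rewrite (@big_cat_nat _ _ _ n.+1)//=; last by rewrite ltnS leq_addl.
  under eq_bigr do rewrite expr1n scale1r; rewrite [X in gauge_le _ X _]addrAC subrr add0r.
  apply: (@gauge_le_le _ _ _ dS _ (\sum_(n.+1 <= N < D) ((M + 1) * (1 / 2) ^+ l * (1 / 2) ^+ N))).
    by rewrite -mulr_sumr ler_wpM2l.
  by apply: gauge_le_sum => // N _; rewrite expr1n scale1r !hV; exact: cb.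
(* The series of [G] at [partial n 1 w], cut after [l = n]; one of the two quarters is the slack of
   [series_tail]. *)
have b2 : gauge_le S (G (partial n 1 w) - \sum_(l < n.+1) q l (partial n 1 w)) (1 / 4 + 1 / 4).
  have [Op _] := N0P n 1 1 N0n (Q3 1 n13) (Q3 1 n13); rewrite scale1r in Op.
  have ub l : gauge_le S (q l (partial n 1 w)) ((M + 1) * (1 / 2) ^+ l).
    by rewrite hV; exact: qb.
  have := series_tail dS h0 h1 M1 e4 (fun k _ => ub k) (qG _ Op) (n := n.+1).
  rewrite seriesEord; apply: (gauge_le_le dS).
  rewrite lerD2r hs exprSr; have := Mh n; lra.
have -> : series (comp_term ^~ w) n.+1 - G (phi 1) =
   (series (comp_term ^~ w) n.+1 - \sum_(l < n.+1) q l (partial n 1 w)) -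
   (G (partial n 1 w) - \sum_(l < n.+1) q l (partial n 1 w)) +
   (G (partial n 1 w) - G (phi 1)).
  by rewrite opprB [X in _ = X + _]addrA subrK [RHS]addrA subrK.
have -> : 1 = 1 / 4 + (1 / 4 + 1 / 4) + 1 / 4 :> R by lra.
by apply: gauge_leD => //; [exact: gauge_leB|exact: N2P].
Qed.

End composite_series.

(** * Stability properties of complex analytic maps *)

Section complex_analytic.
Variable R : realType.
Implicit Types X H Z : tvsType R[i].

Lemma power_series_intro X H (U : set X) (f : X -> H) : open U -> cont_on U f ->
  (forall x, U x -> exists W : set X, exists p : nat -> X -> H,
    [/\ nbhs 0 W, forall k, homogeneous_polynomial k (p k) /\ continuous (p k) &
        forall w, W w -> series (p ^~ w) @ \oo --> f (x + w)]) ->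
  power_series_analytic U f.
Proof.
move=> oU cf h; split; first exact/(within_openP _ oU).
move=> x Ux; have [W [p [W0 pP pf]]] := h x Ux.
exists (W `&` [set w | U (x + w)]), p; split => //.
  by apply: filterI => //; apply: (@near_translate R X x U); exact: open_nbhs_nbhs.
by move=> w [Ww Uw]; split => //; exact: pf.
Qed.

Lemma power_series_sub X H (U U' : set X) (f : X -> H) : open U' -> U' `<=` U ->
  power_series_analytic U f -> power_series_analytic U' f.
Proof.
move=> oU' U'U fU; apply: power_series_intro => //.
  by move=> x /U'U; exact: (power_series_cont fU).
move=> x /U'U Ux; have [_ /(_ x Ux) [W [p [W0 pP pf]]]] := fU.
by exists W, p; split => // w /pf[].
Qed.

Lemma power_series_eq X H (U : set X) (f g : X -> H) : (forall x, U x -> f x = g x) ->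
  power_series_analytic U f -> power_series_analytic U g.
Proof.
move=> fg fU; have oU := power_series_open fU; split.
  apply/(within_openP _ oU); exact: (cont_on_eq oU fg (power_series_cont fU)).
move=> x Ux; have [_ /(_ x Ux) [W [p [W0 pP pf]]]] := fU.
exists W, p; split => // w Ww; have [Uw pw] := pf w Ww.
by split => //; rewrite -fg.
Qed.

Lemma homogeneous_cst X H (y : H) : homogeneous_polynomial 0 (fun _ : X => y).
Proof. by exists (fun=> y) => // v []. Qed.

Lemma homogeneous_linear X H (f : X -> H) : linear f -> homogeneous_polynomial 1 f.
Proof.
move=> lf; exists (fun v => f (v ord0)) => // v i a x y.
by rewrite (ord1 i) !dfwithin lf.
Qed.

Lemma power_series_linear X H (U : set X) (f : X -> H) : open U -> linear f -> continuous f ->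
  power_series_analytic U f.
Proof.
move=> oU lf cf; apply: power_series_intro => // [x _|x Ux]; [exact: cf|exists setT].
exists (fun k : nat => if k is k1.+1 then (if k1 is _.+1 then fun=> 0 else f) else fun=> f x);
  split.
- exact: filterT.
- move=> [|[|k]]; split; try exact: cst_continuous; try exact: cf.
  + exact: homogeneous_cst.
  + exact: homogeneous_linear.
  + exact: homogeneous0.
move=> w _; set u := (X in series X).
have E n : series u n.+2 = f (x + w).
  have [g gE] := linear_exE lf; elim: n => [|n IH].
    by rewrite /series /= !big_nat_recr//= big_geq// add0r gE linearD.
  by rewrite seriesSr IH /= addr0.
move=> A fA; exists 2 => // -[//|[//|n]] _; rewrite /= E; exact: nbhs_singleton fA.
Qed.

Lemma power_series_product (I : finType) H (Hk : I -> tvsType R[i])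
    (p : forall k, H -> Hk k) X (U : set X) (f : X -> H) : open U ->
  tvs_product p -> (forall k, power_series_analytic U (fun x => p k (f x))) ->
  power_series_analytic U f.
Proof.
move=> oU pp fk; apply: power_series_intro => //.
  by move=> x Ux; apply: (tvs_product_cvg pp) => k; exact: (power_series_cont (fk k)).
move=> x Ux.
have hk k : exists Wq : set X * (nat -> X -> Hk k),
    [/\ nbhs 0 Wq.1, forall j, homogeneous_polynomial j (Wq.2 j) /\ continuous (Wq.2 j) &
        forall w, Wq.1 w -> series (Wq.2 ^~ w) @ \oo --> p k (f (x + w))].
  have [_ /(_ x Ux) [W [q [W0 qP qf]]]] := fk k.
  by exists (W, q); split => // w /qf[].
pose Wq k := sval (cid (hk k)).
have WqP k : [/\ nbhs 0 (Wq k).1, forall j, homogeneous_polynomial j ((Wq k).2 j) /\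
      continuous ((Wq k).2 j) &
    forall w, (Wq k).1 w -> series ((Wq k).2 ^~ w) @ \oo --> p k (f (x + w))].
  exact: svalP (cid (hk k)).
have [q qE] : exists q : nat -> X -> H, forall j k w, p k (q j w) = (Wq k).2 j w.
  have h j := tvs_product_maps (fun k => (Wq k).2 j) pp.
  by exists (fun j => sval (cid (h j))) => j k w; exact: (svalP (cid (h j))).
exists [set w | forall k, (Wq k).1 w], q; split.
- apply: (@filter_forall _ I _ _ (nbhs_filter (0 : X))) => k.
  by have [] := WqP k.
- move=> j; split; last first.
    move=> w; apply: (tvs_product_cvg pp) => k; rewrite qE.
    by under eq_fun do rewrite qE; have [_ /(_ j)[_ h] _] := WqP k; exact: h.
  have mk k : {m : ('I_j -> X) -> Hk k | multilinear m /\ forall x, (Wq k).2 j x = m (fun=> x)}.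
    by apply: cid; have [_ /(_ j)[[m m1 m2] _] _] := WqP k; exists m.
  have [m mE] := tvs_product_maps (fun k => sval (mk k)) pp.
  exists m => [v i a y z|w]; apply: (tvs_product_inj pp) => k.
    rewrite (tvs_product_linear pp) !mE; exact: (svalP (mk k)).1.
  by rewrite qE mE; exact: (svalP (mk k)).2.
move=> w Ww; apply: (tvs_product_cvg pp) => k.
have [_ _ /(_ w (Ww k))] := WqP k.
suff -> : (fun n => p k (series (q ^~ w) n)) = series ((Wq k).2 ^~ w) by [].
apply/funext => n; rewrite /series /=.
have [g gE] := linear_exE (tvs_product_linear pp k).
by rewrite gE linear_sum; apply: eq_bigr => j _; rewrite -gE qE.
Qed.

Lemma power_series_comp X H Z (U U' : set X) (V : set H) (f : X -> H) (g : H -> Z) :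
  hausdorff_space H -> open U' -> (forall x, U' x -> U x /\ V (f x)) ->
  power_series_analytic U f -> power_series_analytic V g ->
  power_series_analytic U' (fun x => g (f x)).
Proof.
move=> hH oU' U'UV fU gV; have oV := power_series_open gV.
apply: power_series_intro => //.
  move=> x /U'UV[Ux Vx]; apply: continuous_comp; first exact: (power_series_cont fU).
  exact: (power_series_cont gV).
move=> x U'x; have [Ux Vx] := U'UV x U'x; pose y := f x.
have [_ /(_ x Ux)[Wf [p [Wf0 pP pf]]]] := fU.
have [_ /(_ y Vx)[Wg [q [Wg0 qP qg]]]] := gV.
(* A homogeneous polynomial of degree 0 is constant, and at [w = 0] the series reduces to this
   constant; it equals the limit [f x] because [H] is Hausdorff. *)
have p0 w : p 0 w = y.
  have [h0 _] := pP 0.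
  have E v : p 0 v = p 0 0.
    by rewrite -[in RHS](scale0r v) (homogeneous_scale _ _ h0) expr0 scale1r.
  rewrite E; apply: (cvg_unique hH (F := (fun n => p 0 0) @ \oo)); first exact: cvg_cst.
  have [_] := pf 0 (nbhs_singleton Wf0); rewrite addr0.
  apply: cvg_trans; apply: near_eq_cvg; exists 1%N => // n /= n1.
  rewrite /series /= big_ltn// big1_seq ?addr0// => j.
  rewrite mem_index_iota => /and3P[_ j0 _]; have [hj _] := pP j.
  by have := homogeneous_scale 0 (0 : X) hj; rewrite (scale0r (0 : X)) expr0n gtn_eqF// scale0r.
(* The constant term leaves the inner series and enters the outer map as the translation
   [h |-> g (y + h)]. *)
pose a k w := if k is _.+1 then p k w else 0.
have aP k : homogeneous_polynomial k (a k) /\ continuous (a k).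
  by case: k => [|k]; [split; [exact: homogeneous0|exact: cst_continuous]|exact: pP].
pose O := Wg°.
have oO : open O by exact: open_interior.
have O0 : nbhs (0 : H) O by apply: open_nbhs_nbhs; split.
have OWg : O `<=` Wg by exact: interior_subset.
(* The radii 6 here and 8 below are those required by [comp_series_cvg]. *)
pose V' := [set h : H | forall c, cnorm c <= 6 -> O (c *: h)].
have V'0 : nbhs (0 : H) V' by exact: near_scale.
have cfx : {for x, continuous f} by exact: (power_series_cont fU).
have near1 : nbhs (0 : X) [set w | V' (f (x + w) - y)].
  apply: (@near_translate R X x [set z | V' (f z - y)]).
  have h0 : (fun z => f z - y) @ x --> y - y.
    by apply: (@tvs_cvgB _ H _ (nbhs x)); [exact: cfx|exact: cvg_cst].
  by apply: h0; rewrite subrr.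
have near2 : nbhs (0 : X) [set w | U' (x + w)].
  by apply: (@near_translate R X x U'); exact: open_nbhs_nbhs.
exists [set w | forall c, cnorm c <= 8 -> (Wf `&` [set w | V' (f (x + w) - y)] `&`
   [set w | U' (x + w)]) (c *: w)], (comp_term a qP); split.
- by apply: near_scale; apply: filterI => //; exact: filterI.
- by move=> k; exact: comp_termP.
move=> w Ww; pose phi z := f (x + z *: w) - y.
have -> : g (f (x + w)) = g (y + phi 1) by rewrite /phi scale1r subrKC.
apply: (@comp_series_cvg R X H Z a q qP (fun=> erefl) w phi (fun h => g (y + h)) O) => //.
- move=> h /OWg/qg[Vh _].
  apply: (@continuous_comp _ _ _ (fun h => y + h) g); last exact: (power_series_cont gV).
  by apply: (@tvs_cvgD _ H _ (nbhs h)); [exact: cvg_cst|exact: cvg_id].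
- by move=> h /OWg/qg[].
- move=> z z8; have [[Wfz _] _] := Ww z z8; have [_ pz] := pf _ Wfz.
  have : (fun n => series (p ^~ (z *: w)) n - y) @ \oo --> phi z.
    by apply: tvs_cvgB => //; exact: cvg_cst.
  apply: cvg_trans; apply: near_eq_cvg; exists 1%N => // n /= n1.
  rewrite /series /= [in RHS]big_ltn// [in LHS]big_ltn//= scaler0 add0r p0 addrC addKr.
  apply: eq_big_nat => j /andP[j0 _]; have [hj _] := pP j.
  by rewrite (homogeneous_scale _ _ hj); case: j j0 hj.
- move=> z z6; have z8 : cnorm z <= 8 by apply: le_trans z6 _; rewrite ler_nat.
  have [_ /U'UV[Uz _]] := Ww z z8.
  apply: (@tvs_cvgB _ H _ (nbhs (z : R[i]^o))); last exact: cvg_cst.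
  apply: (@continuous_comp _ _ _ (fun z : R[i]^o => x + z *: w) f);
    last exact: (power_series_cont fU).
  apply: (@tvs_cvgD _ X _ (nbhs (z : R[i]^o))); first exact: cvg_cst.
  by apply: (@tvs_cvgZ _ X _ (nbhs (z : R[i]^o)) _ (fun z => z)); [exact: cvg_id|exact: cvg_cst].
move=> l z l6 z6; have z8 : cnorm z <= 8 by apply: le_trans z6 _; rewrite ler_nat.
by have [[_ Vz] _] := Ww z z8; exact: Vz.
Qed.

End complex_analytic.

(** * Maps of class C^r *)

Lemma hausdorff_separated (T : topologicalType) :
  (forall x y : T, x <> y -> exists S : topologicalType, exists f : T -> S,
     [/\ hausdorff_space S, continuous f & f x <> f y]) -> hausdorff_space T.
Proof.
move=> h x y xy; apply: contrapT => /h[S [f [hS cf]]]; apply; apply: hS.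
move=> A B fA fB; have [z [Az Bz]] := xy _ _ (cf x A fA) (cf y B fB).
by exists (f z).
Qed.

Lemma hausdorff_tvs_product (K : numFieldType) (I : finType) (H : tvsType K)
    (Hk : I -> tvsType K) (p : forall k, H -> Hk k) : tvs_product p ->
  (forall k, hausdorff_space (Hk k)) -> hausdorff_space H.
Proof.
move=> pp hk; apply: hausdorff_separated => x y xy.
have [k pk] : exists k, p k x <> p k y.
  apply: contrapT => h; apply: xy; apply: (tvs_product_inj pp) => k.
  by apply: contrapT => pk; apply: h; exists k.
by exists (Hk k), (p k); split => //; exact: (tvs_product_continuous pp).
Qed.

Lemma hausdorff_pair (S T : topologicalType) :
  hausdorff_space S -> hausdorff_space T -> hausdorff_space (S * T)%type.
Proof.
move=> hS hT; apply: hausdorff_separated => -[x y] [x' y'] xy.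
have [xx'|xx'] := pselect (x = x'); last first.
  by exists S, fst; split => // z; exact: cvg_fst.
exists T, snd; split => //= [z|yy']; first exact: cvg_snd.
by apply: xy; rewrite xx' yy'.
Qed.

(** * Real analytic maps, through complexification *)

Section real_analytic.
Variable R : realType.
Implicit Types X H Z : tvsType R.

Lemma real_analytic_linear X H (U : set X) (f : X -> H) : linear f -> continuous f ->
  real_analytic U f.
Proof.
move=> lf cf; exists setT, (fun z => (f z.1, f z.2)); split => //.
- exact: openT.
- apply: power_series_linear; first exact: openT.
    move=> [a b] [x x'] [y y']; have [g ->] := linear_exE lf; congr (_, _) => /=.
      by rewrite linearD (linearB g) !(linearZ_LR g).
    by rewrite !linearD !(linearZ_LR g).
  apply: (@pair_continuous (X * X)%type) => z.
    by apply: (@continuous_comp _ _ _ fst f); [exact: cvg_fst|exact: cf].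
  by apply: (@continuous_comp _ _ _ snd f); [exact: cvg_snd|exact: cf].
by move=> x _ /=; have [g ->] := linear_exE lf; rewrite linear0.
Qed.

Lemma real_analytic_comp X H Z (U U' : set X) (V : set H) (f : X -> H) (g : H -> Z) :
  hausdorff_space H -> (forall x, U' x -> U x /\ V (f x)) ->
  real_analytic U f -> real_analytic V g -> real_analytic U' (fun x => g (f x)).
Proof.
move=> hH U'UV [V1 [f1 [oV1 UV1 f1a f1E]]] [V2 [g2 [oV2 VV2 g2a g2E]]].
(* The extension of [f] may leave the domain of the extension of [g]; this open preimage still
   contains the real points [(x, 0)] with [x] in [U']. *)
have oW : open (V1 `&` f1 @^-1` V2).
  rewrite openE => z [V1z V2z]; apply: filterI; first exact: open_nbhs_nbhs.
  by apply: (power_series_cont f1a); [|exact: open_nbhs_nbhs].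
exists (V1 `&` f1 @^-1` V2), (fun z => g2 (f1 z)); split => //.
- by move=> x /U'UV[Ux Vx]; split; [exact: UV1|rewrite /= f1E//; exact: VV2].
- apply: (power_series_comp (U := V1) (V := V2)) => //; first exact: hausdorff_pair.
by move=> x /U'UV[Ux Vx]; rewrite f1E// g2E.
Qed.

(** Complexification commutes with products, so extensions of the components assemble to an
    extension of the map. *)
Lemma complexify_product (I : finType) H (Hk : I -> tvsType R)
    (p : forall k, H -> Hk k) : tvs_product p ->
  @tvs_product R[i] I (complexify H) (fun k => complexify (Hk k))
    (fun k z => (p k z.1, p k z.2)).
Proof.
move=> pp; split.
- move=> k [a b] [x x'] [y y']; have [g gE] := linear_exE (tvs_product_linear pp k).
  rewrite gE; congr (_, _) => /=.
    by rewrite linearD (linearB g) !(linearZ_LR g).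
  by rewrite !linearD !(linearZ_LR g).
- move=> k; apply: (@pair_continuous (H * H)%type) => z.
    by apply: (@continuous_comp _ _ _ fst (p k)); [exact: cvg_fst|exact:
      (tvs_product_continuous pp)].
  by apply: (@continuous_comp _ _ _ snd (p k)); [exact: cvg_snd|exact: (tvs_product_continuous pp)].
- move=> T F f [l1 l2] FF fl.
  have -> : f = (fun x => ((f x).1, (f x).2)).
    by apply/funext => x; rewrite -surjective_pairing.
  apply: (@cvg_pair _ _ _ F (nbhs l1) (nbhs l2) FF _ _ (fun x => (f x).1) (fun x => (f x).2)).
    apply: (tvs_product_cvg pp) => k.
    have hc : {for (p k l1, p k l2), continuous (@fst (Hk k) (Hk k))} by exact: cvg_fst.
    exact: (continuous_cvg FF hc (fl k)).
  apply: (tvs_product_cvg pp) => k.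
  have hc : {for (p k l1, p k l2), continuous (@snd (Hk k) (Hk k))} by exact: cvg_snd.
  exact: (continuous_cvg FF hc (fl k)).
- move=> [x y] [x' y'] h; congr (_, _); apply: (tvs_product_inj pp) => k.
    exact: (congr1 fst (h k)).
  exact: (congr1 snd (h k)).
move=> y; have [h1 h1E] := tvs_product_lift pp (fun k => (y k).1).
have [h2 h2E] := tvs_product_lift pp (fun k => (y k).2).
by exists (h1, h2) => k; rewrite /= h1E h2E -surjective_pairing.
Qed.

Lemma real_analytic_product (I : finType) H (Hk : I -> tvsType R)
    (p : forall k, H -> Hk k) X (U : set X) (f : X -> H) : tvs_product p ->
  (forall k, real_analytic U (fun x => p k (f x))) -> real_analytic U f.
Proof.
move=> pp fk; have ppC := complexify_product pp.
have hk k : {Vg : set (complexify X) * (complexify X -> complexify (Hk k)) |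
    [/\ open Vg.1, forall x, U x -> Vg.1 (x, 0), complex_analytic Vg.1 Vg.2 &
        forall x, U x -> Vg.2 (x, 0) = (p k (f x), 0)]}.
  by apply: cid; have [V [g ?]] := fk k; exists (V, g).
pose V k := (sval (hk k)).1.
have VP k : [/\ open (V k), forall x, U x -> V k (x, 0), complex_analytic (V k) (sval (hk k)).2 &
        forall x, U x -> (sval (hk k)).2 (x, 0) = (p k (f x), 0)] by exact: svalP (hk k).
have [g gE] := tvs_product_maps (fun k => (sval (hk k)).2) ppC.
have oW : open [set z | forall k, V k z].
  rewrite openE => z Vz; apply: (@filter_forall _ I _ _ (nbhs_filter z)) => k.
  by apply: open_nbhs_nbhs; split; [have [] := VP k|exact: Vz].
exists [set z | forall k, V k z], g; split => //.
- by move=> x Ux k; have [_ + _ _] := VP k; exact.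
- apply: (power_series_product oW ppC) => k; have [_ _ ga _] := VP k.
  apply: (power_series_eq (f := (sval (hk k)).2)); first by move=> z _; rewrite -gE.
  by apply: power_series_sub ga => // z /(_ k).
move=> x Ux; apply: (tvs_product_inj ppC) => k; rewrite gE.
have [_ _ _ ->] := VP k => //=; congr (_, _).
by have [q ->] := linear_exE (tvs_product_linear pp k); rewrite linear0.
Qed.

End real_analytic.

Section of_class.
Variables (R : realType) (K : base_field) (r : diff_order).
Implicit Types X H Z : tvsType (base_scalars R K).

Lemma real_inclusion : field_inclusion R (base_scalars R K).
Proof. by case: K; [exact: (id_inclusion R)|exact: (real_complex_inclusion R)]. Qed.

(** Quantifying over the finite orders up to [r] treats finite and infinite [r] at once. *)
Lemma keller_cont_diff X H (U : set X) (f : X -> H) : hausdorff_space H -> open U ->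
  r <> Comega ->
  keller r U f <-> (forall n, diff_order_le (Cfinite n) r -> cont_diff n U f).
Proof.
move=> hH oU; case: r => // [m|] _.
  split; first by move=> /(keller_finP real_inclusion m f hH oU) h n nm; exact: cont_diff_le h.
  by move=> /(_ m (leqnn m)) /(keller_finP real_inclusion m f hH oU).
split=> h.
  move=> n _; apply/(keller_finP real_inclusion n f hH oU).
  by have [c d] := h; split => // j _; exact: d.
split; first by have /(keller_finP real_inclusion 0 f hH oU)[] := h 0 isT.
by move=> j _; have /(keller_finP real_inclusion j.+1 f hH oU)[_ d] := h j.+1 isT;
  exact: (d j (leqnn _)).
Qed.

Lemma of_class_keller X H (U : set X) (f : X -> H) : r <> Comega ->
  of_class r U f = keller r U f.
Proof. by case: r. Qed.

Lemma of_class_sub X H (U U' : set X) (f : X -> H) : hausdorff_space H ->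
  open U -> open U' -> U' `<=` U -> of_class r U f -> of_class r U' f.
Proof.
move=> hH oU oU' U'U; have [->|rw] := pselect (r = Comega).
  move: X H U U' f hH oU oU' U'U; rewrite /of_class /analytic;
    case: (K) => X H U U' f hH oU oU' U'U /=.
    by move=> [V [g [oV UV ga gE]]]; exists V, g; split => // x /U'U; [exact: UV|exact: gE].
  exact: power_series_sub.
rewrite !of_class_keller// !keller_cont_diff// => h n /h; exact: cont_diff_sub.
Qed.

Lemma of_class_eq X H (U : set X) (f g : X -> H) : hausdorff_space H ->
  open U -> (forall x, U x -> f x = g x) -> of_class r U f -> of_class r U g.
Proof.
move=> hH oU; have [->|rw] := pselect (r = Comega).
  move: X H U f g hH oU; rewrite /of_class /analytic; case: (K) => X H U f g hH oU fg /=.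
    by move=> [V [h [oV UV ga gE]]]; exists V, h; split => // x Ux; rewrite gE// fg.
  exact: power_series_eq.
move=> fg; rewrite !of_class_keller// !keller_cont_diff// => h n /h; exact: cont_diff_eq.
Qed.

Lemma of_class_linear X H (U : set X) (f : X -> H) : hausdorff_space H ->
  open U -> linear f -> continuous f -> of_class r U f.
Proof.
move=> hH oU; have [->|rw] := pselect (r = Comega).
  move: X H U f hH oU; rewrite /of_class /analytic; case: (K) => X H U f hH oU lf cf /=.
    exact: real_analytic_linear.
  exact: power_series_linear.
move=> lf cf; rewrite !of_class_keller// !keller_cont_diff// => n _; exact: cont_diff_linear.
Qed.

Lemma of_class_comp X H Z (U : set X) (V : set H) (f : X -> H) (g : H -> Z) :
  hausdorff_space H -> hausdorff_space Z -> open U -> open V ->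
  (forall x, U x -> V (f x)) ->
  of_class r U f -> of_class r V g -> of_class r U (fun x => g (f x)).
Proof.
move=> hH hZ oU oV UV; have [->|rw] := pselect (r = Comega).
  move: X H Z U V f g hH hZ oU oV UV; rewrite /of_class /analytic.
  case: (K) => X H Z U V f g hH hZ oU oV UV /=.
    by apply: real_analytic_comp => // x Ux; split => //; exact: UV.
  by apply: power_series_comp => // x Ux; split => //; exact: UV.
rewrite !of_class_keller// !keller_cont_diff// => fC gC n nr.
exact: (cont_diff_comp real_inclusion oV UV (fC n nr) (gC n nr)).
Qed.

Lemma of_class_product (I : finType) H (Hk : I -> tvsType (base_scalars R K))
    (p : forall k, H -> Hk k) X (U : set X) (f : X -> H) :
  (forall k, hausdorff_space (Hk k)) -> open U -> tvs_product p ->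
  (forall k, of_class r U (fun x => p k (f x))) -> of_class r U f.
Proof.
move=> hk oU; have [->|rw] := pselect (r = Comega).
  move: I H Hk p X U f hk oU; rewrite /of_class /analytic.
  case: (K) => I H Hk p X U f hk oU pp /=.
    exact: real_analytic_product pp.
  exact: power_series_product.
move=> pp fC; have hH := hausdorff_tvs_product pp hk.
rewrite of_class_keller// keller_cont_diff// => n nr; apply: (cont_diff_product pp) => k.
by have := fC k; rewrite of_class_keller// keller_cont_diff//; exact.
Qed.

Lemma of_class_pair X (H1 H2 : tvsType (base_scalars R K)) (U : set X) (f : X -> H1)
    (g : X -> H2) : hausdorff_space H1 -> hausdorff_space H2 -> open U ->
  of_class r U f -> of_class r U g ->
  of_class r U (fun x => (f x, g x) : (H1 * H2)%type).
Proof.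
move=> h1 h2 oU fC gC; apply: (of_class_product _ oU (pair_tvs_product H1 H2)); by case.
Qed.

End of_class.

(** * Charts and manifolds *)

Lemma open_preimage_on (T S : topologicalType) (A : set T) (B : set S) (f : T -> S) :
  open A -> cont_on A f -> open B -> open (A `&` f @^-1` B).
Proof.
move=> oA cf oB; rewrite openE => x [Ax Bx]; apply: filterI.
  exact: open_nbhs_nbhs.
by apply: cf => //; exact: open_nbhs_nbhs.
Qed.

Section charts.
Variables (T X : topologicalType) (c : chart T X).
Hypothesis cc : is_chart c.

Lemma chart_dom_open : open (chart_dom c). Proof. by case: cc. Qed.

Lemma chart_imT_open : open (chart_im c setT). Proof. by case: cc. Qed.

Lemma chart_map_cont : cont_on (chart_dom c) (chart_map c).
Proof. by have [oD _ h _ _] := cc; apply/(within_openP _ oD). Qed.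

Lemma chart_inv_cont : cont_on (chart_im c setT) (chart_inv c).
Proof. by have [_ oD _ h _] := cc; apply/(within_openP _ oD). Qed.

Lemma chart_mapK t : chart_dom c t -> chart_inv c (chart_map c t) = t.
Proof. by move=> ct; have [_ _ _ _] := cc; apply; exact/mem_set. Qed.

Lemma chart_imTP x : chart_im c setT x ->
  chart_dom c (chart_inv c x) /\ chart_map c (chart_inv c x) = x.
Proof. by move=> [t [ct _] <-]; rewrite chart_mapK. Qed.

Lemma chart_imP A x : chart_im c A x <-> chart_im c setT x /\ A (chart_inv c x).
Proof.
split=> [[t [ct At] <-]|[/chart_imTP[h1 h2] Ax]].
  by rewrite chart_mapK//; split => //; exists t.
by exists (chart_inv c x).
Qed.

Lemma chart_imE A : chart_im c A = chart_im c setT `&` chart_inv c @^-1` A.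
Proof. by apply/seteqP; split => x /chart_imP. Qed.

Lemma chart_im_open A : open A -> open (chart_im c A).
Proof.
move=> oA; rewrite chart_imE; apply: open_preimage_on => //.
  exact: chart_imT_open.
exact: chart_inv_cont.
Qed.

End charts.

Lemma prod_chart_im (T S X Y : Type) (c : chart T X) (d : chart S Y) (A : set T) (B : set S) :
  chart_im (prod_chart c d) (A `*` B) = chart_im c A `*` chart_im d B.
Proof.
apply/seteqP; split => [_ [[t s] [[ct ds] [At Bs]] <-]|[x y] [[t [ct At] tx] [s [ds Bs] sy]]].
  by split; [exists t|exists s].
by exists (t, s); rewrite //= tx sy.
Qed.

Lemma prod_is_chart (T S X Y : topologicalType) (c : chart T X) (d : chart S Y) :
  is_chart c -> is_chart d -> @is_chart (T * S)%type (X * Y)%type (prod_chart c d).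
Proof.
move=> cc dd.
have oX (P Q : topologicalType) (A : set P) (B : set Q) : open A -> open B ->
    open (A `*` B : set (P * Q)%type).
  move=> oA oB; rewrite openE => -[p q] [Ap Bq].
  by exists (A, B) => //; split; exact: open_nbhs_nbhs.
have oD : open (chart_dom (prod_chart c d) : set (T * S)%type).
  by apply: oX; exact: chart_dom_open.
have imE : chart_im (prod_chart c d) setT = chart_im c setT `*` chart_im d setT.
  by rewrite -prod_chart_im -setXTT.
have oI : open (chart_im (prod_chart c d) setT : set (X * Y)%type).
  by rewrite imE; apply: oX; exact: chart_imT_open.
have cp (P P' Q Q' : topologicalType) (A : set P) (B : set Q) (f : P -> P') (g : Q -> Q') :
    cont_on A f -> cont_on B g ->
    cont_on (A `*` B : set (P * Q)%type) (fun p => (f p.1, g p.2) : (P' * Q')%type).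
  move=> cf cg [p q] [Ap Bq].
  apply: (@cvg_pair _ _ _ (nbhs (p, q)) (nbhs (f p)) (nbhs (g q))).
    by apply: (@continuous_comp _ _ _ (@fst P Q) f (p, q)); [exact: cvg_fst|exact: cf].
  by apply: (@continuous_comp _ _ _ (@snd P Q) g (p, q)); [exact: cvg_snd|exact: cg].
split => //.
- by apply/(within_openP _ oD); apply: cp; exact: chart_map_cont.
- by apply/(within_openP _ oI); rewrite imE; apply: cp; exact: chart_inv_cont.
by move=> [t s] /set_mem[/= ct ds]; rewrite (chart_mapK cc)// (chart_mapK dd).
Qed.

Lemma id_is_chart (T : topologicalType) : @is_chart T T (Chart setT id id).
Proof.
have E : chart_im (Chart setT id id : chart T T) setT = setT.
  by rewrite /chart_im /= setTI image_id.
split; rewrite ?E; try exact: openT; try by [].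
- by apply/(within_openP _ openT) => x _; exact: cvg_id.
- by apply/(within_openP _ openT) => x _; exact: cvg_id.
Qed.

Section class_on.
Variables (R : realType) (K : base_field) (r : diff_order).
Local Notation data := (manifold_data R K).

Lemma class_on_cont (T S : Type) (M : data T) (N : data S) (A : set T) (f : T -> S) :
  open (A : set (manifold_space M)) -> class_on r M N A f ->
  @cont_on (manifold_space M) (manifold_space N) A f.
Proof. by move=> oA [cf _]; apply/(within_openP _ oA). Qed.

Lemma class_onI (T S : Type) (M : data T) (N : data S) (A : set T) (f : T -> S) :
  open (A : set (manifold_space M)) -> @cont_on (manifold_space M) (manifold_space N) A f ->
  (forall c d, manifold_atlas M c -> manifold_atlas N d ->
    of_class r (chart_im c (A `&` f @^-1` chart_dom d))
      (chart_map d \o f \o chart_inv c)) -> class_on r M N A f.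
Proof. by move=> oA cf h; split => //; apply/(within_openP _ oA). Qed.

(** What coordinate expressions require of a manifold, leaving transition maps aside: it is
    available for products, and for the Whitney atlas before its transition maps are known to be of
    class C^r. *)
Definition charted (T : Type) (M : data T) : Prop :=
  hausdorff_space (manifold_model M) /\
  forall c, manifold_atlas M c -> @is_chart (manifold_space M) (manifold_model M) c.

Lemma manifold_charted (T : Type) (M : data T) : is_manifold r M -> charted M.
Proof. by case. Qed.

Lemma prod_charted (T S : Type) (M : data T) (N : data S) :
  charted M -> charted N -> charted (prod_data M N).
Proof.
move=> [hM cM] [hN cN]; split; first exact: hausdorff_pair.
move=> _ [c Mc [d Nd <-]]; apply: prod_is_chart; [exact: cM|exact: cN].
Qed.

Lemma class_im_open (T S : Type) (M : data T) (N : data S) (A : set T) (f : T -> S) c d :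
  charted M -> charted N -> open (A : set (manifold_space M)) ->
  @cont_on (manifold_space M) (manifold_space N) A f ->
  manifold_atlas M c -> manifold_atlas N d ->
  open (chart_im c (A `&` f @^-1` chart_dom d)).
Proof.
move=> [_ cM] [_ cN] oA cf Mc Nd.
apply: (@chart_im_open (manifold_space M) (manifold_model M)); first exact: cM.
apply: (@open_preimage_on (manifold_space M) (manifold_space N)) => //.
by apply: (@chart_dom_open (manifold_space N) (manifold_model N)); exact: cN.
Qed.

Lemma class_on_sub (T S : Type) (M : data T) (N : data S) (A B : set T) (f : T -> S) :
  charted M -> charted N -> open (A : set (manifold_space M)) ->
  open (B : set (manifold_space M)) -> B `<=` A ->
  class_on r M N A f -> class_on r M N B f.
Proof.
move=> hM hN oA oB BA fA; have cf := class_on_cont oA fA.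
have cfB : @cont_on (manifold_space M) (manifold_space N) B f by move=> x /BA; exact: cf.
apply: class_onI => // c d Mc Nd.
apply: (@of_class_sub _ _ _ _ _ (chart_im c (A `&` f @^-1` chart_dom d))).
- by case: hN.
- exact: class_im_open cf Mc Nd.
- exact: class_im_open cfB Mc Nd.
- by move=> _ [t [ct [/BA At ft]] <-]; exists t.
by case: fA => _; exact.
Qed.

(* A composite is of class [C^r] on any set which it maps through a single
   chart of the intermediate manifold. *)
Lemma class_through (T1 T2 T3 : Type) (M1 : data T1) (M2 : data T2) (M3 : data T3)
    (A : set T1) (B : set T2) (f : T1 -> T2) (g : T2 -> T3) c e d O :
  charted M1 -> charted M2 -> charted M3 ->
  open (A : set (manifold_space M1)) -> open (B : set (manifold_space M2)) ->
  class_on r M1 M2 A f -> class_on r M2 M3 B g ->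
  manifold_atlas M1 c -> manifold_atlas M2 e -> manifold_atlas M3 d -> open O ->
  (forall x, O x -> let t := chart_inv c x in
     [/\ chart_im c setT x, A t, chart_dom e (f t), B (f t) & chart_dom d (g (f t))]) ->
  of_class r O (fun x => chart_map d (g (f (chart_inv c x)))).
Proof.
move=> h1 h2 h3 oA oB fA gB M1c M2e M3d oO OP.
have cf := class_on_cont oA fA; have cg := class_on_cont oB gB.
have cc := h1.2 c M1c; have ce := h2.2 e M2e.
have o1 := class_im_open h1 h2 oA cf M1c M2e.
have o2 := class_im_open h2 h3 oB cg M2e M3d.
have O1 x : O x -> chart_im c (A `&` f @^-1` chart_dom e) x.
  by move=> /OP[cx At ef _ _]; apply/(chart_imP cc).
have f1 : of_class r O (chart_map e \o f \o chart_inv c).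
  by apply: of_class_sub o1 oO O1 _; [case: h2|case: fA => _; exact].
have g1 : of_class r (chart_im e (B `&` g @^-1` chart_dom d)) (chart_map d \o g \o chart_inv e).
  by case: gB => _; exact.
have O2 x : O x -> chart_im e (B `&` g @^-1` chart_dom d) ((chart_map e \o f \o chart_inv c) x).
  by move=> /OP[cx At ef Bf df]; exists (f (chart_inv c x)) => //.
have := of_class_comp h2.1 h3.1 oO o2 O2 f1 g1.
apply: of_class_eq => //; first by case: h3.
by move=> x /OP[cx At ef _ _] /=; rewrite (chart_mapK ce).
Qed.

End class_on.

(** * The Whitney sum *)

Lemma prod_topology_cvgP (I : finType) (F : I -> topologicalType) (T : Type)
    (G : set_system T) (FG : Filter G) (f : T -> prod_topology F) (l : prod_topology F) :
  (forall i, (fun x => f x i) @ G --> l i) -> f @ G --> l.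
Proof.
move=> fl; apply/cvg_sup => i.
apply/cvg_image; first by rewrite eqEsubset; split => // y _;
  exists (dfwith l i y) => //; rewrite dfwithin.
move=> A /(fl i) fA; exists [set g | A (g i)] => //.
by rewrite eqEsubset; split => [y [g Ag <-]//|y Ay];
  exists (dfwith l i y); rewrite /= dfwithin.
Qed.

Lemma restrict_dprod_product (K L : numFieldType) (i : field_inclusion K L)
    (I : finType) (F : I -> tvsType L) :
  @tvs_product K I (restrict_scalars i (dprod F)) (fun k => restrict_scalars i (F k))
    (fun k h => h k).
Proof.
split.
- by [].
- by move=> k; exact: (@dprod_eval_continuous I L F k).
- move=> T G f l FG fl; exact: prod_topology_cvgP fl.
- by move=> h h' hh'; apply: functional_extensionality_dep.
- by move=> y; exists y.
Qed.

Lemma hausdorff_dprod (L : numFieldType) (I : finType) (F : I -> tvsType L) :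
  (forall k, hausdorff_space (F k)) -> hausdorff_space (dprod F).
Proof.
by move=> hF; have := hausdorff_tvs_product (restrict_dprod_product (id_inclusion L) F) hF.
Qed.

Section trivial_bundle.
Variables (R : realType) (K L : base_field) (KL : base_subfield K L).
Variables (M : Type) (MM : manifold_data R K M) (F : tvsType (base_scalars R L)).

Lemma trivial_charted : hausdorff_space F -> charted MM ->
  charted (trivial_data KL MM F).
Proof.
move=> hF hM; apply: prod_charted => //; split; first exact: hF.
by move=> c ->; exact: id_is_chart.
Qed.

Lemma trivial_open U : open (U : set (manifold_space MM)) ->
  open (U `*` setT : set (manifold_space (trivial_data KL MM F))).
Proof. exact: (@open_setXT (manifold_space MM) F). Qed.

End trivial_bundle.

Section bundle.
Variables (R : realType) (K L : base_field) (KL : base_subfield K L) (r : diff_order).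
Variables (M : Type) (MM : manifold_data R K M) (E : bundle R K L M).
Hypotheses (hM : charted MM) (hE : is_vector_bundle KL r MM E).
Local Notation A U := (bundle_proj E @^-1` U).
Local Notation td := (trivial_data KL MM (bundle_typical E)).
Local Notation local_triv := (@local_trivialization R K L KL r M MM E).

Lemma bundle_trivial_charted : charted td.
Proof. by apply: trivial_charted => //; have [_ h _ _ _] := hE. Qed.

Lemma bundle_charted : charted (bundle_data E).
Proof. by have [/manifold_charted] := hE. Qed.

Lemma bundle_proj_cont :
  continuous (bundle_proj E : manifold_space (bundle_data E) -> manifold_space MM).
Proof.
have [_ _ _ h _] := hE => v.
exact: (class_on_cont (@openT (manifold_space (bundle_data E))) h (x := v)).
Qed.

Lemma bundle_preimage_open U : open (U : set (manifold_space MM)) ->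
  open (A U : set (manifold_space (bundle_data E))).
Proof.
move=> oU; apply: (@open_comp (manifold_space (bundle_data E)) (manifold_space MM) (bundle_proj
  E)) => // v _.
exact: bundle_proj_cont.
Qed.

Section local_trivialization.
Variables (U : set M) (psi : bundle_total E -> M * bundle_typical E).
Hypothesis psiP : local_triv U psi.

Lemma triv_open : open (U : set (manifold_space MM)). Proof. by case: psiP. Qed.

Lemma triv_class : class_on r (bundle_data E) td (A U) psi.
Proof. by case: psiP => _ [h _]. Qed.

Lemma triv_fst v : U (bundle_proj E v) -> (psi v).1 = bundle_proj E v.
Proof.
move=> Uv; have [_ _ /(_ _ Uv) h _] := psiP.
have : ([set bundle_proj E v] `*` setT) (psi v) by rewrite -h; exists v.
by case.
Qed.

(** [diffeo_on] provides a left inverse only; as the image is all of [U] times the fibre, it is also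
    a right inverse there, and it respects the fibres by [triv_fst]. *)
Lemma triv_inv : exists g : M * bundle_typical E -> bundle_total E,
  [/\ class_on r td (bundle_data E) (U `*` setT) g,
      forall v, U (bundle_proj E v) -> g (psi v) = v &
      forall y z, U y -> bundle_proj E (g (y, z)) = y /\ psi (g (y, z)) = (y, z)].
Proof.
have [_ [_ [im [g [gC gK]]]] _ _] := psiP.
exists g; split => // [v Uv|y z Uy]; first by apply: gK; exact/mem_set.
have : (U `*` setT) (y, z) by [].
rewrite -im => -[v Uv vE]; rewrite -vE gK; last exact/mem_set.
by rewrite -(triv_fst Uv) vE.
Qed.

Lemma triv_sub U' : open (U' : set (manifold_space MM)) -> U' `<=` U ->
  local_triv U' psi.
Proof.
move=> oU' U'U; have oU := triv_open.
have [_ _ fib lin] := psiP; split => //; last 2 first.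
- by move=> y /U'U; exact: fib.
- by move=> y /U'U; exact: lin.
have [g [gC gK pg]] := triv_inv.
split.
  apply: (class_on_sub bundle_charted bundle_trivial_charted (bundle_preimage_open oU)
    (bundle_preimage_open oU')) triv_class.
  by move=> v /U'U.
split.
  apply/seteqP; split => [_ [v U'v <-]|[y z] [/= U'y _]].
    by split => //=; rewrite triv_fst//; exact: U'U.
  have [gy pgy] := pg y z (U'U _ U'y).
  by exists (g (y, z)) => //=; rewrite gy.
exists g; split; last by move=> v /set_mem/U'U; exact: gK.
apply: (class_on_sub bundle_trivial_charted bundle_charted (@trivial_open _ _ _ KL _ _
  (bundle_typical E) _ oU)
  (@trivial_open _ _ _ KL _ _ (bundle_typical E) _ oU')) gC.
by move=> [y z] [/U'U].
Qed.

End local_trivialization.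
End bundle.

Section whitney.
Variables (R : realType) (K L : base_field) (KL : base_subfield K L) (r : diff_order).
Variables (M : Type) (MM : manifold_data R K M) (n : nat) (E : 'I_n -> bundle R K L M).
Local Notation W := (whitney_total E).
Local Notation tot k := (bundle_total (E k)).
Local Notation F := (fun k => bundle_typical (E k)).
Local Notation incl := (base_inclusion R KL).
Local Notation RF := (restrict_scalars incl (dprod F)).
Local Notation X := (manifold_model MM).
Local Notation td := (trivial_data KL MM (dprod F)).
Local Notation tdk k := (trivial_data KL MM (bundle_typical (E k))).
Local Notation SM := (manifold_space MM).
Local Notation SE k := (manifold_space (bundle_data (E k))).
Local Notation piW := (@whitney_proj _ _ _ _ _ E).
Local Notation trivs := (forall k, tot k -> M * bundle_typical (E k)).
Local Notation triv := (local_trivialization KL r MM).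
Local Notation "'family_over' U psi" := (forall k, triv U (psi k))
  (at level 10, U at level 8, psi at level 8).

(** [{classic W}] supplies the choice structure required of a topological space. *)
Definition whitney_embedding (w : {classic W}) : SM * prod_topology (fun k => SE k) :=
  (@whitney_proj _ _ _ _ _ E w, @whitney_vec _ _ _ _ _ E w).

Definition whitney_space : topologicalType := initial_topology whitney_embedding.

Lemma whitney_embedding_cont :
  continuous (whitney_embedding : whitney_space -> SM * prod_topology (fun k => SE k)).
Proof. exact: initial_continuous. Qed.

Lemma whitney_proj_cont : continuous (@whitney_proj _ _ _ _ _ E : whitney_space -> SM).
Proof.
move=> w; apply: (@continuous_comp whitney_space (SM * prod_topology (fun k => SE k))%type SM
  whitney_embedding fst w); last exact: cvg_fst.
exact: whitney_embedding_cont.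
Qed.

Lemma whitney_vec_cont k : continuous (fun w : whitney_space => whitney_vec (E := E) w k : SE k).
Proof.
move=> w; apply: (@continuous_comp whitney_space (prod_topology (fun k => SE k)) (SE k)
  (fun w => (whitney_embedding w).2) (fun h => h k) w); last first.
  exact: (@proj_continuous _ (fun k => SE k)).
apply: (@continuous_comp whitney_space (SM * prod_topology (fun k => SE k))%type
  (prod_topology (fun k => SE k)) whitney_embedding snd w); last exact: cvg_snd.
exact: whitney_embedding_cont.
Qed.

Lemma to_whitney_cont (S : topologicalType) (f : S -> whitney_space) s :
  {for s, continuous (fun x => whitney_proj (E := E) (f x) : SM)} ->
  (forall k, {for s, continuous (fun x => whitney_vec (E := E) (f x) k : SE k)}) ->
  {for s, continuous f}.
Proof.
move=> cp cv B [C [[D oD <-] Df DB]].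
have ce : {for s, continuous (fun x => whitney_embedding (f x))}.
  apply: (@cvg_pair _ _ _ (nbhs s) (nbhs (whitney_proj (E := E) (f s) : SM))
    (nbhs ((whitney_embedding (f s)).2))); first exact: cp.
  apply: prod_topology_cvgP => k; exact: cv.
have := ce D (open_nbhs_nbhs (conj oD Df)).
by apply: (@filterS _ (nbhs s)) => x; exact: DB.
Qed.

Definition whitney_map (psi : trivs) (w : W) :
    M * dprod F :=
  (whitney_proj w, fun k => (psi k (whitney_vec w k)).2).

(* The inverse of [whitney_map psi] over the domain of [psi]; elsewhere the value
   is irrelevant, and taken in the fibre over [q.1]. *)
Definition whitney_sec (psi : trivs)
    (q : M * dprod F) : W :=
  @xget {classic W} (@whitney_in _ _ _ _ _ E q.1 0) [set w | whitney_map psi w = q].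

Record whitney_param := WhitneyParam {
  param_dom : set M;
  param_triv : forall k, tot k -> M * bundle_typical (E k);
  param_base : chart M X;
  param_fibre : forall k, chart (tot k) (manifold_model (bundle_data (E k))) }.

Definition param_valid (p : whitney_param) : Prop :=
  [/\ family_over (param_dom p) (param_triv p), manifold_atlas MM (param_base p) &
      forall k, manifold_atlas (bundle_data (E k)) (param_fibre p k)].

(* The charts of the total spaces enter the domain, although not the formula,
   so that all transition maps factor through a single chart of each [E k]. *)
Definition whitney_chart (p : whitney_param) : chart W (X * RF) :=
  Chart
    [set w | [/\ param_dom p (whitney_proj w), chart_dom (param_base p) (whitney_proj w) &
       forall k, chart_dom (param_fibre p k) (whitney_vec w k)]]
    (fun w => (chart_map (param_base p) (whitney_proj w), (whitney_map (param_triv p) w).2))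
    (fun q => whitney_sec (param_triv p) (chart_inv (param_base p) q.1, q.2)).

Definition whitney_data : manifold_data R K W :=
  @ManifoldData R K W (Topological.class whitney_space) (X * RF)%type
    [set whitney_chart p | p in param_valid].

Hypotheses (hM : is_manifold r MM) (hE : forall k, is_vector_bundle KL r MM (E k)).
Let cM := manifold_charted hM.

Section family.
Variables (U : set M) (psi : trivs).
Arguments psi : clear implicits.
Hypothesis psiP : family_over U psi.

Lemma whitney_map_inj v w : U (whitney_proj v) ->
  whitney_map psi v = whitney_map psi w -> v = w.
Proof.
move=> Uv vw; have pvw : whitney_proj v = whitney_proj w := congr1 fst vw.
apply: whitney_eq => // k; have [g [_ gK _]] := triv_inv (psiP k).
have Uvk : U (bundle_proj (E k) (whitney_vec v k)) by rewrite whitney_vecP.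
have Uwk : U (bundle_proj (E k) (whitney_vec w k)) by rewrite whitney_vecP -pvw.
rewrite -(gK _ Uvk) -(gK _ Uwk); congr g.
rewrite [LHS]surjective_pairing [RHS]surjective_pairing.
rewrite (triv_fst (psiP k) Uvk) (triv_fst (psiP k) Uwk) !whitney_vecP pvw; congr (_, _).
exact: (congr1 (fun q : M * dprod F => q.2 k) vw).
Qed.

Lemma whitney_secK q : U q.1 -> whitney_map psi (whitney_sec psi q) = q.
Proof.
case: q => y z Uy; apply: (@xgetPex {classic W} _ [set w | whitney_map psi w = (y, z)]).
have gk k : {g : M * bundle_typical (E k) -> tot k | forall y z, U y ->
    bundle_proj (E k) (g (y, z)) = y /\ psi k (g (y, z)) = (y, z)}.
  by apply: cid; have [g [_ _ ?]] := triv_inv (psiP k); exists g.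
have vP k : bundle_proj (E k) (sval (gk k) (y, z k)) = y.
  by have [] := svalP (gk k) y (z k) Uy.
exists (WhitneyTotal vP); rewrite /whitney_map /=; congr (_, _).
by apply: functional_extensionality_dep => k; have [_ ->] := svalP (gk k) y (z k) Uy.
Qed.

Lemma whitney_mapK w : U (whitney_proj w) -> whitney_sec psi (whitney_map psi w) = w.
Proof.
move=> Uw; have h := @whitney_secK (whitney_map psi w) Uw.
have pE : whitney_proj (whitney_sec psi (whitney_map psi w)) = whitney_proj w := congr1 fst h.
by apply: whitney_map_inj => //; rewrite pE.
Qed.

Lemma whitney_sec_proj q : U q.1 -> whitney_proj (whitney_sec psi q) = q.1.
Proof. by move=> Uq; exact: (congr1 fst (whitney_secK Uq)). Qed.

(** [whitney_sec] is a chosen preimage; this identifies its components with values of an inverse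
    [g], whose class is known. *)
Lemma whitney_sec_vec q k (g : M * bundle_typical (E k) -> tot k) :
  (forall v, U (bundle_proj (E k) v) -> g (psi k v) = v) -> U q.1 ->
  whitney_vec (whitney_sec psi q) k = g (q.1, q.2 k).
Proof.
move=> gK Uq; have h := whitney_secK Uq; have pE := whitney_sec_proj Uq.
have Uv : U (bundle_proj (E k) (whitney_vec (whitney_sec psi q) k)).
  by rewrite whitney_vecP pE.
rewrite -[LHS](gK _ Uv); congr g; rewrite [LHS]surjective_pairing.
rewrite (triv_fst (psiP k) Uv) whitney_vecP pE; congr (_, _).
exact: (congr1 (fun q : M * dprod F => q.2 k) h).
Qed.

Hypothesis oU : open (U : set SM).

Lemma whitney_preimage_open : open (piW @^-1` U : set whitney_space).
Proof.
apply: (@open_comp whitney_space SM (@whitney_proj _ _ _ _ _ E)) => // w _.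
exact: whitney_proj_cont.
Qed.

Lemma whitney_map_cont : @cont_on whitney_space (manifold_space td)
  (piW @^-1` U) (whitney_map psi).
Proof.
move=> w Uw; apply: (@cvg_pair _ _ _ (nbhs (w : whitney_space)) (nbhs (whitney_proj w : SM))
  (nbhs ((whitney_map psi w).2 : RF))); first exact: whitney_proj_cont.
apply: prod_topology_cvgP => k.
apply: (@continuous_comp whitney_space (manifold_space (tdk k)) (bundle_typical (E k))
  (fun w => psi k (whitney_vec (E := E) w k)) snd w); last exact: cvg_snd.
apply: (@continuous_comp whitney_space (SE k) (manifold_space (tdk k))
  (fun w => whitney_vec (E := E) w k) (psi k) w); first exact: whitney_vec_cont.
apply: (class_on_cont _ (triv_class (psiP k))).
  exact: (bundle_preimage_open (hE k)).
by rewrite /= whitney_vecP.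
Qed.

Lemma whitney_sec_cont : @cont_on (manifold_space td) whitney_space
  (U `*` setT) (whitney_sec psi).
Proof.
move=> q [Uq _].
have near_q : \forall q' \near (q : manifold_space td), U q'.1.
  apply: (@cvg_fst _ _ (nbhs (q.1 : SM)) (nbhs (q.2 : RF))).
  exact: open_nbhs_nbhs.
have ceq (S : topologicalType) (f g : manifold_space td -> S) :
    (forall q', U q'.1 -> f q' = g q') -> {for q, continuous g} -> {for q, continuous f}.
  move=> fg cg; rewrite /prop_for /continuous_at fg//.
  apply: cvg_trans cg; apply: near_eq_cvg.
  by apply: (@filterS _ (nbhs (q : manifold_space td)) _ _ _ _ near_q) => q' /fg ->.
apply: to_whitney_cont.
  apply: (ceq SM _ (fun q' => q'.1)); first by move=> q' Uq'; exact: whitney_sec_proj.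
  exact: cvg_fst.
move=> k; have [g [gC gK _]] := triv_inv (psiP k).
apply: (ceq (SE k) _ (fun q' => g (q'.1, q'.2 k))).
  by move=> q' Uq'; exact: whitney_sec_vec.
apply: (@continuous_comp (manifold_space td) (manifold_space (tdk k)) (SE k)
  (fun q' => (q'.1, q'.2 k)) g q); last first.
  apply: (class_on_cont _ gC); last by [].
  exact: trivial_open.
apply: (@cvg_pair _ _ _ (nbhs (q : manifold_space td)) (nbhs (q.1 : SM))
   (nbhs (q.2 k : bundle_typical (E k)))); first exact: cvg_fst.
apply: (@continuous_comp (manifold_space td) (dprod F) (bundle_typical (E k)) snd
  (fun h => h k) q); first exact: cvg_snd.
exact: dprod_eval_continuous.
Qed.

End family.

Local Notation SW := whitney_space.
Local Notation D := whitney_data.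
Let hF k : hausdorff_space (F k). Proof. by have [_ h _ _ _] := hE k. Qed.
Let hdF : hausdorff_space (dprod F). Proof. exact: hausdorff_dprod. Qed.
Let ctd : charted td. Proof. exact: trivial_charted. Qed.

(** The two trivializing families and the two base charts are independent, so this one statement
    yields changes of charts, the sum of trivializations, its inverse and the projection. Each fibre
    component is [psi2 k] after an inverse of [psi1 k], passing through the chart [e k]. *)
Lemma whitney_transition U1 U2 (psi1 psi2 : trivs)
    c1 c2 (e : forall k, chart (tot k) (manifold_model (bundle_data (E k))))
    (O : set (X * RF)%type) :
  family_over U1 psi1 -> family_over U2 psi2 ->
  open (U1 : set SM) -> open (U2 : set SM) ->
  manifold_atlas MM c1 -> manifold_atlas MM c2 ->
  (forall k, manifold_atlas (bundle_data (E k)) (e k)) -> open O ->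
  (forall q, O q -> let m := chart_inv c1 q.1 in
    [/\ chart_im c1 setT q.1, U1 m, U2 m, chart_dom c2 m &
      forall k, chart_dom (e k) (whitney_vec (whitney_sec psi1 (m, q.2)) k)]) ->
  of_class r O (fun q => let w := whitney_sec psi1 (chart_inv c1 q.1, q.2) in
    (chart_map c2 (whitney_proj w), (whitney_map psi2 w).2) : (X * RF)%type).
Proof.
move=> psi1P psi2P oU1 oU2 Mc1 Mc2 Me oO OP.
have [hX cX] := cM.
have hRF : hausdorff_space RF by exact: hdF.
pose comp1 (q : X * RF) : X := chart_map c2 (chart_inv c1 q.1).
have C1 : of_class r O comp1.
  apply: (@of_class_comp R K r (X * RF)%type X X O (chart_im c1 (chart_dom c2)) fst
    (chart_map c2 \o chart_inv c1)) => //.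
  - apply: (@chart_im_open SM X); first exact: cX.
    by apply: (@chart_dom_open SM X); exact: cX.
  - by move=> q /OP[cq _ _ c2q _]; apply/(@chart_imP SM X _ (cX _ Mc1)).
  - by apply: of_class_linear => // q; exact: cvg_fst.
  by have [_ _ _ _ h] := hM; exact: h.
have gk k : {g : M * bundle_typical (E k) -> tot k |
    [/\ class_on r (tdk k) (bundle_data (E k)) (U1 `*` setT) g,
      forall v, U1 (bundle_proj (E k) v) -> g (psi1 k v) = v &
      forall y z, U1 y -> bundle_proj (E k) (g (y, z)) = y /\ psi1 k (g (y, z)) = (y, z)]}.
  by apply: cid; have [g ?] := triv_inv (psi1P k); exists g.
pose g k := sval (gk k).
have gC k : class_on r (tdk k) (bundle_data (E k)) (U1 `*` setT) (g k) by have [] := svalP (gk k).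
have gK k v : U1 (bundle_proj (E k) v) -> g k (psi1 k v) = v by have [_ + _] := svalP (gk k); exact.
have gP k y z : U1 y -> bundle_proj (E k) (g k (y, z)) = y by have [_ _ h] := svalP (gk k);
  move=> /(h y z)[].
have secE k q : O q -> whitney_vec (whitney_sec psi1 (chart_inv c1 q.1, q.2)) k =
    g k (chart_inv c1 q.1, q.2 k).
  by move=> /OP[_ U1q _ _ _]; apply: (whitney_sec_vec psi1P (q := (_, _))) => //; exact: gK.
pose idF k : chart (bundle_typical (E k)) (restrict_scalars incl (bundle_typical (E k))) :=
  Chart setT id id.
pose comp2 (q : X * RF) : RF := fun k => (psi2 k (g k (chart_inv c1 q.1, q.2 k))).2.
have C2 : of_class r O comp2.
  apply: (of_class_product _ oO (restrict_dprod_product incl F)) => [k|k]; first exact: hF.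
  have cE := bundle_charted (hE k).
  have ctk : charted (tdk k) by exact: trivial_charted.
  have hRk : hausdorff_space (restrict_scalars incl (bundle_typical (E k))) by exact: hF.
  have hXk := hausdorff_pair hX hRk.
  pose c1' : chart (M * bundle_typical (E k)) (X * restrict_scalars incl (bundle_typical (E k))) :=
    prod_chart c1 (idF k).
  pose c2' : chart (M * bundle_typical (E k)) (X * restrict_scalars incl (bundle_typical (E k))) :=
    prod_chart c2 (idF k).
  have tc1 : manifold_atlas (tdk k) c1' by exists c1 => //; exists (idF k).
  have tc2 : manifold_atlas (tdk k) c2' by exists c2 => //; exists (idF k).
  have oU1T : open (U1 `*` setT : set (manifold_space (tdk k))) by exact: trivial_open.
  have oU2A : open (bundle_proj (E k) @^-1` U2 : set (SE k)).
    exact: (bundle_preimage_open (hE k)).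
  have gcont := class_on_cont oU1T (gC k).
  have pC := triv_class (psi2P k).
  have pcont := class_on_cont oU2A pC.
  have cc1' := ctk.2 _ tc1; have cc2' := ctk.2 _ tc2.
  (* The part of the chart domain of [e k] that [psi2 k] maps into the chart [c2']; its preimage
     gives the set [O'] on which [class_through] applies. *)
  pose B : set (SE k) := chart_dom (e k) `&`
    (bundle_proj (E k) @^-1` U2 `&` psi2 k @^-1` chart_dom c2').
  have oB : open B.
    apply: openI; first exact: (chart_dom_open (cE.2 _ (Me k))).
    by apply: (open_preimage_on oU2A pcont); exact: (chart_dom_open cc2').
  pose O' := chart_im c1' (U1 `*` setT `&` g k @^-1` B).
  have oO' : open O'.
    apply: (chart_im_open cc1'); exact: (open_preimage_on oU1T gcont oB).
  apply: (@of_class_comp R K r (X * RF)%type (X * restrict_scalars incl (bundle_typical (E k)))%type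
     (restrict_scalars incl (bundle_typical (E k))) O O' (fun q => (q.1, q.2 k))
     (fun x => (psi2 k (g k (chart_inv c1 x.1, x.2))).2)) => //.
  - move=> q Oq; have [cq U1q U2q c2q eq] := OP q Oq.
    apply/(chart_imP cc1'); split.
      rewrite /c1' -setXTT prod_chart_im; split => //=.
      by exists (q.2 k).
    split => //; rewrite /= -secE//; split; first exact: eq.
    rewrite /= whitney_vecP (whitney_sec_proj psi1P)//; split => //.
    have U2v : U2 (bundle_proj (E k) (g k (chart_inv c1 q.1, q.2 k))) by rewrite gP.
    by split => //=; rewrite secE// (triv_fst (psi2P k) U2v) gP.
  - apply: of_class_linear => // q.
    apply: (@cvg_pair _ _ _ (nbhs q) (nbhs q.1) (nbhs (q.2 k : restrict_scalars incl
      (bundle_typical (E k))))).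
      exact: cvg_fst.
    apply: (@continuous_comp _ RF (restrict_scalars incl (bundle_typical (E k))) snd (fun h =>
      h k) q).
      exact: cvg_snd.
    exact: dprod_eval_continuous.
  have mid : of_class r O' (fun x => chart_map c2' (psi2 k (g k (chart_inv c1' x)))).
    apply: (class_through ctk cE ctk oU1T oU2A (gC k) pC tc1 (Me k) tc2 oO') => x.
    by move=> /(chart_imP cc1')[cx [U1x [ex [U2x px]]]]; split.
  apply: (@of_class_comp R K r _ _ _ O' setT
    (fun x => chart_map c2' (psi2 k (g k (chart_inv c1' x)))) snd) => //.
    exact: openT.
  by apply: of_class_linear => //; [exact: openT|move=> x; exact: cvg_snd].
have := of_class_pair hX hRF oO C1 C2.
apply: of_class_eq => //; first exact: hausdorff_pair.
move=> q Oq; have [_ U1q _ _ _] := OP q Oq.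
rewrite /= (whitney_sec_proj psi1P)//; congr (_, _).
by apply: functional_extensionality_dep => k; rewrite /comp2 -secE.
Qed.

Hypothesis n_gt0 : (0 < n)%N.

(** For [n = 0] the premise would say nothing about [U]. *)
Lemma family_open U (psi : trivs) : family_over U psi -> open (U : set SM).
Proof. by move=> h; exact: (triv_open (h (Ordinal n_gt0))). Qed.

Let hmodel : hausdorff_space (X * RF)%type.
Proof. by apply: hausdorff_pair; [case: cM|exact: hdF]. Qed.

Section whitney_chart.
Variable p : whitney_param.
Hypothesis pP : param_valid p.
Local Notation c := (param_base p).
Local Notation psi := (param_triv p).
Local Notation sec q := (whitney_sec psi (chart_inv c q.1, q.2)).

Let psiP : family_over (param_dom p) psi. Proof. by case: pP. Qed.
Let oU : open (param_dom p : set SM). Proof. exact: family_open psiP. Qed.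
Let cc : @is_chart SM X c. Proof. by case: pP => _ h _; exact: cM.2. Qed.

Lemma whitney_chart_secK (w : W) : param_dom p (whitney_proj w) ->
  chart_dom c (whitney_proj w) ->
  whitney_sec psi (chart_inv c (chart_map c (whitney_proj w)), (whitney_map psi w).2) = w.
Proof.
move=> Uw cw; rewrite (chart_mapK cc)//.
by rewrite -[RHS](whitney_mapK psiP).
Qed.

Lemma whitney_chart_imP A (q : (X * RF)%type) : chart_im (whitney_chart p) A q <->
  [/\ chart_im c setT q.1, param_dom p (chart_inv c q.1),
      forall k, chart_dom (param_fibre p k) (whitney_vec (sec q) k) & A (sec q)].
Proof.
split=> [[w [[Uw cw ew] Aw] <-]|[cq Uq eq Aq]].
  rewrite /= whitney_chart_secK// (chart_mapK cc)//; split => //.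
  by exists (whitney_proj w).
have [ci cK] := chart_imTP cc cq.
have pE : whitney_proj (sec q) = chart_inv c q.1 by rewrite (whitney_sec_proj psiP).
exists (sec q); first by split => //; split => //; rewrite pE.
transitivity ((chart_map c (whitney_proj (sec q)), (whitney_map psi (sec q)).2) : (X *
  RF)%type) => //.
by rewrite pE cK (whitney_secK psiP)// -surjective_pairing.
Qed.

Lemma whitney_is_chart : @is_chart SW (X * RF)%type (whitney_chart p).
Proof.
have oUc : open (param_dom p `&` chart_dom c : set SM).
  by apply: openI => //; exact: chart_dom_open cc.
have oD : open (chart_dom (whitney_chart p) : set SW).
  rewrite openE => w [Uw cw ew].
  have h1 : \forall w' \near (w : SW), (param_dom p `&` chart_dom c) (whitney_proj (E := E) w').
    by apply: whitney_proj_cont; exact: open_nbhs_nbhs.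
  have h2 : \forall w' \near (w : SW), forall k, chart_dom (param_fibre p k) (whitney_vec (E :=
    E) w' k).
    apply: (@filter_forall _ 'I_n _ _ (nbhs_filter (w : SW))) => k.
    apply: (whitney_vec_cont (k := k)); apply: open_nbhs_nbhs; split; last exact: ew.
    have [_ _ /(_ k) h] := pP.
    exact: (chart_dom_open ((bundle_charted (hE k)).2 _ h)).
  by apply: (@filterS2 _ (nbhs (w : SW)) _ _ _ _ _ h1 h2) => w' [? ?] ?; split.
(* The section is continuous on all of [B], so the image of the chart is open as the part of [B]
   that the section maps into the chart domain. *)
pose B := [set q : (X * RF)%type | chart_im c (param_dom p) q.1].
have oB : open B.
  apply: (@open_comp (X * RF)%type X fst); last exact: (chart_im_open cc oU).
  by move=> q _; exact: cvg_fst.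
have secC : @cont_on (X * RF)%type SW B (fun q => sec q).
  move=> q /(chart_imP cc)[cq Uq].
  apply: (@continuous_comp (X * RF)%type (manifold_space td) SW
    (fun q => (chart_inv c q.1, q.2)) (whitney_sec psi) q).
    apply: (@cvg_pair _ _ _ (nbhs q) (nbhs (chart_inv c q.1 : SM)) (nbhs q.2)).
      apply: (@continuous_comp (X * RF)%type X SM fst (chart_inv c) q); first exact: cvg_fst.
      exact: (chart_inv_cont cc).
    exact: cvg_snd.
  by apply: (whitney_sec_cont psiP oU); split.
have imE : chart_im (whitney_chart p) setT =
    B `&` (fun q => sec q) @^-1` chart_dom (whitney_chart p).
  apply/seteqP; split => q.
    move=> /whitney_chart_imP[cq Uq eq _]; split; first exact/(chart_imP cc).
    have [ci _] := chart_imTP cc cq.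
    by split; rewrite ?(whitney_sec_proj psiP).
  move=> [/(chart_imP cc)[cq Uq] [_ _ eq]].
  by apply/whitney_chart_imP; split.
have oI : open (chart_im (whitney_chart p) setT).
  by rewrite imE; exact: (open_preimage_on oB secC).
split => //.
- apply/(within_openP _ oD) => w [Uw cw ew].
  apply: (@cvg_pair _ _ _ (nbhs (w : SW)) (nbhs (chart_map c (whitney_proj w)))
    (nbhs ((whitney_map psi w).2 : RF))).
    apply: (@continuous_comp SW SM X piW (chart_map c) w); first exact: whitney_proj_cont.
    exact: (chart_map_cont cc).
  apply: (@continuous_comp SW (manifold_space td) RF (whitney_map psi) snd w); last exact: cvg_snd.
  exact: (whitney_map_cont psiP oU).
- apply/(within_openP _ oI) => q; rewrite imE => -[Bq _]; exact: secC.
by move=> w /set_mem[Uw cw ew]; exact: whitney_chart_secK.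
Qed.

End whitney_chart.

Lemma whitney_charted : charted D.
Proof. by split=> // _ [p pP <-]; exact: whitney_is_chart. Qed.

Lemma family_ex x : exists U, exists psi : trivs, U x /\ family_over U psi.
Proof.
have tk k : {Up : set M * (tot k -> M * bundle_typical (E k)) | Up.1 x /\ triv Up.1 Up.2}.
  by apply: cid; have [_ _ _ _ /(_ x)[U [psi ?]]] := hE k; exists (U, psi).
exists [set y | forall k, (sval (tk k)).1 y], (fun k => (sval (tk k)).2); split.
  by move=> k; have [] := svalP (tk k).
move=> k; have [_ tP] := svalP (tk k).
apply: (triv_sub cM (hE k) tP); last by move=> y /(_ k).
rewrite openE => y Uy; apply: (@filter_forall _ 'I_n _ _ (nbhs_filter (y : SM))) => j.
have [_ tj] := svalP (tk j).
by apply: open_nbhs_nbhs; split; [exact: triv_open tj|exact: Uy].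
Qed.

Lemma whitney_param_ex (w : W) : exists p : whitney_param, param_valid p /\ chart_dom
  (whitney_chart p) w.
Proof.
have [U [psi [Uw psiP]]] := family_ex (whitney_proj w).
have [_ _ _ /(_ (whitney_proj w))[c Mc cw] _] := hM.
have ek k : {e | manifold_atlas (bundle_data (E k)) e & chart_dom e (whitney_vec w k)}.
  by apply: cid2; have [[_ _ _ h _] _ _ _ _] := hE k; exact: h.
exists (@WhitneyParam U psi c (fun k => s2val (ek k))); split; split => //=.
  by move=> k; exact: s2valP (ek k).
by move=> k; exact: s2valP' (ek k).
Qed.

Lemma whitney_hausdorff : hausdorff_space SW.
Proof.
apply: hausdorff_separated => v w vw.
have [pvw|pvw] := pselect (piW v = piW w); last first.
  exists SM, piW; split => //; first by case: hM.
  exact: whitney_proj_cont.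
have [k kvw] : exists k, whitney_vec (E := E) v k <> whitney_vec (E := E) w k.
  apply: contrapT => h; apply: vw; apply: (whitney_eq pvw) => k.
  by apply: contrapT => hk; apply: h; exists k.
exists (SE k), (fun u => whitney_vec (E := E) u k); split => //.
  by have [[]] := hE k.
exact: whitney_vec_cont.
Qed.

(** [p] only provides the charts of the total spaces; it may come from the source or from the target
    of the map considered. *)
Lemma whitney_transition_chart U1 U2 (psi1 psi2 : trivs) c1 c2 (p : whitney_param) (O : set (X
  * RF)%type) :
  family_over U1 psi1 -> family_over U2 psi2 ->
  manifold_atlas MM c1 -> manifold_atlas MM c2 -> param_valid p -> open O ->
  (forall q, O q -> let w := whitney_sec psi1 (chart_inv c1 q.1, q.2) in
    [/\ chart_im c1 setT q.1, U1 (chart_inv c1 q.1), U2 (whitney_proj w),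
      chart_dom c2 (whitney_proj w) &
      forall k, chart_dom (param_fibre p k) (whitney_vec w k)]) ->
  of_class r O (fun q => let w := whitney_sec psi1 (chart_inv c1 q.1, q.2) in
    (chart_map c2 (whitney_proj w), (whitney_map psi2 w).2) : (X * RF)%type).
Proof.
move=> psi1P psi2P Mc1 Mc2 [_ _ Me] oO OP.
apply: (whitney_transition psi1P psi2P (family_open psi1P) (family_open psi2P)
  Mc1 Mc2 Me oO) => q Oq.
by have [? U1q + + ?] := OP q Oq; rewrite (whitney_sec_proj psi1P)//; split.
Qed.

Lemma whitney_manifold : is_manifold r D.
Proof.
have [_ cD] := whitney_charted.
split => //; first exact: whitney_hausdorff.
  move=> w; have [p [pP pw]] := whitney_param_ex w.
  by exists (whitney_chart p) => //; exists p.
move=> _ _ [p1 p1P <-] [p2 p2P <-].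
have [psi1P c1P _] := p1P; have [psi2P c2P _] := p2P.
have c1 := whitney_is_chart p1P; have c2 := whitney_is_chart p2P.
apply: (whitney_transition_chart psi1P psi2P c1P c2P p1P).
  apply: (chart_im_open c1); exact: (chart_dom_open c2).
by move=> q /(whitney_chart_imP p1P)[cq Uq eq [Uq2 c2q eq2]]; split.
Qed.

Lemma whitney_map_class U (psi : trivs) : family_over U psi ->
  class_on r D td (piW @^-1` U) (whitney_map psi).
Proof.
move=> psiP; have oU := family_open psiP.
have oA := whitney_preimage_open oU.
have cf := whitney_map_cont psiP oU.
apply: (@class_onI R K r _ _ D td _ _ oA cf) => _ _ [p pP <-] [c Mc [d -> <-]].
have [p1P pc _] := pP.
apply: (whitney_transition_chart p1P psiP pc Mc pP).
  apply: (@class_im_open R K _ _ D td _ _ _ _ whitney_charted ctd oA cf); first by exists p.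
  by exists c => //; exists (Chart setT id id).
by move=> q /(whitney_chart_imP pP)[cq Uq eq [Uq2 [c2q _]]]; split.
Qed.

Lemma whitney_sec_class U (psi : trivs) : family_over U psi ->
  class_on r td D (U `*` setT) (whitney_sec psi).
Proof.
move=> psiP; have oU := family_open psiP.
have oUT : open (U `*` setT : set (manifold_space td)) by exact: trivial_open.
have cf := whitney_sec_cont psiP oU.
apply: (@class_onI R K r _ _ td D _ _ oUT cf) => _ _ [c Mc [d -> <-]] [p pP <-].
have [p1P pc _] := pP.
have tc : manifold_atlas td (prod_chart c (Chart setT id id)).
  by exists c => //; exists (Chart setT id id).
apply: (whitney_transition_chart psiP p1P Mc pc pP).
  by apply: (@class_im_open R K _ _ td D _ _ _ _ ctd whitney_charted oUT cf) => //; exists p.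
move=> q /(chart_imP (ctd.2 _ tc))[+ [[Uq _] [Uq2 cq eq]]].
by rewrite -setXTT prod_chart_im => -[cq1 _]; split.
Qed.

Lemma whitney_local_trivialization U (psi : trivs) : family_over U psi ->
  @local_trivialization _ _ _ KL r _ MM (whitney_bundle D) U (whitney_map psi).
Proof.
move=> psiP; split.
- exact: family_open psiP.
- split; first exact: whitney_map_class.
  split; last first.
    exists (whitney_sec psi); split; first exact: whitney_sec_class.
    by move=> w /set_mem Uw; exact: (whitney_mapK psiP).
  apply/seteqP; split => [_ [w Uw <-]//|q [Uq _]].
  by exists (whitney_sec psi q); [rewrite /= (whitney_sec_proj psiP)|exact: (whitney_secK psiP)].
- move=> y Uy; apply/seteqP; split => [_ [w <- <-]//|[_ z] [/= -> _]].
  exists (whitney_sec psi (y, z)); last exact: (whitney_secK psiP).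
  by rewrite /= (whitney_sec_proj psiP).
move=> y Uy a u v; apply: functional_extensionality_dep => k.
by have [_ _ _ /(_ y Uy a (u k) (v k))] := psiP k.
Qed.

Lemma whitney_vector_bundle : is_vector_bundle KL r MM (whitney_bundle D).
Proof.
split.
- exact: whitney_manifold.
- exact: hdF.
- by apply/seteqP; split => // x _; exists (@whitney_in _ _ _ _ _ E x 0).
- apply: class_onI; first exact: openT.
    by move=> w _; exact: whitney_proj_cont.
  move=> _ d [p pP <-] Md.
  have [psiP pc _] := pP; have cp := whitney_is_chart pP.
  have oO : open (chart_im (whitney_chart p) (setT `&` piW @^-1` chart_dom d)).
    apply: (class_im_open whitney_charted cM) => //; try exact: openT; last by exists p.
    by move=> w _; exact: whitney_proj_cont.
  have hX : hausdorff_space X by case: cM.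
  (* The projection is the first component of a transition with the same trivializations on both
     sides and the base chart changed to [d]. *)
  have f1 : of_class r (chart_im (whitney_chart p) (setT `&` piW @^-1` chart_dom d))
    (fun q => let w := whitney_sec (param_triv p) (chart_inv (param_base p) q.1, q.2) in
      (chart_map d (whitney_proj w), (whitney_map (param_triv p) w).2) : (X * RF)%type).
    apply: (whitney_transition_chart psiP psiP pc Md pP oO).
    move=> q /(whitney_chart_imP pP)[cq Uq eq [_ dq]]; split => //.
    by rewrite (whitney_sec_proj psiP).
  have g1 : of_class r (setT : set (X * RF)%type) (fst : (X * RF)%type -> X).
    by apply: of_class_linear => //; [exact: openT|move=> q; exact: cvg_fst].
  by have := of_class_comp hmodel hX oO openT (fun _ _ => I) f1 g1.
move=> x; have [U [psi [Ux psiP]]] := family_ex x.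
by exists U, (whitney_map psi); split => //; exact: whitney_local_trivialization.
Qed.

Lemma whitney_structure : is_whitney_structure KL r MM D.
Proof.
split; first exact: whitney_vector_bundle.
by move=> U psi; exact: whitney_local_trivialization.
Qed.

Let cW : charted D := whitney_charted.

Let base_chart (c : chart M X) : chart (M * dprod F) (X * RF) :=
  prod_chart c (Chart setT id id : chart (dprod F) RF).

Let base_chartP c : manifold_atlas MM c -> manifold_atlas td (base_chart c).
Proof. by move=> Mc; exists c => //; exists (Chart setT id id). Qed.

(** * Uniqueness of the Whitney structure *)

Section uniqueness.
Variable D' : manifold_data R K W.
Hypothesis D'P : is_whitney_structure KL r MM D'.
Local Notation E' := (whitney_bundle D').

Let cD' : charted D' := bundle_charted D'P.1.
Let openA U : open (U : set SM) -> open (piW @^-1` U : set (manifold_space D')).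
Proof. exact: (bundle_preimage_open D'P.1). Qed.

Let triv' U (psi : trivs) (psiP : family_over U psi) :
  @local_trivialization _ _ _ KL r _ MM E' U (whitney_map psi) := D'P.2 U psi psiP.

(** A chart of [D] is a chart of the trivial bundle after [whitney_map psi], and the latter is a
    trivialization for [D']; so the identity in coordinates is the coordinate expression of this
    trivialization. Continuity follows by writing the identity as [whitney_sec psi] after
    [whitney_map psi]. *)
Lemma id_to_whitney : class_on r D' D setT id.
Proof.
have cid' : @cont_on (manifold_space D') SW setT id.
  move=> w _; have [U [psi [Uw psiP]]] := family_ex (whitney_proj w).
  have oU := family_open psiP.
  have := @cont_on_eq (manifold_space D') SW (piW @^-1` U)
    (fun w => whitney_sec psi (whitney_map psi w)) id (openA oU).
  apply=> //; first by move=> v Uv; exact: (whitney_mapK psiP).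
  move=> v Uv; apply: (@continuous_comp (manifold_space D') (manifold_space td) SW
    (whitney_map psi) (whitney_sec psi) v).
    exact: (class_on_cont (openA oU) (triv_class (triv' psiP))).
  by apply: (whitney_sec_cont psiP oU); split.
apply: (@class_onI R K r _ _ D' D _ _ (@openT (manifold_space D')) cid').
move=> d _ D'd [p pP <-]; have [psiP pc _] := pP.
have oU := family_open psiP.
have pC := triv_class (triv' psiP); have pcont := class_on_cont (openA oU) pC.
have oO : open (chart_im d (setT `&` id @^-1` chart_dom (whitney_chart p))).
  by apply: (@class_im_open R K _ _ D' D _ _ _ _ cD' cW (@openT (manifold_space D')) cid') =>
    //; exists p.
have oV := @class_im_open R K _ _ D' td _ _ _ _ cD' ctd (openA oU) pcont D'd (base_chartP pc).
have : of_class r (chart_im d (piW @^-1` param_dom p `&`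
    whitney_map (param_triv p) @^-1` chart_dom (base_chart (param_base p))))
   (chart_map (base_chart (param_base p)) \o whitney_map (param_triv p) \o chart_inv d).
  by have [_ h] := pC; exact: (h _ _ D'd (base_chartP pc)).
by apply: of_class_sub => // _ [w [dw [_ [Uw cw ew]]] <-]; exists w.
Qed.

(** Now the inverse [g] of the trivialization for [D'] is used: by [gE], the inverse charts of [D]
    are [g] after inverse charts of the trivial bundle. *)
Lemma id_from_whitney : class_on r D D' setT id.
Proof.
have inv' U (psi : trivs) (psiP : family_over U psi) := triv_inv (triv' psiP).
have cid' : @cont_on SW (manifold_space D') setT id.
  move=> w _; have [U [psi [Uw psiP]]] := family_ex (whitney_proj w).
  have oU := family_open psiP.
  have [g [gC gK _]] := inv' _ _ psiP.
  have oUT : open (U `*` setT : set (manifold_space td)) by exact: trivial_open.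
  have := @cont_on_eq SW (manifold_space D') (piW @^-1` U)
    (fun w => g (whitney_map psi w)) id (whitney_preimage_open oU).
  apply=> //.
  move=> v Uv; apply: (@continuous_comp SW (manifold_space td) (manifold_space D')
    (whitney_map psi) g v).
    exact: (whitney_map_cont psiP oU).
  exact: (class_on_cont oUT gC).
apply: (@class_onI R K r _ _ D D' _ _ (@openT SW) cid').
move=> _ d [p pP <-] D'd; have [psiP pc _] := pP.
have oU := family_open psiP.
have [g [gC gK _]] := inv' _ _ psiP.
have oUT : open (param_dom p `*` setT : set (manifold_space td)) by exact: trivial_open.
have gcont := class_on_cont oUT gC.
have oO : open (chart_im (whitney_chart p) (setT `&` id @^-1` chart_dom d)).
  by apply: (@class_im_open R K _ _ D D' _ _ _ _ cW cD' (@openT SW) cid') => //; exists p.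
have oV := @class_im_open R K _ _ td D' _ _ _ _ ctd cD' oUT gcont (base_chartP pc) D'd.
have gE q : chart_im (whitney_chart p) (setT `&` id @^-1` chart_dom d) q ->
    g (chart_inv (base_chart (param_base p)) q) = chart_inv (whitney_chart p) q.
  move=> /(whitney_chart_imP pP)[cq Uq eq _].
  rewrite /= -[RHS]gK /=; last by rewrite (whitney_sec_proj psiP).
  by rewrite (whitney_secK psiP).
have : of_class r (chart_im (base_chart (param_base p)) ((param_dom p `*` setT) `&` g @^-1`
  chart_dom d))
   (chart_map d \o g \o chart_inv (base_chart (param_base p))).
  by have [_ h] := gC; exact: (h _ _ (base_chartP pc) D'd).
move=> /(of_class_sub cD'.1 oV oO) gd.
have : of_class r (chart_im (whitney_chart p) (setT `&` id @^-1` chart_dom d))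
   (chart_map d \o g \o chart_inv (base_chart (param_base p))).
  apply: gd => q qO; have [cq Uq eq [_ dq]] := (iffLR (whitney_chart_imP pP _ _)) qO.
  apply/(chart_imP (ctd.2 _ (base_chartP pc))); split.
    by rewrite /base_chart -setXTT prod_chart_im; split => //; exists q.2.
  by split; [split|rewrite /= gE].
apply: of_class_eq => //; first by case: cD'.
by move=> q qO; rewrite /= gE.
Qed.

Lemma whitney_unique : diffeo_on r D D' setT setT id.
Proof.
split; first exact: id_from_whitney.
split; first by rewrite image_id.
by exists id; split; [exact: id_to_whitney|].
Qed.

End uniqueness.

(** * The action on the Whitney sum *)

Section action.
Variables (G : groupType) (MG : manifold_data R K G) (a : G -> M -> M).
Variable b : forall k, G -> tot k -> tot k.
Arguments b : clear implicits.
Hypotheses (cG : charted MG) (aP : is_class_action r MG MM a).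
Hypothesis bP : forall k, is_class_action r MG (bundle_data (E k)) (b k).
Hypothesis ab : forall k g e, bundle_proj (E k) (b k g e) = a g (bundle_proj (E k) e).
Local Notation beta := (whitney_action ab).
Local Notation SG := (manifold_space MG).

Let acont : continuous (fun p : SG * SM => a p.1 p.2 : SM).
Proof.
have [_ h] := aP => p.
exact: (@class_on_cont R K r _ _ (prod_data MG MM) MM setT _ (@openT (SG * SM)%type) h p I).
Qed.

Let bcont k : continuous (fun p : SG * SE k => b k p.1 p.2 : SE k).
Proof.
have [_ h] := bP k => p.
exact: (@class_on_cont R K r _ _ (prod_data MG (bundle_data (E k))) (bundle_data (E k)) setT _
  (@openT (SG * SE k)%type) h p I).
Qed.

Lemma whitney_action_cont : continuous (fun p : SG * SW => beta p.1 p.2 : SW).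
Proof.
move=> p; apply: to_whitney_cont => [|k].
  apply: (@continuous_comp (SG * SW)%type (SG * SM)%type SM
    (fun p => (p.1, piW p.2)) (fun p => a p.1 p.2) p); last exact: acont.
  apply: (@cvg_pair _ _ _ (nbhs p) (nbhs p.1) (nbhs (piW p.2 : SM))); first exact: cvg_fst.
  apply: (@continuous_comp (SG * SW)%type SW SM snd piW p); first exact: cvg_snd.
  exact: whitney_proj_cont.
apply: (@continuous_comp (SG * SW)%type (SG * SE k)%type (SE k)
  (fun p => (p.1, whitney_vec (E := E) p.2 k)) (fun p => b k p.1 p.2) p); last exact: bcont.
apply: (@cvg_pair _ _ _ (nbhs p) (nbhs p.1) (nbhs (whitney_vec (E := E) p.2 k : SE k))).
  exact: cvg_fst.
apply: (@continuous_comp (SG * SW)%type SW (SE k) snd (fun w => whitney_vec (E := E) w k) p).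
  exact: cvg_snd.
exact: whitney_vec_cont.
Qed.

(** The class of [b k] is known in charts of [E k] only. So each component is first carried from its
    trivialization to the chart [e1], then moved by [b k] and trivialized again through the chart
    [e2]. *)
Lemma whitney_action_class : class_map r (prod_data MG D) D (fun p => beta p.1 p.2).
Proof.
have cGW := prod_charted cG cW.
have ccont : @cont_on (manifold_space (prod_data MG D)) SW setT (fun p => beta p.1 p.2).
  by move=> p _; exact: whitney_action_cont.
apply: (@class_onI R K r _ _ (prod_data MG D) D _ _ (@openT (SG * SW)%type) ccont).
move=> hp _ [h Gh [_ [p1 p1P <-] <-]] [p2 p2P <-] {hp}.
have [psi1P pc1 pe1] := p1P; have [psi2P pc2 pe2] := p2P.
have ohp := @class_im_open R K _ _ (prod_data MG D) D _ _ _ _ cGW cW (@openT (SG * SW)%type) ccont.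
set O := chart_im _ _.
have oO : open O.
  apply: ohp; last by exists p2.
  by exists h => //; exists (whitney_chart p1) => //; exists p1.
pose Y := manifold_model MG; have hY : hausdorff_space Y by case: cG.
have hX : hausdorff_space X by case: cM.
have hRF : hausdorff_space RF by exact: hdF.
pose sec (q : Y * (X * RF)) := whitney_sec (param_triv p1) (chart_inv (param_base p1) q.2.1, q.2.2).
have OP q : O q -> [/\ chart_im h setT q.1, chart_im (whitney_chart p1) setT q.2 &
     chart_dom (whitney_chart p2) (beta (chart_inv h q.1) (sec q))].
  have c1' : @is_chart (SG * SW)%type (Y * (X * RF))%type (prod_chart h (whitney_chart p1)).
    by apply: prod_is_chart; [exact: cG.2|apply: cW.2; exists p1].
  move=> /(chart_imP c1')[+ [_ dq]]; rewrite -setXTT prod_chart_im => -[? ?].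
  by split.
have OP1 q : O q -> [/\ chart_im (param_base p1) setT q.2.1,
     param_dom p1 (chart_inv (param_base p1) q.2.1) &
     forall k, chart_dom (param_fibre p1 k) (whitney_vec (sec q) k)].
  by move=> /OP[_ /(whitney_chart_imP p1P)[? ? ? _] _].
have OP2 q : O q -> [/\ param_dom p2 (a (chart_inv h q.1) (whitney_proj (sec q))),
     chart_dom (param_base p2) (a (chart_inv h q.1) (whitney_proj (sec q))) &
     forall k, chart_dom (param_fibre p2 k) (b k (chart_inv h q.1) (whitney_vec (sec q) k))].
  by move=> /OP[_ _ []].
have secP q : O q -> whitney_proj (sec q) = chart_inv (param_base p1) q.2.1.
  by move=> /OP1[_ Uq _]; exact: (whitney_sec_proj psi1P (q := (_, _))).
pose comp1 (q : Y * (X * RF)) : X :=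
  chart_map (param_base p2) (a (chart_inv h q.1) (chart_inv (param_base p1) q.2.1)).
have C1 : of_class r O comp1.
  have cGM := prod_charted cG cM.
  have acont' : @cont_on (manifold_space (prod_data MG MM)) SM setT (fun p => a p.1 p.2).
    by move=> p _; exact: acont.
  have hc1 : manifold_atlas (prod_data MG MM) (prod_chart h (param_base p1)).
    by exists h => //; exists (param_base p1).
  have oV := @class_im_open R K _ _ (prod_data MG MM) MM _ _ _ _ cGM cM
    (@openT (SG * SM)%type) acont' hc1 pc2.
  have [_ /(_ _ _ hc1 pc2) aC] := aP.2.
  have lC : of_class r O (fun q : Y * (X * RF) => (q.1, q.2.1) : (Y * X)%type).
    apply: of_class_linear => //; first exact: hausdorff_pair.
    move=> q; apply: (@cvg_pair _ _ _ (nbhs q) (nbhs q.1) (nbhs q.2.1)); first exact: cvg_fst.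
    apply: (@continuous_comp (Y * (X * RF))%type (X * RF)%type X snd fst q); first exact: cvg_snd.
    exact: cvg_fst.
  have lV q : O q -> chart_im (prod_chart h (param_base p1))
      (setT `&` (fun p => a p.1 p.2) @^-1` chart_dom (param_base p2)) (q.1, q.2.1).
    move=> Oq; apply/(chart_imP (cGM.2 _ hc1)); split.
      rewrite -setXTT prod_chart_im; have [? _ _] := OP q Oq; have [? _ _] := OP1 q Oq.
      by split.
    by split => //; rewrite /= -secP//; have [] := OP2 q Oq.
  exact: (of_class_comp (hausdorff_pair hY hX) hX oO oV lV lC aC).
pose comp2 (q : Y * (X * RF)) : RF := fun k =>
  (param_triv p2 (b k (chart_inv h q.1) (whitney_vec (sec q) k))).2.
have C2 : of_class r O comp2.
  apply: (of_class_product _ oO (restrict_dprod_product incl F)) => [k|k]; first exact: hF.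
  have [g [gC gK _]] := triv_inv (psi1P k).
  have cE := bundle_charted (hE k).
  have cGE := prod_charted cG cE.
  have ctk : charted (tdk k) by exact: trivial_charted.
  pose Fk : tvsType _ := restrict_scalars incl (bundle_typical (E k)).
  have hFk : hausdorff_space Fk by exact: hF.
  pose lc (c : chart M X) : chart (M * bundle_typical (E k)) (X * Fk) :=
    prod_chart c (Chart setT id id : chart (bundle_typical (E k)) Fk).
  have lcP c : manifold_atlas MM c -> manifold_atlas (tdk k) (lc c).
    by move=> Mc; exists c => //; exists (Chart setT id id).
  pose e1 := param_fibre p1 k; pose e2 := param_fibre p2 k.
  have oU1T : open (param_dom p1 `*` setT : set (manifold_space (tdk k))).
    by apply: trivial_open; exact: (family_open psi1P).
  have oU2A : open (bundle_proj (E k) @^-1` param_dom p2 : set (SE k)).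
    apply: (bundle_preimage_open (hE k)); exact: (family_open psi2P).
  have gcont := class_on_cont oU1T gC.
  have pC := triv_class (psi2P k).
  have pcont := class_on_cont oU2A pC.
  have secE q : O q -> whitney_vec (sec q) k = g (chart_inv (param_base p1) q.2.1, q.2.2 k).
    by move=> /OP1[_ U1q _]; exact: (whitney_sec_vec psi1P (q := (_, _)) gK).
  pose Yk := manifold_model (bundle_data (E k)); have hYk : hausdorff_space Yk by case: cE.
  (* From the trivialization to the chart [e1], by the inverse [g]. *)
  have S1 : of_class r O (fun q : Y * (X * RF) => chart_map e1 (whitney_vec (sec q) k) : Yk).
    have lC : of_class r O (fun q : Y * (X * RF) => (q.2.1, q.2.2 k) : (X * Fk)%type).
      apply: of_class_linear => //; first exact: hausdorff_pair.
      have c2 : continuous (snd : (Y * (X * RF))%type -> (X * RF)%type) by move=> q; exact: cvg_snd.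
      move=> q; apply: (@cvg_pair _ _ _ (nbhs q) (nbhs q.2.1) (nbhs (q.2.2 k : Fk))).
        apply: (@continuous_comp (Y * (X * RF))%type (X * RF)%type X snd fst q); first exact: c2.
        exact: cvg_fst.
      apply: (@continuous_comp (Y * (X * RF))%type RF Fk (fun q => q.2.2) (fun h => h k) q).
        apply: (@continuous_comp (Y * (X * RF))%type (X * RF)%type RF snd snd q); first exact: c2.
        exact: cvg_snd.
      exact: dprod_eval_continuous.
    have oV := class_im_open ctk cE oU1T gcont (lcP _ pc1) (pe1 k).
    have [_ /(_ _ _ (lcP _ pc1) (pe1 k)) gC'] := gC.
    have lV q : O q -> chart_im (lc (param_base p1))
        (param_dom p1 `*` setT `&` g @^-1` chart_dom e1) (q.2.1, q.2.2 k).
      move=> Oq; have [c1q U1q e1q] := OP1 q Oq.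
      apply/(chart_imP (ctk.2 _ (lcP _ pc1))); split.
        by rewrite /lc -setXTT prod_chart_im; split => //; exists (q.2.2 k).
      by split => //; rewrite /= -secE.
    have := of_class_comp (hausdorff_pair hX hFk) hYk oO oV lV lC gC'.
    by apply: of_class_eq => // q Oq; rewrite /= secE.
  have S2 : of_class r O (fun q : Y * (X * RF) =>
      (q.1, chart_map e1 (whitney_vec (sec q) k)) : (Y * Yk)%type).
    apply: of_class_pair => //.
    by apply: of_class_linear => // q; exact: cvg_fst.
  have bcont' : @cont_on (manifold_space (prod_data MG (bundle_data (E k)))) (SE k) setT
      (fun p => b k p.1 p.2) by move=> p _; exact: bcont.
  have [_ bC] := bP k.
  have he1 : manifold_atlas (prod_data MG (bundle_data (E k))) (prod_chart h e1).
    by exists h => //; exists e1 => //; exact: pe1.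
  (* As in [whitney_transition], [B] keeps the moved vector inside the single chart [e2], where
     [param_triv p2] has a coordinate expression. *)
  pose B : set (SE k) := chart_dom e2 `&` (bundle_proj (E k) @^-1` param_dom p2 `&`
    param_triv p2 (k := k) @^-1` chart_dom (lc (param_base p2))).
  have oB : open B.
    apply: openI; first exact: (chart_dom_open (cE.2 _ (pe2 k))).
    apply: (open_preimage_on oU2A pcont).
    exact: (chart_dom_open (ctk.2 _ (lcP _ pc2))).
  pose V := chart_im (prod_chart h e1) (setT `&` (fun p => b k p.1 p.2) @^-1` B).
  have oV : open V.
    apply: (chart_im_open (cGE.2 _ he1)).
    exact: (open_preimage_on (@openT (SG * SE k)%type) bcont' oB).
  have mid : of_class r V (fun x => chart_map (lc (param_base p2))
      (param_triv p2 (b k (chart_inv (prod_chart h e1) x).1 (chart_inv (prod_chart h e1) x).2))).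
    apply: (class_through cGE cE ctk (@openT (SG * SE k)%type) oU2A bC pC he1 (pe2 k)
      (lcP _ pc2) oV) => x.
    by move=> /(chart_imP (cGE.2 _ he1))[cx [_ [ex [U2x px]]]]; split.
  have S3 : of_class r V (fun x =>
      (param_triv p2 (b k (chart_inv (prod_chart h e1) x).1 (chart_inv (prod_chart h e1)
        x).2)).2 : Fk).
    have s2 : of_class r (setT : set (X * Fk)%type) (snd : (X * Fk)%type -> Fk).
      by apply: of_class_linear => //; [exact: openT|move=> x; exact: cvg_snd].
    exact: (of_class_comp (hausdorff_pair hX hFk) hFk oV openT (fun _ _ => I) mid s2).
  have ce1 := cE.2 _ (pe1 k).
  have SV q : O q -> V (q.1, chart_map e1 (whitney_vec (sec q) k)).
    move=> Oq; have [c1q U1q e1q] := OP1 q Oq; have [hq _ _] := OP q Oq.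
    have [U2q c2q e2q] := OP2 q Oq.
    apply/(chart_imP (cGE.2 _ he1)); split.
      by rewrite -setXTT prod_chart_im; split => //; exists (whitney_vec (sec q) k).
    split => //=; rewrite (chart_mapK ce1 (e1q k)); split; first exact: e2q.
    have U2b : param_dom p2 (bundle_proj (E k) (b k (chart_inv h q.1) (whitney_vec (sec q) k))).
      by rewrite ab whitney_vecP.
    by split => //; split => //=; rewrite (triv_fst (psi2P k) U2b) ab whitney_vecP.
  have := of_class_comp (hausdorff_pair hY hYk) hFk oO oV SV S2 S3.
  apply: of_class_eq => // q Oq; have [_ _ e1q] := OP1 q Oq.
  by rewrite /comp2 /= (chart_mapK ce1 (e1q k)).
have := of_class_pair hX hRF oO C1 C2.
apply: of_class_eq => // q Oq.
by rewrite /comp1 -secP.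
Qed.

End action.

End whitney.

Theorem proposition8p2 (R : realType) (L K : base_field)
    (KL : base_subfield K L) (s r : diff_order)
    (hs : s = Cinfty \/ s = Comega) (rs : diff_order_le r s)
    (G : groupType) (MG : manifold_data R K G) (hG : is_lie_group s MG)
    (M : Type) (MM : manifold_data R K M) (a : G -> M -> M)
    (hM : is_G_manifold r MG MM a)
    (n : nat) (n_gt0 : (0 < n)%N)
    (E : 'I_n -> bundle R K L M)
    (b : forall k, G -> bundle_total (E k) -> bundle_total (E k))
    (hE : forall k, is_equivariant_bundle KL r MM MG a (b k)) :
  exists D : manifold_data R K (whitney_total E),
    [/\ is_whitney_structure KL r MM D,
        (forall D' : manifold_data R K (whitney_total E),
           is_whitney_structure KL r MM D' -> diffeo_on r D D' setT setT id) &
        is_equivariant_bundle KL r MM MG a (E := whitney_bundle D)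
          (whitney_action (fun k => equivariant_proj (hE k)))].
Proof.
have [mM aP] := hM; have [mG _ _] := hG.
have vE k := equivariant_bundle (hE k).
exists (whitney_data KL r MM E); split.
- exact: whitney_structure.
- by move=> D' D'P; exact: whitney_unique.
split.
- exact: whitney_vector_bundle.
- split; last first.
    apply: whitney_action_class => //; first exact: manifold_charted mG.
    by move=> k; exact: (equivariant_action (hE k)).
  split=> [w|g h w]; apply: whitney_eq => /=.
  + exact: aP.1.1.
  + by move=> k; have [[b1 _] _] := equivariant_action (hE k); exact: b1.
  + exact: aP.1.2.
  + by move=> k; have [[_ bM] _] := equivariant_action (hE k); exact: bM.
- by [].
move=> g x.
pose h k := cid (equivariant_linear (hE k) g x).
(* On fibres the action is the product of the linear maps chosen for the summands. *)
pose hh (v : whitney_fibre E x) : whitney_fibre E (a g x) := fun k => sval (h k) (v k).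
have hl : linear hh.
  move=> c u v; apply: functional_extensionality_dep => k.
  exact: (linearP (sval (h k))).
have [l lE] := linear_exE hl.
exists l => v; apply: whitney_eq => //= k.
by rewrite -lE; exact: (svalP (h k)).
Qed.
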